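(* The problem $3$-SAT/2-FLIP with lexicographic payoffs is PLS-complete.
   Context: PLS (Polynomial Local Search) is the class of local optimization problems in which a starting feasible solution and the neighborhood of a solution are computable in polynomial time, feasibility is recognizable in polynomial time, and one must output a local optimum (a feasible solution with no strictly better neighbor). PLS-completeness is with respect to PLS-reductions: a pair of polynomial-time functions $(f,g)$ where $f$ maps instances $I$ of $P$ to instances $f(I)$ of $Q$ and $g$ maps any local optimum $s$ of $f(I)$ to a local optimum $g(I,s)$ of $I$. The problem $k$-SAT/$d$-FLIP with lexicographic payoffs: the input is a CNF formula $F=C_1\wedge\dots\wedge C_t$ in which every clause has at most $k$ literals, with clauses listed in order of priority; clause $C_i$ has weight $2^{t-i}$. The payoff of a truth assignment $\alpha$ is the total weight of the clauses it satisfies. The task is to find an assignment $\alpha$ such that no assignment obtained from $\alpha$ by changing the values of at most $d$ variables has strictly larger payoff. *)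

(* Defs.v *)
From mathcomp Require Import all_boot all_order all_algebra.

Set Implicit Arguments.
Unset Strict Implicit.
Unset Printing Implicit Defensive.

Definition bitstring := seq bool.

(* [None] is the blank. *)
Definition symbol := option bool.

Inductive dir := Left | Stay | Right.

(* A tape, infinite in both directions: the cells to the left of the head,
   nearest first, and the cells from the scanned one rightwards.  All cells
   beyond the two lists are blank. *)
Definition tape := (seq symbol * seq symbol)%type.

Definition tape_of (x : bitstring) : tape := ([::], map Some x).

Definition tape_read (t : tape) : symbol := head None t.2.

Definition tape_write (a : symbol) (t : tape) : tape := (t.1, a :: behead t.2).

Definition tape_move (m : dir) (t : tape) : tape :=
  match m with
  | Left => (behead t.1, head None t.1 :: t.2)
  | Stay => t
  | Right => (head None t.2 :: t.1, behead t.2)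
  end.

(* The bits from the head rightwards up to the first blank. *)
Fixpoint leading_bits (r : seq symbol) : bitstring :=
  if r is Some b :: r' then b :: leading_bits r' else [::].

(* A deterministic Turing machine with [ntapes.+1] tapes, so that there is
   always an output tape. *)
Record machine := Machine {
  ntapes : nat;
  state : finType;
  start_state : state;
  halting : pred state;
  delta : state -> {ffun 'I_ntapes.+1 -> symbol} ->
          state * {ffun 'I_ntapes.+1 -> symbol * dir}
}.

Definition config (M : machine) : Type :=
  (state M * {ffun 'I_(ntapes M).+1 -> tape})%type.

Definition step (M : machine) (c : config M) : config M :=
  if halting c.1 then c else
  let qa := delta c.1 [ffun i => tape_read (c.2 i)] in
  (qa.1, [ffun i => tape_move (qa.2 i).2 (tape_write (qa.2 i).1 (c.2 i))]).

(* The i-th input string is on the i-th tape, the other tapes are blank. *)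
Definition init_config (M : machine) (xs : seq bitstring) : config M :=
  (start_state M, [ffun i : 'I_(ntapes M).+1 => tape_of (nth [::] xs i)]).

(* The output is read on the last tape. *)
Definition output (M : machine) (c : config M) : bitstring :=
  leading_bits (c.2 ord_max).2.

Definition computes_within (M : machine) (t : nat)
    (xs : seq bitstring) (y : bitstring) : Prop :=
  let c := iter t (@step M) (init_config M xs) in
  halting c.1 /\ output c = y.

Definition poly_eval (p : {poly nat}) (n : nat) : nat := p.[n]%R.

(* One machine, in time polynomial in the total input length, maps the strings
   [inp a] to the string [out a], for every [a] in the domain [D]. *)
Definition polytime (A : Type) (D : A -> Prop)
    (inp : A -> seq bitstring) (out : A -> bitstring) : Prop :=
  exists (M : machine) (p : {poly nat}), forall a : A, D a ->
    computes_within M (poly_eval p (sumn (map size (inp a)))) (inp a) (out a).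

Definition prefix_code (A : Type) (e : A -> bitstring) : Prop :=
  forall (x y : A) (u v : bitstring), e x ++ u = e y ++ v -> x = y /\ u = v.

Definition encode_bit (b : bool) : bitstring := [:: b].

Definition encode_unary (n : nat) : bitstring := rcons (nseq n true) false.

Definition encode_seq (A : Type) (e : A -> bitstring) (s : seq A) : bitstring :=
  foldr (fun a r => true :: e a ++ r) [:: false] s.

Definition encode_strings : seq bitstring -> bitstring :=
  encode_seq (encode_seq encode_bit).

(* The number with the given binary digits, least significant first. *)
Definition bits_value (x : bitstring) : nat :=
  foldr (fun (b : bool) n => b + n.*2) 0 x.

Lemma encode_unary_prefix : prefix_code encode_unary.
Proof.
elim=> [|m IH] [|n] u v //=; first by case.
by case=> /IH [-> ->].
Qed.

Lemma encode_bit_prefix : prefix_code encode_bit.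
Proof. by move=> x y u v [-> ->]. Qed.

Lemma encode_seq_prefix (A : Type) (e : A -> bitstring) :
  prefix_code e -> prefix_code (encode_seq e).
Proof.
move=> eP; elim=> [|a s IH] [|b t] u v //=; first by case.
by rewrite -!catA; case=> /eP [-> /IH [-> ->]].
Qed.

Lemma prefix_code_inj (A : Type) (e : A -> bitstring) :
  prefix_code e -> injective e.
Proof. by move=> eP x y exy; have [] := eP x y [::] [::]; rewrite ?exy. Qed.

Lemma encode_strings_inj : injective encode_strings.
Proof.
exact/prefix_code_inj/encode_seq_prefix/encode_seq_prefix/encode_bit_prefix.
Qed.

Record local_search := LocalSearch {
  instance : Type;
  encode : instance -> bitstring;
  encode_inj : injective encode;
  feasible : instance -> pred bitstring;
  payoff : instance -> bitstring -> nat;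
  maximizes : bool;
  neighbor : instance -> bitstring -> pred bitstring
}.

Definition better (P : local_search) (I : instance P) (s' s : bitstring) : bool :=
  if maximizes P then payoff I s < payoff I s' else payoff I s' < payoff I s.

Definition local_optimum (P : local_search) (I : instance P) (s : bitstring) :
    Prop :=
  feasible I s /\ forall s', neighbor I s s' -> ~~ better I s' s.

Record in_PLS (P : local_search) : Prop := InPLS {
  PLS_solution_size : exists p : {poly nat}, forall (I : instance P) s,
    feasible I s -> size s <= poly_eval p (size (encode I));
  PLS_neighbor_feasible : forall (I : instance P) s s',
    feasible I s -> neighbor I s s' -> feasible I s';
  PLS_feasible :
    polytime (fun _ : instance P * bitstring => True)
      (fun Is => [:: encode Is.1; Is.2])
      (fun Is => [:: feasible Is.1 Is.2]);
  PLS_start : exists start : instance P -> bitstring,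
    (forall I, feasible I (start I)) /\
    polytime (fun _ : instance P => True) (fun I => [:: encode I]) start;
  PLS_payoff : exists digits : instance P -> bitstring -> bitstring,
    (forall I s, feasible I s -> bits_value (digits I s) = payoff I s) /\
    polytime (fun Is : instance P * bitstring => feasible Is.1 Is.2)
      (fun Is => [:: encode Is.1; Is.2])
      (fun Is => digits Is.1 Is.2);
  PLS_neighborhood : exists nbhd : instance P -> bitstring -> seq bitstring,
    (forall I s, feasible I s ->
       forall s', (s' \in nbhd I s) = neighbor I s s') /\
    polytime (fun Is : instance P * bitstring => feasible Is.1 Is.2)
      (fun Is => [:: encode Is.1; Is.2])
      (fun Is => encode_strings (nbhd Is.1 Is.2))
}.

Definition PLS_reduction (P Q : local_search)
    (f : instance P -> instance Q)
    (g : instance P -> bitstring -> bitstring) : Prop :=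
  [/\ polytime (fun _ : instance P => True)
        (fun I => [:: encode I]) (fun I => encode (f I)),
      polytime (fun Is : instance P * bitstring => feasible (f Is.1) Is.2)
        (fun Is => [:: encode Is.1; Is.2]) (fun Is => g Is.1 Is.2)
    & forall I s, local_optimum (f I) s -> local_optimum I (g I s)].

Definition PLS_reducible (P Q : local_search) : Prop :=
  exists (f : instance P -> instance Q)
         (g : instance P -> bitstring -> bitstring), PLS_reduction f g.

Definition PLS_complete (Q : local_search) : Prop :=
  in_PLS Q /\ forall P : local_search, in_PLS P -> PLS_reducible P Q.

(* [(i, true)] is the variable x_i and [(i, false)] its negation. *)
Definition literal := (nat * bool)%type.
Definition clause := seq literal.

(* The variables of [F] are x_i for i < nvars F, and an assignment is the
   bitstring of their values. *)
Record cnf := CNF { nvars : nat; clauses : seq clause }.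

Definition kcnf (k : nat) (F : cnf) : bool :=
  all (fun C : clause =>
         (size C <= k) && all (fun l : literal => l.1 < nvars F) C)
      (clauses F).

Definition sat_literal (a : bitstring) (l : literal) : bool :=
  nth false a l.1 == l.2.

Definition sat_clause (a : bitstring) (C : clause) : bool :=
  has (sat_literal a) C.

(* The clause of index i counted from 0 is C_(i+1), of weight 2^(t-(i+1)). *)
Definition lex_payoff (F : cnf) (a : bitstring) : nat :=
  \sum_(i < size (clauses F))
     sat_clause a (nth [::] (clauses F) i) * 2 ^ (size (clauses F) - i.+1).

Definition is_assignment (F : cnf) (a : bitstring) : bool := size a == nvars F.

Definition flips (a b : bitstring) : nat :=
  count (fun xy : bool * bool => xy.1 != xy.2) (zip a b).

Definition flip_neighbor (d : nat) (F : cnf) (a b : bitstring) : bool :=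
  is_assignment F b && (flips a b <= d).

(* Variable indices and the number of variables are written in unary, so that
   assignments have length linear in the size of the encoded formula. *)
Definition encode_literal (l : literal) : bitstring :=
  encode_unary l.1 ++ encode_bit l.2.

Definition encode_cnf (F : cnf) : bitstring :=
  encode_unary (nvars F) ++ encode_seq (encode_seq encode_literal) (clauses F).

Lemma encode_literal_prefix : prefix_code encode_literal.
Proof.
move=> [i a] [j b] u v; rewrite /encode_literal -!catA /=.
by case/encode_unary_prefix=> -> [-> ->].
Qed.

Lemma encode_cnf_inj : injective encode_cnf.
Proof.
move=> [m Cs] [n Ds] /encode_unary_prefix [/= -> eqCD]; congr CNF.
by apply: prefix_code_inj eqCD; do 2!apply: encode_seq_prefix;
   apply: encode_literal_prefix.
Qed.

Definition encode_kcnf (k : nat) (F : {F : cnf | kcnf k F}) : bitstring :=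
  encode_cnf (sval F).

Lemma encode_kcnf_inj (k : nat) : injective (@encode_kcnf k).
Proof.
by move=> [F kF] [G kG] /encode_cnf_inj /= FG; subst G; congr exist;
   apply: bool_irrelevance.
Qed.

Definition lex_SAT_FLIP (k d : nat) : local_search :=
  {| instance := {F : cnf | kcnf k F};
     encode := @encode_kcnf k;
     encode_inj := @encode_kcnf_inj k;
     feasible := fun F => is_assignment (sval F);
     payoff := fun F => lex_payoff (sval F);
     maximizes := true;
     neighbor := fun F => flip_neighbor d (sval F) |}.

(* Main.v *)
From Stdlib Require Import FunctionalExtensionality.
From mathcomp Require Import all_boot all_order all_algebra zify.
Require Import Defs.

Set Implicit Arguments.
Unset Strict Implicit.
Unset Printing Implicit Defensive.

(** Hardness.  Given a problem in PLS, a uniform circuit maps the code of a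
    solution to the code of a better neighbour (if there is one) followed by
    the value of the solution.  The formula contains two copies of this
    circuit, the variable [f] telling which one is active, and output variables
    [o_j].  In order of priority, its clauses ask
    - that the gates of the active copy be correct,
    - for [j = 0, 1, ...], that [o_j] be the [j]-th value bit of the active
      copy, and then that [o_j] be true,
    - that the input of the inactive copy be the better neighbour computed by
      the active one, and that the gates of the inactive copy be correct.
    An incorrect gate can be repaired at the expense of later clauses only, so
    at a local optimum both copies compute correctly.  If the inactive copy
    holds a better solution and [j] is the first value bit where the two copies
    differ, flipping [f] and [o_j] together improves the payoff: this is where
    two flips are needed.  They are also needed to keep clauses short: the
    clause [~w \/ ~y \/ z] of a gate [z = w /\ y] has no room for a guard
    depending on [f], so it stays in force in the inactive copy, and a change of
    [w] or [y] there is made together with a change of [z].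

    Polynomial time.  Functions are written in a small language of register
    programs on strings, closed under composition, case analysis and bounded
    loops; this language and the multitape Turing machines simulate each other. *)

(** * Register programs on strings *)

(** Two flips suffice only because every gate owns private copies of its inputs. If a wire fed
    several gates directly, changing it in the inactive copy could force many conjunctions to change
    at once, through the clauses that stay in force there. With private copies each variable occurs
    in the unguarded clause of at most one gate, while the equality of a private copy with its wire
    fits into three literals together with a guard and can be switched off.

    Turing machines occur at both ends: membership of the given problem supplies them, and the
    reduction has to produce them. The circuit simulates neither of these but a machine compiled
    from a register program. Its registers are stacks, so all action takes place at position 0 and
    no head has to be tracked: position [j] at the next instant depends on positions 0, [j - 1], [j]
    and [j + 1] only.

    The inputs of a copy range over all bitstrings, most of which code no feasible solution.
    Decoding is therefore total, and the leading value bit is feasibility, so that a bad code is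
    always improved by the starting solution. *)

Definition store := nat -> bitstring.

Definition upd (s : store) (r : nat) (x : bitstring) : store :=
  fun i => if i == r then x else s i.

Inductive cmd :=
  | Skip
  | Push (r : nat) (b : bool)
  | Pop (r : nat)
  | Seq (c1 c2 : cmd)
  | Case (r : nat) (c0 c1 c2 : cmd)
  | While (r : nat) (c : cmd).

Notation "c1 ;; c2" := (Seq c1 c2) (at level 61, right associativity).

Definition by_head (T : Type) (x : bitstring) (t0 t1 t2 : T) : T :=
  match x with [::] => t0 | true :: _ => t1 | false :: _ => t2 end.

(* The number counts the steps of the code compiled from the command, jumps
   included. *)
Inductive exec : cmd -> store -> nat -> store -> Prop :=
  | ESkip s : exec Skip s 0 s
  | EPush s r b : exec (Push r b) s 1 (upd s r (b :: s r))
  | EPop s r : exec (Pop r) s 1 (upd s r (behead (s r)))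
  | ESeq c1 c2 s n1 s1 n2 s2 :
      exec c1 s n1 s1 -> exec c2 s1 n2 s2 -> exec (c1 ;; c2) s (n1 + n2) s2
  | ECase s r c0 c1 c2 n s' :
      exec (by_head (s r) c0 c1 c2) s n s' -> exec (Case r c0 c1 c2) s n.+2 s'
  | EWhile0 s r c : s r = [::] -> exec (While r c) s 1 s
  | EWhile1 s r c n1 s1 n2 s2 :
      s r <> [::] -> exec c s n1 s1 -> exec (While r c) s1 n2 s2 ->
      exec (While r c) s (n1 + n2).+2 s2.

Definition run (c : cmd) (s : store) (N : nat) (s' : store) : Prop :=
  exists2 n, n <= N & exec c s n s'.

Lemma run_le c s N N' s' : N <= N' -> run c s N s' -> run c s N' s'.
Proof. by move=> le [n ln e]; exists n => //; apply: leq_trans le. Qed.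

Lemma run_eq c s N s1 s2 : s1 =1 s2 -> run c s N s1 -> run c s N s2.
Proof. by move/functional_extensionality->. Qed.

Lemma run_skip s : run Skip s 0 s.
Proof. by exists 0 => //; constructor. Qed.

Lemma run_push s r b : run (Push r b) s 1 (upd s r (b :: s r)).
Proof. by exists 1 => //; constructor. Qed.

Lemma run_pop s r : run (Pop r) s 1 (upd s r (behead (s r))).
Proof. by exists 1 => //; constructor. Qed.

Lemma run_seq c1 c2 s N1 s1 N2 s2 :
  run c1 s N1 s1 -> run c2 s1 N2 s2 -> run (c1 ;; c2) s (N1 + N2) s2.
Proof.
move=> [n1 l1 e1] [n2 l2 e2]; exists (n1 + n2); first exact: leq_add.
by constructor 4 with s1.
Qed.

Lemma run_case s r c0 c1 c2 N s' :
  run (by_head (s r) c0 c1 c2) s N s' -> run (Case r c0 c1 c2) s N.+2 s'.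
Proof. by move=> [n l e]; exists n.+2 => //; constructor. Qed.

Lemma run_while0 s r c : s r = [::] -> run (While r c) s 1 s.
Proof. by move=> e; exists 1 => //; constructor. Qed.

Lemma run_while1 s r c N1 s1 N2 s2 :
  s r <> [::] -> run c s N1 s1 -> run (While r c) s1 N2 s2 ->
  run (While r c) s (N1 + N2).+2 s2.
Proof.
move=> ne [n1 l1 e1] [n2 l2 e2]; exists (n1 + n2).+2; first by rewrite !ltnS leq_add.
by constructor 7 with s1.
Qed.

Lemma updE s r x i : upd s r x i = if i == r then x else s i.
Proof. by []. Qed.

Lemma upd_eq s r x : upd s r x r = x.
Proof. by rewrite updE eqxx. Qed.

Lemma upd_ne s r x i : i != r -> upd s r x i = s i.
Proof. by rewrite updE => /negPf->. Qed.

Lemma upd_id s r : upd s r (s r) = s.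
Proof. by apply: functional_extensionality => i; rewrite updE; case: eqP => // ->. Qed.

Lemma updd s r x y : upd (upd s r x) r y = upd s r y.
Proof. by apply: functional_extensionality => i; rewrite !updE; case: eqP. Qed.

(** * Clearing, moving and copying registers *)

Definition clear r := While r (Pop r).

Lemma run_clear r s : run (clear r) s (3 * size (s r) + 1) (upd s r [::]).
Proof.
move def_x: (s r) => x; elim: x s def_x => [|b x IH] s def_x.
  by rewrite -{2}def_x upd_id; apply: run_while0.
have -> : 3 * size (b :: x) + 1 = (1 + (3 * size x + 1)).+2 by move=> /=; lia.
apply: run_while1 (run_pop _ _) _; first by rewrite def_x.
by rewrite def_x /=; have := IH (upd s r x); rewrite updd updE eqxx; apply.
Qed.

Definition mvrev r1 r2 :=
  While r1 (Case r1 Skip (Push r2 true) (Push r2 false) ;; Pop r1).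

Lemma run_mvrev r1 r2 s : r1 != r2 ->
  run (mvrev r1 r2) s (6 * size (s r1) + 1)
    (upd (upd s r1 [::]) r2 (catrev (s r1) (s r2))).
Proof.
move=> r12; move def_x: (s r1) => x; elim: x s def_x => [|b x IH] s def_x.
  rewrite -{2}def_x upd_id /= upd_id; exact: run_while0.
have -> : 6 * size (b :: x) + 1 = ((1.+2 + 1) + (6 * size x + 1)).+2
  by move=> /=; lia.
apply: run_while1; first by rewrite def_x.
- apply: run_seq; last exact: run_pop.
  apply: run_case; rewrite def_x; case: b {def_x} => /=; exact: run_push.
- set s1 := upd _ r1 _; rewrite -/(mvrev r1 r2).
  have e1 : s1 r1 = x.
    by rewrite /s1 !updE eqxx /upd (negPf r12) def_x.
  have e2 : s1 r2 = b :: s r2.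
    by rewrite /s1 /upd eq_sym (negPf r12) eqxx; case: (b).
  have := IH _ e1; rewrite e2; apply: run_eq => i; rewrite /s1 /upd.
  by case: eqP => // ir2; case: eqP => // ir1; case: eqP.
Qed.

(** Registers are stacks, so one pass reverses; the second pass, out of the empty scratch register
    [t], restores the order. The result lands in front of the old content of [r2], which is also how
    concatenation is obtained. *)
Definition mv r1 r2 t := mvrev r1 t ;; mvrev t r2.

Lemma run_mv r1 r2 t s : r1 != t -> r2 != t -> r1 != r2 -> s t = [::] ->
  run (mv r1 r2 t) s (12 * size (s r1) + 2)
    (upd (upd s r1 [::]) r2 (s r1 ++ s r2)).
Proof.
move=> r1t r2t r12 st.
have -> : 12 * size (s r1) + 2 = (6 * size (s r1) + 1) + (6 * size (s r1) + 1) by lia.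
apply: run_seq (run_mvrev _ r1t) _.
set s1 := upd _ t _.
have e1 : s1 t = rev (s r1) by rewrite /s1 updE eqxx st.
have e2 : s1 r2 = s r2 by rewrite /s1 /upd (negPf r2t) eq_sym (negPf r12).
have := @run_mvrev t r2 s1; rewrite eq_sym => /(_ r2t).
rewrite e1 e2 size_rev catrevE revK; apply: run_eq => i; rewrite /s1 /upd.
case: (eqVneq i r2) => // _; case: (eqVneq i t) => // -> .
by rewrite eq_sym (negPf r1t) st.
Qed.

Definition cp r1 r2 t :=
  mvrev r1 t ;;
  While t (Case t Skip (Push r1 true ;; Push r2 true)
                       (Push r1 false ;; Push r2 false) ;; Pop t).

Lemma run_cp r1 r2 t s : r1 != t -> r2 != t -> r1 != r2 -> s t = [::] ->
  run (cp r1 r2 t) s (13 * size (s r1) + 2) (upd s r2 (s r1 ++ s r2)).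
Proof.
move=> r1t r2t r12 st.
have -> : 13 * size (s r1) + 2 = (6 * size (s r1) + 1) + (7 * size (s r1) + 1) by lia.
apply: run_seq (run_mvrev _ r1t) _.
rewrite st.
have loop : forall x s0, s0 t = x -> run (While t
    (Case t Skip (Push r1 true ;; Push r2 true)
       (Push r1 false ;; Push r2 false) ;; Pop t)) s0 (7 * size x + 1)
    (upd (upd (upd s0 t [::]) r1 (catrev x (s0 r1))) r2 (catrev x (s0 r2))).
  elim=> [|b x IH] s0 e0.
    rewrite -{2}e0 upd_id /= !upd_id; exact: run_while0.
  have -> : 7 * size (b :: x) + 1 = (((1 + 1).+2 + 1) + (7 * size x + 1)).+2
    by move=> /=; lia.
  apply: run_while1; first by rewrite e0.
  - apply: run_seq; last exact: run_pop.
    apply: run_case; rewrite e0; case: b {e0} => /=;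
    exact: (run_seq (run_push _ _ _) (run_push _ _ _)).
  - set s1 := upd _ t _.
    have e1 : s1 t = x.
      by rewrite /s1 /upd eqxx !(eq_sym t) (negPf r1t) (negPf r2t) e0.
    have := IH _ e1; apply: run_eq => i; rewrite /s1 /upd.
    rewrite !(eq_sym r2 r1) (negPf r12) eqxx (negPf r1t) (negPf r2t) eqxx.
    case: (eqVneq i r2) => [_|ir2]; first by case: (b).
    case: (eqVneq i r1) => [_|ir1]; first by case: (b).
    by case: (eqVneq i t).
set s1 := upd _ t _.
have e1 : s1 t = rev (s r1) by rewrite /s1 updE eqxx.
have := loop _ _ e1; rewrite size_rev; apply: run_eq => i; rewrite /s1 /upd.
rewrite (negPf r1t) eqxx (negPf r2t) eq_sym; rewrite (eq_sym r2 r1) (negPf r12).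
rewrite !catrevE revK cats0.
case: (eqVneq r2 i) => // ir2; case: (eqVneq i r1) => [->//|ir1].
by case: (eqVneq i t) => // ->.
Qed.

(** A step pushes at most one bit. Time bounds thus yield bounds on the size of outputs, which need
    not be carried along separately. *)
Lemma exec_growth c s n s' r : exec c s n s' -> size (s' r) <= size (s r) + n.
Proof.
elim=> {c s n s'} //=; try lia.
- by move=> s r' b; rewrite updE; case: eqP => [->|] /=; lia.
- by move=> s r' ; rewrite updE; case: eqP => [->|] /=; rewrite ?size_behead; lia.
Qed.

(** Relocation: a program becomes a subroutine working on a block of registers beyond those of its
    caller. *)
Fixpoint shift (M : nat) (c : cmd) : cmd :=
  match c with
  | Skip => Skip
  | Push r b => Push (M + r) b
  | Pop r => Pop (M + r)
  | c1 ;; c2 => shift M c1 ;; shift M c2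
  | Case r c0 c1 c2 => Case (M + r) (shift M c0) (shift M c1) (shift M c2)
  | While r c => While (M + r) (shift M c)
  end.

Definition above (M : nat) (t s : store) : store :=
  fun r => if r < M then t r else s (r - M).

Lemma above_shift M t s r : above M t s (M + r) = s r.
Proof. by rewrite /above ltnNge leq_addr /= addKn. Qed.

Lemma above_upd M t s r x : above M t (upd s r x) = upd (above M t s) (M + r) x.
Proof.
apply: functional_extensionality => i; rewrite /above /upd.
case: ltnP => iM; first by case: eqP => //; lia.
by have -> : (i - M == r) = (i == M + r) by lia.
Qed.

Lemma run_shift M t c s N s' :
  run c s N s' -> run (shift M c) (above M t s) N (above M t s').
Proof.
move=> [n ln e]; exists n => //; elim: e => {c s n s' N ln} /=.
- by move=> s; constructor.
- by move=> s r b; rewrite above_upd -(above_shift M t s r); constructor.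
- by move=> s r; rewrite above_upd -(above_shift M t s r); constructor.
- by move=> c1 c2 s n1 s1 n2 s2 _ e1 _ e2; constructor 4 with (above M t s1).
- move=> s r c0 c1 c2 n s' _ e; constructor; rewrite above_shift.
  by case: (s r) e => [|[] ?].
- by move=> s r c e; constructor; rewrite above_shift.
- move=> s r c n1 s1 n2 s2 ne _ e1 _ e2; constructor 7 with (above M t s1) => //.
  by rewrite above_shift.
Qed.

(** * Functions computed by register programs in polynomial time *)

(** [A] is an arbitrary type of abstract inputs, which programs see only through the functions of
    [env]. Programs can be composed in this way without fixing an encoding of [A]. *)
Definition st (A : Type) (env : seq (A -> bitstring)) (a : A) : store :=
  fun i => nth (fun=> [::]) env i a.

Definition env_size (A : Type) (env : seq (A -> bitstring)) (a : A) : nat :=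
  sumn [seq size (g a) | g <- env].

Lemma st_out (A : Type) (env : seq (A -> bitstring)) a i :
  size env <= i -> st env a i = [::].
Proof. by move=> le; rewrite /st nth_default. Qed.

Lemma upd_st_nil (A : Type) (env : seq (A -> bitstring)) a :
  upd (st env a) (size env) [::] = st env a.
Proof. by rewrite -{2}(upd_id (st env a) (size env)) st_out. Qed.

Lemma st_rcons (A : Type) (env : seq (A -> bitstring)) o a :
  st (rcons env o) a = upd (st env a) (size env) (o a).
Proof.
apply: functional_extensionality => i; rewrite /st /upd nth_rcons.
by case: ltngtP => // h; rewrite nth_default // ltnW.
Qed.

Lemma st_cat (A : Type) (env env' : seq (A -> bitstring)) a :
  st (env ++ env') a = above (size env) (st env a) (st env' a).
Proof. by apply: functional_extensionality => i; rewrite /st /above nth_cat; case: ltnP. Qed.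

Lemma st_map (A B : Type) (h : A -> B) (env : seq (B -> bitstring)) a :
  st [seq (fun a => g (h a)) | g <- env] a = st env (h a).
Proof.
apply: functional_extensionality => i; rewrite /st.
by elim: env i => [|g env IH] [|i] //=.
Qed.

Lemma env_size_rcons (A : Type) (env : seq (A -> bitstring)) o a :
  env_size (rcons env o) a = env_size env a + size (o a).
Proof. by rewrite /env_size map_rcons sumn_rcons. Qed.

Lemma env_size_cat (A : Type) (env env' : seq (A -> bitstring)) a :
  env_size (env ++ env') a = env_size env a + env_size env' a.
Proof. by rewrite /env_size map_cat sumn_cat. Qed.

Lemma env_size_map (A B : Type) (h : A -> B) (env : seq (B -> bitstring)) a :
  env_size [seq (fun a => g (h a)) | g <- env] a = env_size env (h a).
Proof. by rewrite /env_size -map_comp. Qed.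

Lemma size_st_le (A : Type) (env : seq (A -> bitstring)) a i :
  size (st env a i) <= env_size env a.
Proof.
rewrite /st /env_size; elim: env i => [|g env IH] [|i] //=; first exact: leq_addr.
by apply: leq_trans (IH i) (leq_addl _ _).
Qed.

(** One shape of bound is enough: since the base is at least 2, these powers absorb constants and
    are closed under sum, product and composition. They are also easy to compute in unary, as clocks
    require. *)
Definition pbounded (A : Type) (D : A -> Prop) (env : seq (A -> bitstring))
    (T : A -> nat) : Prop :=
  exists k, forall a, D a -> T a <= (env_size env a + 2) ^ k.

Lemma pow_add n k l : (n + 2) ^ k + (n + 2) ^ l <= (n + 2) ^ (k + l + 1).
Proof.
rewrite addn1 expnS; apply: (@leq_trans (2 * (n + 2) ^ (k + l))); last first.
  by rewrite leq_mul2r leq_addl orbT.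
have h j : 0 < (n + 2) ^ j by rewrite expn_gt0 addn2.
rewrite mul2n -addnn expnD; apply: leq_add.
  by rewrite leq_pmulr.
by rewrite leq_pmull.
Qed.

Lemma pow_comp x n k l : x <= (n + 2) ^ k -> (x + 2) ^ l <= (n + 2) ^ ((k + 2) * l).
Proof.
move=> le; rewrite expnM; case: l => [|l] //; rewrite leq_exp2r //.
have h j : 0 < (n + 2) ^ j by rewrite expn_gt0 addn2.
rewrite expnD; have := h k.
have : 4 <= (n + 2) ^ 2 by rewrite -[4]/(2 ^ 2) leq_exp2r // leq_addl.
move: le; set y := (n + 2) ^ k; set z := (n + 2) ^ 2; nia.
Qed.

Lemma pb_le (A : Type) (D : A -> Prop) env (T T' : A -> nat) :
  pbounded D env T' -> (forall a, D a -> T a <= T' a) -> pbounded D env T.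
Proof. by move=> [k b] le; exists k => a Da; apply: leq_trans (le a Da) (b a Da). Qed.

Lemma pb_add (A : Type) (D : A -> Prop) env (T T' : A -> nat) :
  pbounded D env T -> pbounded D env T' -> pbounded D env (fun a => T a + T' a).
Proof.
move=> [k b] [l b']; exists (k + l + 1) => a Da.
by apply: leq_trans (leq_add (b a Da) (b' a Da)) (pow_add _ _ _).
Qed.

Lemma pb_mul (A : Type) (D : A -> Prop) env (T T' : A -> nat) :
  pbounded D env T -> pbounded D env T' -> pbounded D env (fun a => T a * T' a).
Proof.
by move=> [k b] [l b']; exists (k + l) => a Da; rewrite expnD leq_mul ?b ?b'.
Qed.

Lemma pb_const (A : Type) (D : A -> Prop) env c :
  @pbounded A D env (fun=> c).
Proof.
exists c => a _; apply: leq_trans (ltnW (ltn_expl c (isT : 1 < 2))) _.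
by case: c => // c; rewrite leq_exp2r // leq_addl.
Qed.

Lemma pb_size (A : Type) (D : A -> Prop) env : @pbounded A D env (env_size env).
Proof. by exists 1 => a _; rewrite expn1 leq_addr. Qed.

Lemma pb_comp (A B : Type) (DA : A -> Prop) envA (DB : B -> Prop) envB
    (h : A -> B) (T : B -> nat) :
  (forall a, DA a -> DB (h a)) -> pbounded DB envB T ->
  pbounded DA envA (fun a => env_size envB (h a)) ->
  pbounded DA envA (fun a => T (h a)).
Proof.
move=> dom [l b] [k b']; exists ((k + 2) * l) => a Da.
by apply: leq_trans (b _ (dom _ Da)) (pow_comp _ (b' a Da)).
Qed.

(* [FP D env o]: a command computes [o a] in polynomial time, for [a] in [D],
   from the registers [env] into the first free register; all other registers
   are left as they were. *)
Definition FP (A : Type) (D : A -> Prop) (env : seq (A -> bitstring))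
    (o : A -> bitstring) : Prop :=
  exists c T, pbounded D env T /\ forall a, D a ->
    run c (st env a) (T a) (upd (st env a) (size env) (o a)).

Definition FPs (A : Type) (D : A -> Prop) (env os : seq (A -> bitstring)) : Prop :=
  exists c T, pbounded D env T /\ forall a, D a ->
    run c (st env a) (T a) (st (env ++ os) a).

Lemma FP_pb (A : Type) (D : A -> Prop) env (o : A -> bitstring) :
  FP D env o -> pbounded D env (fun a => size (o a)).
Proof.
move=> [c [T [bT h]]]; apply: (pb_le bT) => a Da.
have [n le e] := h a Da; have := exec_growth (size env) e.
by rewrite updE eqxx st_out // => /leq_trans; apply.
Qed.

Lemma FP_ext (A : Type) (D : A -> Prop) env (o o' : A -> bitstring) :
  (forall a, D a -> o a = o' a) -> FP D env o -> FP D env o'.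
Proof.
by move=> eq [c [T [bT h]]]; exists c, T; split=> // a Da; rewrite -eq //; apply: h.
Qed.

Lemma FP_sub (A : Type) (D D' : A -> Prop) env (o : A -> bitstring) :
  (forall a, D' a -> D a) -> FP D env o -> FP D' env o.
Proof.
move=> sub [c [T [[k bT] h]]]; exists c, T; split=> [|a Da]; last by apply: h; auto.
by exists k => a Da; apply: bT; auto.
Qed.

Lemma pb_rcons (A : Type) (D : A -> Prop) env (u : A -> bitstring) T :
  FP D env u -> pbounded D (rcons env u) T -> pbounded D env T.
Proof.
move=> fu bT; apply: (pb_comp (h := id) _ bT) => //.
apply: pb_le (pb_add (pb_size D env) (FP_pb fu)) _ => a _.
by rewrite env_size_rcons.
Qed.

Ltac pb := repeat first [ assumption | apply: pb_const | apply: pb_size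
  | apply: pb_add | apply: pb_mul | by apply: FP_pb].

Lemma FP_nil (A : Type) (D : A -> Prop) env : @FP A D env (fun=> [::]).
Proof.
exists Skip, (fun=> 0); split; first exact: pb_const.
by move=> a _; rewrite upd_st_nil; exact: run_skip.
Qed.

Lemma FP_var (A : Type) (D : A -> Prop) env i :
  @FP A D env (fun a => st env a i).
Proof.
case: (ltnP i (size env)) => lt; last first.
  by apply: FP_ext (FP_nil _ _) => a _; rewrite st_out.
exists (cp i (size env) (size env).+1), (fun a => 13 * env_size env a + 2).
split=> [|a Da]; first by pb.
apply: (@run_le _ _ (13 * size (st env a i) + 2)).
  by rewrite leq_add2r leq_mul2l size_st_le.
have := @run_cp i (size env) (size env).+1 (st env a).
rewrite (@st_out _ env a (size env)) // cats0; apply; try lia.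
by rewrite st_out.
Qed.

Lemma FP_cons (A : Type) (D : A -> Prop) env b (u : A -> bitstring) :
  FP D env u -> FP D env (fun a => b :: u a).
Proof.
move=> [c [T [bT h]]]; exists (c ;; Push (size env) b), (fun a => T a + 1).
split=> [|a Da]; first by pb.
have := run_seq (h a Da) (run_push _ (size env) b).
by rewrite updE eqxx updd.
Qed.

Lemma FP_behead (A : Type) (D : A -> Prop) env (u : A -> bitstring) :
  FP D env u -> FP D env (fun a => behead (u a)).
Proof.
move=> [c [T [bT h]]]; exists (c ;; Pop (size env)), (fun a => T a + 1).
split=> [|a Da]; first by pb.
have := run_seq (h a Da) (run_pop _ (size env)).
by rewrite updE eqxx updd.
Qed.

(** The output need not be written as a case expression: each branch may exploit, through its
    restricted domain, what the test has revealed. *)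
Lemma FP_case (A : Type) (D : A -> Prop) env (u o : A -> bitstring) :
  FP D env u ->
  FP (fun a => D a /\ u a = [::]) env o ->
  FP (fun a => D a /\ exists x, u a = true :: x) env o ->
  FP (fun a => D a /\ exists x, u a = false :: x) env o ->
  FP D env o.
Proof.
move=> fu [c0 [T0 [[k0 b0] h0]]] [c1 [T1 [[k1 b1] h1]]] [c2 [T2 [[k2 b2] h2]]].
case: fu (fu) => c [T [bT h]] fu; have bu := FP_pb fu.
set m := size env.
exists (c ;; Case m c0 (clear m ;; c1) (clear m ;; c2)).
(* The running time of a branch is controlled on the domain of that branch only, so the total time
   is stated with the bounding powers. *)
pose K a k := (env_size env a + 2) ^ k.
exists (fun a => T a + ((3 * size (u a) + 1) + (K a k0 + K a k1 + K a k2)).+2).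
split=> [|a Da].
  have bK k : pbounded D env (fun a => K a k) by exists k.
  apply: pb_le (_ : pbounded D env (fun a => T a + ((3 * size (u a) + 1) +
    (K a k0 + K a k1 + K a k2) + 2))) _ => [|a _]; last by rewrite -addn2.
  by pb.
apply: run_seq (h a Da) _; apply: run_case; rewrite updE eqxx.
have e : upd (upd (st env a) m (u a)) m [::] = st env a by rewrite updd upd_st_nil.
have cl : run (clear m) (upd (st env a) m (u a)) (3 * size (u a) + 1) (st env a).
  by have := run_clear m (upd (st env a) m (u a)); rewrite e updE eqxx.
case eu: (u a) => [|[] x] /=.
- rewrite upd_st_nil; apply: run_le (h0 a (conj Da eu)).
  by apply: leq_trans (b0 a (conj Da eu)) _; rewrite /K; lia.
- rewrite eu in cl; apply: run_seq cl _.
  have D' : D a /\ exists x, u a = true :: x by split=> //; exists x.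
  by apply: run_le (h1 a D'); apply: leq_trans (b1 a D') _; rewrite /K; lia.
- rewrite eu in cl; apply: run_seq cl _.
  have D' : D a /\ exists x, u a = false :: x by split=> //; exists x.
  by apply: run_le (h2 a D'); apply: leq_trans (b2 a D') _; rewrite /K; lia.
Qed.

Lemma FPs_nil (A : Type) (D : A -> Prop) env : @FPs A D env [::].
Proof.
exists Skip, (fun=> 0); split; first exact: pb_const.
by move=> a _; rewrite cats0; exact: run_skip.
Qed.

Lemma FPs_cons (A : Type) (D : A -> Prop) env (o : A -> bitstring) os :
  FP D env o -> FPs D (rcons env o) os -> FPs D env (o :: os).
Proof.
move=> fo [c2 [T2 [/(pb_rcons fo) b2 h2]]]; case: fo => c1 [T1 [b1 h1]].
exists (c1 ;; c2), (fun a => T1 a + T2 a); split=> [|a Da]; first by pb.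
apply: run_seq (h1 a Da) _; rewrite -st_rcons -cat_rcons; exact: h2.
Qed.

Definition clears m k := iteri k (fun i c => clear (m + i) ;; c) Skip.

Definition cleared m k (s : store) : store :=
  fun i => if m <= i < m + k then [::] else s i.

Lemma run_clears m k s N : (forall i, i < k -> size (s (m + i)) <= N) ->
  run (clears m k) s (k * (3 * N + 1)) (cleared m k s).
Proof.
rewrite /cleared; elim: k s => [|k IH] s le.
  rewrite mul0n; apply: run_eq (run_skip s) => i.
  by case: andP => //; lia.
rewrite mulSn /=; apply: run_seq.
  apply: run_le (run_clear _ _); have := le k (ltnSn k); lia.
apply: run_eq (IH _ _) => [i|i ik]; rewrite updE.
  case: (eqVneq i (m + k)) => [->|ne].
    by case: andP => //; case: andP => //; lia.
  by have -> : (m <= i < m + k) = (m <= i < m + k.+1) by lia.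
by have := le i (ltnW ik); case: eqP.
Qed.

Lemma env_size_bound (A : Type) (D : A -> Prop) env os :
  @FPs A D env os -> pbounded D env (env_size os).
Proof.
move=> [c [T [bT h]]].
apply: (pb_le (_ : pbounded D env (fun a => size os * T a))); first by pb.
move=> a Da; rewrite /env_size; have [n le e] := h a Da.
have {}h i : size (st os a i) <= T a.
  have := exec_growth (size env + i) e.
  by rewrite st_cat above_shift (@st_out _ env) ?leq_addr // => /leq_trans; apply.
elim: os {e c bT} h => [|o os IH] h //=.
rewrite mulSn leq_add ?(h 0) //; apply: IH => i; exact: (h i.+1).
Qed.

(** Composition: the arguments are computed above the registers of [envA], the relocated program
    runs on them, and its result is moved down once they are cleared. *)
Lemma FP_subst_run (A B : Type) (DA : A -> Prop) envA (DB : B -> Prop) envB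
    (h : A -> B) (o : B -> bitstring) :
  (forall a, DA a -> DB (h a)) ->
  FPs DA envA [seq (fun a => g (h a)) | g <- envB] -> FP DB envB o ->
  FP DA envA (fun a => o (h a)).
Proof.
move=> dom fg fo; have bs := env_size_bound fg.
have {}bs : pbounded DA envA (fun a => env_size envB (h a)).
  by apply: pb_le bs _ => a _; rewrite env_size_map.
have bo := pb_comp dom (FP_pb fo) bs.
case: fo => c2 [T2 [/(pb_comp dom)/(_ bs) b2 h2]].
case: fg => c1 [T1 [b1 h1]].
set m := size envA; set e := size envB.
(* Without arguments the result is already in register [m], and [mv] requires distinct registers. *)
exists (c1 ;; shift m c2 ;; clears m e ;; (if e is e'.+1 then mv (m + e) m (m + e).+1 else Skip)).
exists (fun a => T1 a + (T2 (h a) + (e * (3 * env_size envB (h a) + 1) +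
   (12 * size (o (h a)) + 2)))).
split=> [|a Da]; first by pb.
apply: run_seq (h1 a Da) _.
rewrite st_cat st_map -/m.
apply: run_seq (run_shift _ _ (h2 _ (dom _ Da))) _.
rewrite above_upd -/e.
apply: run_seq.
  apply: (@run_clears _ _ _ (env_size envB (h a))) => i ie.
  by rewrite upd_ne ?above_shift ?size_st_le // -/m; lia.
set s := cleared _ _ _.
have sE i : s i = if i == m + e then o (h a) else st envA a i.
  rewrite /s /cleared updE; case: andP => [[mi im]|ni].
    by rewrite st_out //; case: eqP => //; lia.
  case: eqP => // ne; rewrite /above; case: ltnP => // mi.
  rewrite (@st_out _ envA) // st_out // -/e; lia.
rewrite /e in sE *; case: (size envB) sE => [|e'] sE.
  apply: run_eq (run_le _ (run_skip _)) => // i; rewrite sE /upd addn0 //.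
have := @run_mv (m + e'.+1) m (m + e'.+1).+1 s.
have -> : s (m + e'.+1) = o (h a) by rewrite sE eqxx.
have -> : s m = [::] by rewrite sE st_out //; case: eqP => //; lia.
rewrite cats0 => r; apply: run_eq (r _ _ _ _); try lia; last first.
  by rewrite sE st_out -/m; [case: eqP => //; lia | lia].
move=> i; rewrite !updE sE; case: (eqVneq i m) => // im.
by case: eqP => // ->; rewrite st_out // -/m; lia.
Qed.

Lemma FPs_vars (A : Type) (D : A -> Prop) env pre ext (post : seq (A -> bitstring)) :
  env = pre ++ post -> FPs D (env ++ ext) post.
Proof.
elim: post pre ext => [|g post IH] pre ext def; first exact: FPs_nil.
apply: FPs_cons; last first.
  by rewrite rcons_cat; apply: (IH (rcons pre g)); rewrite cat_rcons.
apply: FP_ext (FP_var _ _ (size pre)) => a _.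
by rewrite /st def -catA nth_cat ltnn subnn.
Qed.

(** A program for [env] writes to the register just after [env], which [ext] now occupies. So [env]
    is copied beyond [ext] and the relocated program runs on the copy. *)
Lemma FP_weak (A : Type) (D : A -> Prop) env ext (o : A -> bitstring) :
  FP D env o -> FP D (env ++ ext) o.
Proof.
apply: (@FP_subst_run _ _ D (env ++ ext) D env id o) => //.
have -> : [seq (fun a : A => g a) | g <- env] = env by rewrite -[RHS]map_id; apply: eq_map.
exact: (@FPs_vars _ _ env [::]).
Qed.

Fixpoint FPall (A : Type) (D : A -> Prop) (env os : seq (A -> bitstring)) : Prop :=
  if os is o :: os' then FP D env o /\ FPall D env os' else True.

Lemma FPall_FPs (A : Type) (D : A -> Prop) env os : @FPall A D env os -> FPs D env os.
Proof.
rewrite -{2}[env]cats0; elim: os [::] => [|o os IH] ext /=; first by move=> _; exact: FPs_nil.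
move=> [fo fos]; apply: FPs_cons; first exact: FP_weak.
rewrite rcons_cat; exact: IH.
Qed.

Lemma FP_subst (A B : Type) (DA : A -> Prop) envA (DB : B -> Prop) envB
    (h : A -> B) (o : B -> bitstring) :
  (forall a, DA a -> DB (h a)) -> FP DB envB o ->
  FPall DA envA [seq (fun a => g (h a)) | g <- envB] ->
  FP DA envA (fun a => o (h a)).
Proof. by move=> dom fo /FPall_FPs fg; apply: FP_subst_run fg fo. Qed.

Lemma FP_cat (A : Type) (D : A -> Prop) env (u v : A -> bitstring) :
  FP D env u -> FP D env v -> FP D env (fun a => u a ++ v a).
Proof.
move=> fu fv; have bu := FP_pb fu.
have bv := FP_pb fv.
have fuv : FPs D env [:: v; u] by apply: FPall_FPs.
case: fuv => c [T [bT h]]; set m := size env.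
exists (c ;; mv m.+1 m m.+2), (fun a => T a + (12 * size (u a) + 2)).
split=> [|a Da]; first by pb.
apply: run_seq (h a Da) _; set s := st _ _.
have sE i : s i = if i == m.+1 then u a else if i == m then v a else st env a i.
  rewrite /s -[[:: v; u]]/([:: v] ++ [:: u]) catA !cats1 !st_rcons size_rcons.
  by rewrite /upd.
have := @run_mv m.+1 m m.+2 s.
have -> : s m.+1 = u a by rewrite sE eqxx.
have -> : s m = v a by rewrite sE eqxx; case: eqP => //; lia.
move=> r; apply: run_eq (r _ _ _ _); try lia; last first.
  by rewrite sE ifN ?ifN ?st_out // -/m; lia.
move=> i; rewrite !updE sE; case: (eqVneq i m) => // im.
by case: eqP => // ->; rewrite st_out // -/m; lia.
Qed.

Definition mvs src dst L t :=
  iteri L (fun i c => mv (src + i) (dst + i) t ;; c) Skip.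

Definition moved src dst L (s : store) : store :=
  fun i => if dst <= i < dst + L then s (src + (i - dst)) else
           if src <= i < src + L then [::] else s i.

Lemma run_mvs src dst L t s N :
  dst + L <= src -> src + L <= t -> s t = [::] ->
  (forall i, i < L -> s (dst + i) = [::]) ->
  (forall i, i < L -> size (s (src + i)) <= N) ->
  run (mvs src dst L t) s (L * (12 * N + 2)) (moved src dst L s).
Proof.
rewrite /moved; elim: L s => [|L IH] s ds sL st0 dst0 le.
  rewrite mul0n; apply: run_eq (run_skip s) => i.
  by case: andP => [|_]; [lia | case: andP => //; lia].
rewrite mulSn /=; apply: run_seq.
  apply: run_le (run_mv _ _ _ st0); try lia; have := le L (ltnSn L); lia.
rewrite (dst0 L) // cats0; apply: run_eq (IH _ _ _ _ _ _) => [i|||||]; try lia.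
- rewrite /upd; case: (eqVneq i (dst + L)) => [->|ne].
    rewrite ifN; last lia.
    rewrite ifN; last lia.
    rewrite ifT; last lia.
    by congr (s _); lia.
  have -> : (dst <= i < dst + L) = (dst <= i < dst + L.+1) by lia.
  case: andP => [[l1 l2]|nd].
    rewrite ifN; last lia.
    by rewrite ifN; last lia.
  case: (eqVneq i (src + L)) => [->|ne']; first by rewrite if_same ifT //; lia.
  by have -> : (src <= i < src + L) = (src <= i < src + L.+1) by lia.
- by rewrite !upd_ne //; lia.
- move=> i iL; rewrite !upd_ne ?dst0 //; lia.
- move=> i iL; rewrite !upd_ne ?le //; lia.
Qed.

Lemma FPs_nth (A : Type) (D : A -> Prop) env os i :
  @FPs A D env os -> i < size os -> FP D env (fun a => st os a i).
Proof.
move=> fos lt; have bs := env_size_bound fos; case: fos => c [T [bT h]].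
set m := size env; set L := size os.
exists (c ;; mv (m + i) (m + L) (m + L).+1 ;; clears m L ;; mv (m + L) m (m + L).+1).
exists (fun a => T a + ((12 * env_size os a + 2) + (L * (3 * env_size os a + 1) +
  (12 * env_size os a + 2)))).
split=> [|a Da]; first by pb.
apply: run_seq (h a Da) _; rewrite st_cat -/m.
set s := above _ _ _.
have sm j : s (m + j) = st os a j by rewrite /s above_shift.
have sL j : L <= j -> s (m + j) = [::] by move=> Lj; rewrite sm st_out.
apply: run_seq.
  apply: run_le (run_mv _ _ _ _); rewrite ?sm ?leq_add2r ?leq_mul2l ?size_st_le //; try lia.
  by rewrite -addnS sL.
rewrite (sL L) // cats0 sm.
set s1 := upd _ _ _.
apply: run_seq.
  apply: (@run_clears _ _ _ (env_size os a)) => j jL.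
  rewrite /s1 upd_ne; last lia.
  by rewrite updE; case: eqP => // _; rewrite sm size_st_le.
set s2 := cleared _ _ _.
have e1 : s2 (m + L) = st os a i.
  by rewrite /s2 /cleared ifN /s1 ?upd_eq //; lia.
have e2 : s2 m = [::].
  by rewrite /s2 /cleared ifT //; lia.
apply: run_eq (run_le _ (run_mv _ _ _ _)); rewrite ?e1 ?e2; try lia.
- move=> j; rewrite /upd cats0; case: (eqVneq j m) => // jm.
  rewrite /s2 /cleared; case: (eqVneq j (m + L)) => [->|jL].
    by rewrite st_out // leq_addr.
  case: andP => [[l1 l2]|nl]; first by rewrite st_out.
  rewrite /s1 upd_ne //; rewrite updE; case: eqP => [?|_]; first lia.
  by rewrite /s /above; case: ltnP => // mj; rewrite (@st_out _ env) // st_out // -/L; lia.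
- by rewrite leq_add2r leq_mul2l size_st_le.
- rewrite /s2 /cleared ifN; last lia.
  by rewrite /s1 !upd_ne; [rewrite -addnS sL | lia | lia].
Qed.

(** The word is the clock, losing one bit per round. The step sees what remains of it, the current
    letter being its head. *)
Fixpoint loop (S : Type) (step : bitstring -> S -> S) (w : bitstring) (s : S) : S :=
  if w is _ :: w' then loop step w' (step w s) else s.

Definition loop_env (A S : Type) (env : seq (A -> bitstring))
    (proj : seq (S -> bitstring)) : seq (A * (bitstring * S) -> bitstring) :=
  [seq (fun p => g p.1) | g <- env] ++
  (fun p => p.2.1) :: [seq (fun p => g p.2.2) | g <- proj].

Lemma st_cat_cons (A : Type) (env os : seq (A -> bitstring)) o a i :
  st (env ++ o :: os) a i =
  if i < size env then st env a i else
  if i == size env then o a else st os a (i - (size env).+1).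
Proof.
rewrite st_cat /above; case: ltnP => // le; case: eqP => [->|ne].
  by rewrite subnn.
by have -> : i - size env = (i - (size env).+1).+1 by lia.
Qed.

Lemma st_loop_env (A S : Type) env (proj : seq (S -> bitstring)) (a : A) w s i :
  st (loop_env env proj) (a, (w, s)) i =
  if i < size env then st env a i else
  if i == size env then w else st proj s (i - (size env).+1).
Proof.
rewrite st_cat_cons size_map (st_map (fun p : A * (bitstring * S) => p.1)).
by rewrite (st_map (fun p : A * (bitstring * S) => p.2.2)).
Qed.

Lemma env_size_loop (A S : Type) env (proj : seq (S -> bitstring)) (a : A) w s :
  env_size (loop_env env proj) (a, (w, s)) =
  env_size env a + (size w + env_size proj s).
Proof.
rewrite env_size_cat (env_size_map (fun p : A * (bitstring * S) => p.1)).
by rewrite /env_size /= -!map_comp.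
Qed.

Lemma pb_pow (A : Type) (D : A -> Prop) env (T : A -> nat) k :
  pbounded D env T -> pbounded D env (fun a => (T a + 2) ^ k).
Proof.
by move=> [l b]; exists ((l + 2) * k) => a Da; apply: pow_comp (b a Da).
Qed.

(** Steps in polynomial time do not suffice, as a state doubling in every round would grow
    exponentially. The invariant serves to bound all reachable states by [bnd], which makes every
    round cost at most one fixed polynomial in the input. *)
Lemma FP_loops (A S : Type) (D : A -> Prop) env (w : A -> bitstring)
    (proj : seq (S -> bitstring)) (init : A -> S)
    (step : A -> bitstring -> S -> S) (Inv : A -> bitstring -> S -> Prop)
    (bnd : A -> nat) :
  FP D env w ->
  FPall D env [seq (fun a => g (init a)) | g <- proj] ->
  FPall (fun p => [/\ D p.1, Inv p.1 p.2.1 p.2.2 & p.2.1 <> [::]])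
    (loop_env env proj) [seq (fun p => g (step p.1 p.2.1 p.2.2)) | g <- proj] ->
  (forall a, D a -> Inv a (w a) (init a)) ->
  (forall a b w' s, D a -> Inv a (b :: w') s -> Inv a w' (step a (b :: w') s)) ->
  pbounded D env bnd ->
  (forall a w' s, D a -> Inv a w' s -> env_size proj s <= bnd a) ->
  FPs D env ((fun=> [::]) :: [seq (fun a => g (loop (step a) (w a) (init a))) | g <- proj]).
Proof.
move=> fw finit fstep inv0 invS bb le; have bw := FP_pb fw.
have fwi : FPs D env (w :: [seq (fun a => g (init a)) | g <- proj]) by apply: FPall_FPs.
case: fwi => c1 [T1 [b1 h1]].
case: (FPall_FPs fstep) => c2 [T2 [[k b2] h2]].
set m := size env; set L := size proj.
(* All components of the new state are computed above the old one before any of the old ones is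
   erased, since each may depend on all of them and on the word. *)
pose body := c2 ;; clears m.+1 L ;; mvs (m.+1 + L) m.+1 L (m.+1 + L + L) ;; Pop m.
pose Z a := env_size env a + (size (w a) + bnd a).
pose C a := (Z a + 2) ^ k + (L * (3 * bnd a + 1) + (L * (12 * bnd a + 2) + 1)).
exists (c1 ;; While m body), (fun a => T1 a + (size (w a) * (C a + 2) + 1)).
split.
  have bC : pbounded D env C.
    by apply: pb_add; [apply: pb_pow; rewrite /Z; pb | pb].
  by pb.
move=> a Da; apply: run_seq (h1 a Da) _.
have -> : st (env ++ w :: [seq (fun a => g (init a)) | g <- proj]) a =
    st (loop_env env proj) (a, (w a, init a)).
  apply: functional_extensionality => i.
  by rewrite st_cat_cons st_loop_env (st_map init).
have -> : st (env ++ (fun=> [::]) ::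
    [seq (fun a => g (loop (step a) (w a) (init a))) | g <- proj]) a =
    st (loop_env env proj) (a, ([::], loop (step a) (w a) (init a))).
  apply: functional_extensionality => i.
  by rewrite st_cat_cons st_loop_env (st_map (fun a => loop (step a) (w a) (init a))).
suff main w' s : Inv a w' s -> size w' <= size (w a) ->
    run (While m body) (st (loop_env env proj) (a, (w', s)))
      (size w' * (C a + 2) + 1)
      (st (loop_env env proj) (a, ([::], loop (step a) w' s))).
  by apply: main => //; apply: inv0.
elim: w' s => [|b w' IH] s inv sw /=.
  apply: run_while0; rewrite st_loop_env -/m; by rewrite ltnn eqxx.
rewrite mulSn -addnA.
have -> : C a + 2 + (size w' * (C a + 2) + 1) = (C a + (size w' * (C a + 2) + 1)).+2 by lia.
set s2 := step a _ s.
have inv2 : Inv a w' s2 by apply: invS.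
have lt1 : m < m.+1 + L by lia.
have stE i : st (loop_env env proj) (a, (b :: w', s)) i =
  if i < m then st env a i else if i == m then b :: w' else st proj s (i - m.+1)
  by exact: st_loop_env.
apply: (run_while1 _ _ (IH s2 inv2 (ltnW sw))).
  by rewrite stE ltnn eqxx.
have Dp : [/\ D (a, (b :: w', s)).1, Inv a (b :: w') s & b :: w' <> [::]] by [].
rewrite /C; apply: run_seq.
  apply: run_le (h2 _ Dp); apply: leq_trans (b2 _ Dp) _.
  have := le _ _ _ Da inv.
  rewrite env_size_loop /Z; case: (k) => // k' lb; rewrite leq_exp2r //; move: sw => /=; lia.
rewrite st_cat.
have sE : size (loop_env env proj) = m.+1 + L.
  by rewrite size_cat /= !size_map -/m -/L addnS.
rewrite sE; set s1 := above _ _ _.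
have s1E i : s1 i = if i < m.+1 + L then st (loop_env env proj) (a, (b :: w', s)) i
                    else st proj s2 (i - (m.+1 + L)).
  rewrite /s1 /above; case: ltnP => // _.
  exact: (congr1 (fun f : store => f (i - (m.+1 + L)))
    (st_map (fun p : A * (bitstring * S) => step p.1 p.2.1 p.2.2) proj (a, (b :: w', s)))).
apply: run_seq.
  apply: (@run_clears _ _ _ (bnd a)) => i iL.
  rewrite s1E ifT; last lia.
  rewrite stE ifN; last lia.
  rewrite ifN; last lia.
  exact: leq_trans (size_st_le _ _ _) (le _ _ _ Da inv).
set s3 := cleared _ _ _.
have s3E i : s3 i = if m.+1 <= i < m.+1 + L then [::] else s1 i by [].
apply: run_seq.
  apply: (@run_mvs _ _ _ _ _ (bnd a)); try lia.
  - rewrite s3E ifN; last lia.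
    rewrite s1E ifN; last lia.
    by rewrite st_out // -/L; lia.
  - by move=> i iL; rewrite s3E ifT //; lia.
  - move=> i iL; rewrite s3E ifN; last lia.
    rewrite s1E ifN; last lia.
    exact: leq_trans (size_st_le _ _ _) (le _ _ _ Da inv2).
apply: run_eq (run_pop _ _) => i; rewrite st_loop_env -/m.
have mE : moved (m.+1 + L) m.+1 L s3 m = b :: w'.
  rewrite /moved !ifN; try lia.
  rewrite s3E ifN; last lia.
  by rewrite s1E lt1 stE ltnn eqxx.
rewrite updE; case: (eqVneq i m) => [->|im].
  by rewrite ltnn mE.
rewrite /moved; case: andP => [[l1 l2]|nl].
  rewrite s3E ifN; last lia.
  rewrite s1E ifN; last lia.
  rewrite ifN; last lia.
  by congr (st proj s2 _); lia.
case: andP => [[l1 l2]|nl'].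
  rewrite ifN; last lia.
  by rewrite st_out // -/L; lia.
rewrite s3E ifN; last lia.
case: ltnP => mi.
  rewrite s1E ifT; last lia.
  by rewrite stE mi.
rewrite s1E ifN; last lia.
by rewrite !st_out // -/L; lia.
Qed.

(** * From register programs to Turing machines *)

Inductive op := Nop | OPop | OPush of bool.

Definition do_op (o : op) (x : bitstring) : bitstring :=
  match o with Nop => x | OPop => behead x | OPush b => b :: x end.

Definition instr := (nat * (option bool -> op * nat))%type.

Definition jmp (pc : nat) : instr := (0, fun=> (Nop, pc)).

Fixpoint csize (c : cmd) : nat :=
  match c with
  | Skip => 0
  | Push _ _ | Pop _ => 1
  | c1 ;; c2 => csize c1 + csize c2
  | Case _ c0 c1 c2 => (csize c0 + (csize c1 + (csize c2 + 1).+1).+1).+1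
  | While _ c => (csize c + 1).+1
  end.

(** Jump targets are absolute, hence the load address [b]. Even the last branch of a [Case] ends
    with a jump, so that all three branches cost the two extra steps counted by [exec]. *)
Fixpoint comp (b : nat) (c : cmd) : seq instr :=
  match c with
  | Skip => [::]
  | Push r x => [:: (r, fun=> (OPush x, b.+1))]
  | Pop r => [:: (r, fun=> (OPop, b.+1))]
  | c1 ;; c2 => comp b c1 ++ comp (b + csize c1) c2
  | Case r c0 c1 c2 =>
      let b1 := (b.+1 + csize c0).+1 in
      let b2 := (b1 + csize c1).+1 in
      let e := (b2 + csize c2).+1 in
      (r, fun t => (Nop, if t is Some x then if x then b1 else b2 else b.+1)) ::
      comp b.+1 c0 ++ jmp e :: comp b1 c1 ++ jmp e :: comp b2 c2 ++ [:: jmp e]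
  | While r c =>
      (r, fun t => (Nop, if t is None then (b.+1 + csize c).+1 else b.+1)) ::
      comp b.+1 c ++ [:: jmp b]
  end.

Lemma size_comp b c : size (comp b c) = csize c.
Proof.
elim: c b => //= [c1 h1 c2 h2|r c0 h0 c1 h1 c2 h2|r c h] b;
  by rewrite ?size_cat /= ?size_cat /= ?size_cat /= ?h0 ?h1 ?h2 ?h.
Qed.

Definition cstep (code : seq instr) (x : nat * store) : nat * store :=
  if x.1 < size code then
    let i := nth (jmp 0) code x.1 in
    let o := i.2 (ohead (x.2 i.1)) in
    (o.2, upd x.2 i.1 (do_op o.1 (x.2 i.1)))
  else x.

Lemma cstep_at pre i post s :
  cstep (pre ++ i :: post) (size pre, s) =
  ((i.2 (ohead (s i.1))).2, upd s i.1 (do_op (i.2 (ohead (s i.1))).1 (s i.1))).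
Proof.
rewrite /cstep /= size_cat /= ifT; last by lia.
by rewrite nth_cat ltnn subnn.
Qed.

Lemma cstep_jmp pre e post s : cstep (pre ++ jmp e :: post) (size pre, s) = (e, s).
Proof. by rewrite cstep_at /= upd_id. Qed.

(** The surrounding code is arbitrary because the induction meets each command inside the code of
    its parent, and a loop meets its own code again after each round. *)
Lemma comp_exec c s n s' : exec c s n s' -> forall code pre post,
  code = pre ++ comp (size pre) c ++ post ->
  iter n (cstep code) (size pre, s) = (size pre + csize c, s').
Proof.
have branch c1 s1 n1 s2 code pre e post :
    (forall code pre post, code = pre ++ comp (size pre) c1 ++ post ->
      iter n1 (cstep code) (size pre, s1) = (size pre + csize c1, s2)) ->
    code = pre ++ comp (size pre) c1 ++ jmp e :: post ->
    iter n1.+1 (cstep code) (size pre, s1) = (e, s2).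
  move=> h ->; rewrite iterS (h _ _ _ erefl) catA.
  have -> : size pre + csize c1 = size (pre ++ comp (size pre) c1).
    by rewrite size_cat size_comp.
  exact: cstep_jmp.
elim=> {c s n s'}.
- by move=> s code pre post _; rewrite addn0.
- by move=> s r b code pre post ->; rewrite /= cstep_at /= addn1.
- by move=> s r code pre post ->; rewrite /= cstep_at /= addn1.
- move=> c1 c2 s n1 s1 n2 s2 _ h1 _ h2 code pre post def.
  rewrite addnC iterD (h1 code pre (comp (size pre + csize c1) c2 ++ post)).
    have := h2 code (pre ++ comp (size pre) c1) post.
    by rewrite size_cat size_comp addnA; apply; rewrite def -!catA.
  by rewrite def /= -catA.
- move=> s r c0 c1 c2 n s' _ h code pre post def.
  set b1 := ((size pre).+1 + csize c0).+1; set b2 := (b1 + csize c1).+1.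
  set e := (b2 + csize c2).+1.
  have -> : size pre + csize (Case r c0 c1 c2) = e by rewrite /e /b2 /b1 /=; lia.
  rewrite iterSr {2}def [cstep _ _]cstep_at /= upd_id -/b1 -/b2 -/e.
  rewrite [comp _ _]/= -/b1 -/b2 -/e in def; move: def; set I := (r, _) => def.
  case: (s r) h => [|[] x] /= h.
  + pose pre1 := rcons pre I.
    have sp : size pre1 = (size pre).+1 by rewrite size_rcons.
    rewrite -iterS -sp; apply: branch h _.
    by rewrite sp def /pre1 -cats1 -!catA /= -!catA.
  + pose pre1 := pre ++ I :: comp (size pre).+1 c0 ++ [:: jmp e].
    have sp : size pre1 = b1 by rewrite size_cat /= size_cat size_comp /b1 /=; lia.
    rewrite -iterS -sp; apply: branch h _.
    by rewrite sp def /pre1 -!catA /= -!catA /= -!catA.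
  + pose pre1 := pre ++ I :: comp (size pre).+1 c0 ++ jmp e :: comp b1 c1 ++ [:: jmp e].
    have sp : size pre1 = b2.
      by rewrite size_cat /= size_cat /= size_cat !size_comp /b2 /b1 /=; lia.
    rewrite -iterS -sp; apply: branch h _.
    by rewrite sp def /pre1 -!catA /= -!catA /= -!catA /= -!catA.
- move=> s r c e code pre post -> /=; rewrite cstep_at /= upd_id e; congr pair.
  by lia.
- move=> s r c n1 s1 n2 s2 ne _ h1 _ h2 code pre post def.
  have -> : (n1 + n2).+2 = n2 + n1.+2 by lia.
  rewrite iterD iterSr {3}def [cstep _ _]cstep_at.
  have -> /= : ohead (s r) = Some (head true (s r)) by case: (s r) ne.
  rewrite upd_id; move: (def); rewrite [comp _ _]/=; set I := (r, _) => def'.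
  have sp : size (rcons pre I) = (size pre).+1 by rewrite size_rcons.
  rewrite -sp -iterS (branch _ _ _ _ _ _ (size pre) post h1); first exact: h2 def.
  by rewrite sp def' -cats1 -!catA /= -!catA.
Qed.

(** Finite control over [sK.+1] stacks, each state inspecting a single one: the common source of the
    Turing machines and of the circuits. *)
Record smach := SMach {
  sQ : finType;
  sinit : sQ;
  sfin : sQ;
  sK : nat;
  sreg : sQ -> 'I_sK.+1;
  sop : sQ -> option bool -> op * sQ
}.

Definition mstep (M : smach) (x : sQ M * store) : sQ M * store :=
  if x.1 == sfin M then x else
  let o := sop x.1 (ohead (x.2 (sreg x.1))) in
  (o.2, upd x.2 (sreg x.1) (do_op o.1 (x.2 (sreg x.1)))).

Definition smach_of (c : cmd) (K : nat) : smach :=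
  let code := comp 0 c in
  let n := size code in
  @SMach ('I_n.+1) ord0 ord_max K
    (fun q => inord (nth (jmp 0) code q).1)
    (fun q t => let o := (nth (jmp 0) code q).2 t in (o.1, inord (minn o.2 n))).

Fixpoint maxreg (c : cmd) : nat :=
  match c with
  | Skip => 0
  | Push r _ | Pop r => r
  | c1 ;; c2 => maxn (maxreg c1) (maxreg c2)
  | Case r c0 c1 c2 => maxn r (maxn (maxreg c0) (maxn (maxreg c1) (maxreg c2)))
  | While r c => maxn r (maxreg c)
  end.

Lemma comp_maxreg c b : all (fun i : instr => i.1 <= maxreg c) (comp b c).
Proof.
have sub K K' l : K <= K' -> all (fun i : instr => i.1 <= K) l ->
    all (fun i : instr => i.1 <= K') l.
  by move=> le; apply: sub_all => i /leq_trans; apply.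
elim: c b => //= [r x b|r b|c1 h1 c2 h2 b|r c0 h0 c1 h1 c2 h2 b|r c h b];
  rewrite ?leqnn //.
- by rewrite all_cat (sub _ _ _ _ (h1 _)) ?(sub _ _ _ _ (h2 _)) // ?leq_maxl ?leq_maxr.
- rewrite leq_maxl !(all_cat, all_rcons) /= !all_cat /= !all_cat /= !andbT.
  by rewrite (sub _ _ _ _ (h0 _)) ?(sub _ _ _ _ (h1 _)) ?(sub _ _ _ _ (h2 _)) //; lia.
- by rewrite leq_maxl all_cat /= (sub _ _ _ _ (h _)) //; lia.
Qed.

Lemma exec_smach c K s n s' : maxreg c <= K -> exec c s n s' ->
  iter n (@mstep (smach_of c K)) (sinit _, s) = (sfin (smach_of c K), s').
Proof.
move=> leK e; set code := comp 0 c; set N := size code.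
pose phi (x : nat * store) : sQ (smach_of c K) * store := (inord (minn x.1 N), x.2).
have phiS x : mstep (phi x) = phi (cstep code x).
  case: x => pc s0; rewrite /phi /mstep /cstep /= -/code -/N.
  case: ltnP => lt.
    have E : @inord N pc = pc :> nat by rewrite inordK; lia.
    rewrite ifN; last by apply/eqP => /(congr1 val); rewrite [val _]E /=; lia.
    rewrite /= E; set i := nth _ _ pc.
    have iK : @inord K i.1 = i.1 :> nat.
      rewrite inordK // ltnS; apply: leq_trans leK.
      by have /all_nthP := comp_maxreg c 0; apply; rewrite -/code.
    by rewrite iK.
  have -> : inord N = ord_max :> 'I_N.+1 by apply/val_inj; rewrite /= inordK.
  rewrite eqxx.
  rewrite /= (minn_idPr lt); congr pair; apply/val_inj.
  by rewrite /= inordK.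
have phi_iter k x : iter k (@mstep (smach_of c K)) (phi x) = phi (iter k (cstep code) x).
  by elim: k => //= k ->; rewrite phiS.
have := phi_iter n (0, s); rewrite (comp_exec e (pre := [::]) (post := [::])) ?cats0 //.
rewrite /phi /= min0n add0n -(size_comp 0) minnn.
have -> : inord 0 = ord0 :> 'I_N.+1 by apply/val_inj; rewrite /= inordK.
by have -> : inord N = ord_max :> 'I_N.+1 by apply/val_inj; rewrite /= inordK.
Qed.

(** Each stack lies on a tape with its top under the head. A push has to move left first and can
    write only in the next step; the intermediate states remember the stack and the bit, and every
    step of [M] takes two. *)
Definition tm_of (M : smach) : machine :=
  let K := sK M in
  @Machine K (sQ M + sQ M * ('I_K.+1 * option bool))%type (inl (sinit M))
    (pred1 (inl (sfin M)))
    (fun q rd =>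
       match q with
       | inl q =>
           let r := sreg q in
           let o := sop q (rd r) in
           (inr (o.2, (r, if o.1 is OPush b then Some b else None)),
            [ffun i => if i == r then
                         match o.1 with
                         | Nop => (rd i, Stay)
                         | OPop => (None, Right)
                         | OPush _ => (rd i, Left)
                         end
                       else (rd i, Stay)])
       | inr (q, (r, p)) =>
           (inl q,
            [ffun i => (if i == r then if p is Some b then Some b else rd i
                        else rd i, Stay)])
       end).

(** Moving and erasing leave explicit blanks in the two lists, so a tape represents its stack only
    up to blanks on either side. *)
Definition holds_string (t : tape) (x : bitstring) : Prop :=
  exists i j, t = (nseq i None, map Some x ++ nseq j None).

Lemma tape_read_string t x : holds_string t x -> tape_read t = ohead x.
Proof. by move=> [i [j ->]]; case: x => //; case: j. Qed.

Lemma behead_string x j :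
  exists j', behead (map Some x ++ nseq j (None : symbol)) = map Some (behead x) ++ nseq j' None.
Proof. by case: x => [|b x]; [exists j.-1; case: j | exists j]. Qed.

Lemma rewrite_string x j : exists j',
  head None (map Some x ++ nseq j (None : symbol)) :: behead (map Some x ++ nseq j None) =
  map Some x ++ nseq j' None.
Proof. by case: x => [|b x]; [case: j => [|j]; [exists 1 | exists j.+1] | exists j]. Qed.

Lemma holds_stay t x : holds_string t x ->
  holds_string (tape_move Stay (tape_write (tape_read t) t)) x.
Proof.
move=> [i [j ->]]; rewrite /tape_write /tape_read /=.
by have [j' ->] := rewrite_string x j; exists i, j'.
Qed.

Lemma holds_pop t x : holds_string t x ->
  holds_string (tape_move Right (tape_write None t)) (behead x).
Proof.
move=> [i [j ->]]; rewrite /tape_write /=.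
by have [j' ->] := behead_string x j; exists i.+1, j'.
Qed.

Lemma holds_push t x b : holds_string t x ->
  holds_string (tape_move Stay (tape_write (Some b)
    (tape_move Left (tape_write (tape_read t) t)))) (b :: x).
Proof.
move=> [i [j ->]]; rewrite /tape_write /tape_read /=.
by have [j' ->] := rewrite_string x j; exists i.-1, j'; case: i.
Qed.

Lemma tm_step2 (M : smach) (c : config (tm_of M)) q (s : store) :
  c.1 = inl q -> q != sfin M ->
  (forall i : 'I_(sK M).+1, holds_string (c.2 i) (s i)) ->
  let c' := step (step c) in
  c'.1 = inl (mstep (q, s)).1 /\
  forall i : 'I_(sK M).+1, holds_string (c'.2 i) ((mstep (q, s)).2 i).
Proof.
move=> c1 nf hold.
have nh : @halting (tm_of M) (inl q) = false.
  by apply/negbTE; apply: contra nf => /eqP [->].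
rewrite {2}/step c1 nh /=.
rewrite /mstep /= (negPf nf) ffunE (tape_read_string (hold _)).
set o := sop _ _; rewrite /step /=; split=> // i.
rewrite !ffunE /=; case: (eqVneq i (sreg q)) => [->|ne].
  rewrite upd_eq; case: (o.1) => [||b] /=.
  - exact/holds_stay/holds_stay.
  - exact/holds_stay/holds_pop.
  - exact/holds_push.
rewrite upd_ne; last by [].
exact/holds_stay/holds_stay.
Qed.

Lemma tm_iter (M : smach) n s s' :
  iter n (@mstep M) (sinit M, s) = (sfin M, s') ->
  forall xs, (forall i : 'I_(sK M).+1, s i = nth [::] xs i) ->
  let c := iter (n + n) (@step (tm_of M)) (init_config (tm_of M) xs) in
  halting c.1 /\ forall i : 'I_(sK M).+1, holds_string (c.2 i) (s' i).
Proof.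
move=> e xs sxs /=.
suff: let c := iter (n + n) (@step (tm_of M)) (init_config (tm_of M) xs) in
    c.1 = inl (iter n (@mstep M) (sinit M, s)).1 /\
    forall i : 'I_(sK M).+1, holds_string (c.2 i) ((iter n (@mstep M) (sinit M, s)).2 i).
  by rewrite e => /= [[-> h]]; rewrite eqxx.
elim: n {e s'} => [|n IH] /=.
  split=> // i; rewrite ffunE sxs; exists 0, 0; by rewrite cats0.
rewrite addnS /=; case: IH => c1 hold; set c := iter _ _ _ in c1 hold *.
case: (iter n _ _) c1 hold => q s1 /= c1 hold.
case: (eqVneq q (sfin M)) => [qf|nf]; last exact: tm_step2.
have stepc : step c = c by rewrite /step c1 qf /= eqxx.
by rewrite !stepc /mstep /= qf eqxx /= c1 qf.
Qed.

Lemma pow_poly k n : poly_eval (('X + 2%:P) ^+ k)%R n = (n + 2) ^ k.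
Proof.
by rewrite /poly_eval horner_exp hornerD hornerX hornerC; elim: k => // k; rewrite expnS GRing.exprS => ->.
Qed.

Lemma leading_bits_string x j : leading_bits (map Some x ++ nseq j None) = x.
Proof. by elim: x => [|b x /= ->] //; case: j. Qed.

Lemma iter_halted (M : machine) (c : config M) n : halting c.1 -> iter n (@step M) c = c.
Proof. by move=> h; elim: n => //= n ->; rewrite /step h. Qed.

Lemma FP_polytime (A : Type) (D : A -> Prop) env o :
  FP D env o -> polytime D (fun a => [seq g a | g <- env]) o.
Proof.
move=> fo; have bo := FP_pb fo; case: fo => c [T [bT h]].
(* [K] becomes the last tape, on which the output is read; the margin of two leaves [K.-1] as an
   empty scratch register for the final move. *)
set m := size env; set K := (maxn (maxreg c) m).+2.
pose c' := c ;; mv m K K.-1.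
have [k bk] : pbounded D env (fun a => 2 * (T a + (12 * size (o a) + 2))) by pb.
exists (tm_of (smach_of c' K)), (('X + 2%:P) ^+ k)%R => a Da.
rewrite pow_poly -map_comp -/(env_size env a).
have [n le e] : run c' (st env a) (T a + (12 * size (o a) + 2))
    (upd (st env a) K (o a)).
  apply: run_seq (h a Da) _.
  have := @run_mv m K K.-1 (upd (st env a) m (o a)).
  have -> : upd (st env a) m (o a) K = [::] by rewrite upd_ne ?st_out // -/m /K; lia.
  rewrite upd_eq cats0 => r; apply: run_eq (r _ _ _ _); try by rewrite /K; lia.
    move=> i; rewrite !updE; case: eqP => // _.
    by case: eqP => [->|] //; rewrite st_out.
  by rewrite upd_ne ?st_out // -/m /K; lia.
have lK : maxreg c' <= K by rewrite /c' /=; lia.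
have sxs (i : 'I_K.+1) : st env a i = nth [::] [seq g a | g <- env] i.
  case: (ltnP i (size env)) => lt; last by rewrite st_out ?nth_default ?size_map.
  by rewrite (nth_map (fun=> [::])).
have [] := tm_iter (exec_smach lK e) sxs.
set c0 := iter _ _ _ => hc hold.
have le2 : n + n <= (env_size env a + 2) ^ k.
  by apply: leq_trans (bk a Da); lia.
rewrite /computes_within -(subnK le2) iterD -/c0 iter_halted //; split=> //.
have [i [j E]] := hold ord_max; rewrite /output E /= leading_bits_string.
by rewrite upd_eq.
Qed.

(** * A library of polynomial-time functions *)

Lemma FP_var_of (A : Type) (D : A -> Prop) env i (o : A -> bitstring) :
  (forall a, D a -> o a = st env a i) -> FP D env o.
Proof. by move=> e; apply: FP_ext (FP_var D env i) => a Da; rewrite e. Qed.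

Lemma FP_const (A : Type) (D : A -> Prop) env x : @FP A D env (fun=> x).
Proof. by elim: x => [|b x IH]; [exact: FP_nil | exact: FP_cons]. Qed.

Definition lift_env (A B : Type) (h : B -> A) (env : seq (A -> bitstring)) :
    seq (B -> bitstring) :=
  [seq (fun b => g (h b)) | g <- env].

Lemma FP_lift (A B : Type) (DA : A -> Prop) (DB : B -> Prop) env (h : B -> A) ext o :
  (forall b, DB b -> DA (h b)) -> FP DA env o ->
  FP DB (lift_env h env ++ ext) (fun b => o (h b)).
Proof.
move=> dom fo; apply: FP_weak; apply: (FP_subst_run dom _ fo).
by have := @FPs_vars _ DB (lift_env h env) [::] [::] _ erefl; rewrite cats0.
Qed.

Lemma FP_if (A : Type) (D : A -> Prop) env (b : A -> bool) (u v : A -> bitstring) :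
  FP D env (fun a => [:: b a]) ->
  FP (fun a => D a /\ b a) env u -> FP (fun a => D a /\ ~~ b a) env v ->
  FP D env (fun a => if b a then u a else v a).
Proof.
move=> fb fu fv; apply: (FP_case fb).
- by apply: FP_ext (FP_nil _ _) => a [].
- apply: FP_ext (FP_sub _ fu) => a [Da [x [E _]]]; first by rewrite E.
  by rewrite E.
- apply: FP_ext (FP_sub _ fv) => a [Da [x [E _]]]; first by rewrite E.
  by rewrite E.
Qed.

Lemma FPb_head (A : Type) (D : A -> Prop) env u :
  @FP A D env u -> FP D env (fun a => [:: head false (u a)]).
Proof.
move=> fu; apply: (FP_case fu).
- by apply: FP_ext (FP_const _ _ [:: false]) => a [_ ->].
- by apply: FP_ext (FP_const _ _ [:: true]) => a [_ [x ->]].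
- by apply: FP_ext (FP_const _ _ [:: false]) => a [_ [x ->]].
Qed.

Lemma FPb_nil (A : Type) (D : A -> Prop) env u :
  @FP A D env u -> FP D env (fun a => [:: u a == [::]]).
Proof.
move=> fu; apply: (FP_case fu).
- by apply: FP_ext (FP_const _ _ [:: true]) => a [_ ->].
- by apply: FP_ext (FP_const _ _ [:: false]) => a [_ [x ->]].
- by apply: FP_ext (FP_const _ _ [:: false]) => a [_ [x ->]].
Qed.

Lemma FPb_neg (A : Type) (D : A -> Prop) env b :
  @FP A D env (fun a => [:: b a]) -> FP D env (fun a => [:: ~~ b a]).
Proof.
move=> fb; apply: FP_ext (FP_if fb (FP_const _ _ [:: false]) (FP_const _ _ [:: true])).
by move=> a _; case: (b a).
Qed.

Lemma FPb_and (A : Type) (D : A -> Prop) env b b' :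
  @FP A D env (fun a => [:: b a]) -> FP D env (fun a => [:: b' a]) ->
  FP D env (fun a => [:: b a && b' a]).
Proof.
move=> fb fb'; apply: FP_ext (FP_if fb (FP_sub _ fb') (FP_const _ _ [:: false])) => a.
  by case: (b a).
by case.
Qed.

Lemma FP_loop (A S : Type) (D : A -> Prop) env (w : A -> bitstring)
    (proj : seq (S -> bitstring)) (init : A -> S)
    (step : A -> bitstring -> S -> S) (Inv : A -> bitstring -> S -> Prop)
    (bnd : A -> nat) i (o : A -> bitstring) :
  i < size proj ->
  (forall a, D a -> o a = st proj (loop (step a) (w a) (init a)) i) ->
  FP D env w ->
  FPall D env [seq (fun a => g (init a)) | g <- proj] ->
  FPall (fun p => [/\ D p.1, Inv p.1 p.2.1 p.2.2 & p.2.1 <> [::]])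
    (loop_env env proj) [seq (fun p => g (step p.1 p.2.1 p.2.2)) | g <- proj] ->
  (forall a, D a -> Inv a (w a) (init a)) ->
  (forall a b w' s, D a -> Inv a (b :: w') s -> Inv a w' (step a (b :: w') s)) ->
  pbounded D env bnd ->
  (forall a w' s, D a -> Inv a w' s -> env_size proj s <= bnd a) ->
  FP D env o.
Proof.
move=> lt def fw fi fs i0 iS bb le.
have := FPs_nth (i := i.+1) (FP_loops fw fi fs i0 iS bb le).
rewrite /= size_map ltnS => /(_ lt); apply: FP_ext => a Da; rewrite def //.
exact: (congr1 (fun f : store => f i) (st_map (fun a => loop (step a) (w a) (init a)) proj a)).
Qed.

Lemma FP_loop_word (A S : Type) D env (proj : seq (S -> bitstring)) :
  FP D (loop_env env proj) (fun p : A * (bitstring * S) => p.2.1).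
Proof.
apply: (@FP_var_of _ _ _ (size env)) => [[a [w s]] _] /=.
by rewrite st_loop_env ltnn eqxx.
Qed.

Lemma FP_loop_state (A S : Type) D env (proj : seq (S -> bitstring)) i (o : S -> bitstring) :
  o = nth (fun=> [::]) proj i ->
  FP D (loop_env env proj) (fun p : A * (bitstring * S) => o p.2.2).
Proof.
move=> ->; apply: (@FP_var_of _ _ _ ((size env).+1 + i)) => [[a [w s]] _].
rewrite st_loop_env ifN; last lia.
by rewrite ifN ?addKn //; lia.
Qed.

Lemma FP_loop_lift (A S : Type) (D : A -> Prop) D' env (proj : seq (S -> bitstring)) o :
  (forall p, D' p -> D p.1) -> FP D env o ->
  FP D' (loop_env env proj) (fun p : A * (bitstring * S) => o p.1).
Proof. exact: FP_lift. Qed.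

(** Numbers are kept in unary, so a number computed in polynomial time is polynomially bounded and
    can serve as a loop counter. *)
Notation FPn D env n := (FP D env (fun a => nseq (n a) true)).

Lemma FPn_S (A : Type) (D : A -> Prop) env (n : A -> nat) :
  FPn D env n -> FPn D env (fun a => (n a).+1).
Proof. exact: FP_cons. Qed.

Lemma FPn_pred (A : Type) (D : A -> Prop) env (n : A -> nat) :
  FPn D env n -> FPn D env (fun a => (n a).-1).
Proof. by move=> fn; apply: FP_ext (FP_behead fn) => a _; case: (n a). Qed.

Lemma FPn_add (A : Type) (D : A -> Prop) env (n m : A -> nat) :
  FPn D env n -> FPn D env m -> FPn D env (fun a => n a + m a).
Proof. by move=> fn fm; apply: FP_ext (FP_cat fn fm) => a _; rewrite nseqD. Qed.

Lemma FPn_const (A : Type) (D : A -> Prop) env n : FPn D env (fun _ : A => n).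
Proof. exact: FP_const. Qed.

Definition index_env (A : Type) (env : seq (A -> bitstring)) : seq (A * nat -> bitstring) :=
  lift_env fst env ++ [:: fun p => nseq p.2 true].

Lemma FP_index (A : Type) D env : FPn D (@index_env A env) snd.
Proof.
apply: (@FP_var_of _ _ _ (size env)) => p _; rewrite st_cat_cons size_map ltnn eqxx //.
Qed.

Lemma FP_index_lift (A : Type) (D : A -> Prop) D' env o :
  (forall p, D' p -> D p.1) -> FP D env o ->
  FP D' (@index_env A env) (fun p => o p.1).
Proof. exact: FP_lift. Qed.

Lemma size_flatten_le (T : Type) (f : nat -> seq T) n B :
  (forall i, i < n -> size (f i) <= B) -> size (flatten [seq f i | i <- iota 0 n]) <= n * B.
Proof.
elim: n => // n IH le; rewrite -addn1 iotaD map_cat flatten_cat size_cat mulnDl leq_add //.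
  by apply: IH => i lt; apply: le; apply: ltnW.
by rewrite /= cats0 mul1n le.
Qed.

(** The for-loop with which encodings are written. Indices stay below [n a], which is polynomially
    bounded, so all pieces share one polynomial bound and the text built so far remains short. *)
Lemma FP_flatmap (A : Type) (D : A -> Prop) env (n : A -> nat) (f : A -> nat -> bitstring) :
  FPn D env n ->
  FP (fun p => D p.1 /\ p.2 < n p.1) (index_env env) (fun p => f p.1 p.2) ->
  FP D env (fun a => flatten [seq f a i | i <- iota 0 (n a)]).
Proof.
move=> fn ff; have bn := FP_pb fn; have [k bf] := FP_pb ff.
pose proj : seq (nat * bitstring -> bitstring) := [:: fun s => nseq s.1 true; snd].
pose stp a (w : bitstring) (s : nat * bitstring) := (s.1.+1, s.2 ++ f a s.1).
pose Inv a (w : bitstring) (s : nat * bitstring) :=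
  s.1 + size w = n a /\ s.2 = flatten [seq f a i | i <- iota 0 s.1].
pose B a := (env_size env a + n a + 2) ^ k.
have bB : pbounded D env (fun a => n a + n a * B a).
  have {}bn : pbounded D env n by apply: (pb_le bn) => a _; rewrite size_nseq.
  by apply: pb_add => //; apply: pb_mul => //; apply: pb_pow; pb.
apply: (@FP_loop _ _ _ _ _ proj (fun=> (0, [::])) stp Inv _ 1 _ _ _ fn _ _ _ _ bB) => //.
- move=> a Da /=.
  have loopE w i x : (loop (stp a) w (i, x)).2 =
      x ++ flatten [seq f a j | j <- iota i (size w)].
    elim: w i x => [|b w IH] i x /=; first by rewrite cats0.
    by rewrite IH /= catA.
  by rewrite /st /= loopE size_nseq.
- by split; [exact: FP_const | split=> //; exact: FP_const].
- split; last split=> //.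
    by apply: FPn_S; apply: (@FP_loop_state _ _ _ _ _ 0 (fun s => nseq s.1 true)).
  apply: FP_cat; first exact: (@FP_loop_state _ _ _ _ _ 1 snd).
  apply: (@FP_subst _ _ _ _ _ _ (fun p => (p.1, p.2.2.1)) _ _ ff).
    move=> [a [w [i x]]] [/= Da [E _] nw]; split=> //; rewrite -E.
    by case: w nw {E} => //= *; lia.
  rewrite /index_env /lift_env map_cat -map_comp /=.
  have sub : forall env0 env1, env = env1 ++ env0 -> FPall
    (fun p : A * (bitstring * (nat * bitstring)) => [/\ D p.1, Inv p.1 p.2.1 p.2.2 & p.2.1 <> [::]])
    (loop_env env proj)
    ([seq ((fun g b => g (b.1, b.2.2.1)) \o
           (fun (g : A -> bitstring) (b : A * nat) => g b.1)) x | x <- env0] ++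
     [:: fun a => nseq a.2.2.1 true]).
    elim=> [|g env0 IH] env1 E /=.
      by split=> //; apply: (@FP_loop_state _ _ _ _ _ 0 (fun s => nseq s.1 true)).
    split; last by apply: (IH (rcons env1 g)); rewrite E cat_rcons.
    apply: (@FP_var_of _ _ _ (size env1)) => [[a [w s]] _] /=.
    rewrite st_loop_env ifT; last by rewrite E size_cat /=; lia.
    by rewrite /st E nth_cat ltnn subnn.
  exact: (sub env [::]).
- by move=> a Da; split=> //=; rewrite size_nseq.
- move=> a b w s Da [/= E1 E2]; split; first by rewrite -E1 /=; lia.
  rewrite [(stp _ _ _).1]/= [(stp _ _ _).2]/= E2 -[s.1.+1]addn1 iotaD map_cat.
  by rewrite flatten_cat /= cats0.
- move=> a w s Da [E1 E2]; rewrite /env_size /= size_nseq E2 addn0.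
  apply: leq_add; first by rewrite -E1 leq_addr.
  apply: leq_trans (_ : s.1 * B a <= _); last by rewrite leq_mul2r -E1 leq_addr orbT.
  apply: size_flatten_le => i lt.
  have lin : i < n a by rewrite -E1; lia.
  apply: leq_trans (bf (a, i) (conj Da lin)) _; rewrite /B.
  have -> : env_size (index_env env) (a, i) = env_size env a + i.
    by rewrite env_size_cat (env_size_map fst) /env_size /= size_nseq addn0.
  by case: (k) => // k'; rewrite leq_exp2r //; lia.
Qed.

Lemma FPn_mul (A : Type) (D : A -> Prop) env (n m : A -> nat) :
  FPn D env n -> FPn D env m -> FPn D env (fun a => n a * m a).
Proof.
move=> fn fm.
have := @FP_flatmap _ D env n (fun a _ => nseq (m a) true) fn.
have -> : (fun a : A => flatten [seq nseq (m a) true | _ <- iota 0 (n a)]) =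
   (fun a => nseq (n a * m a) true).
  apply: functional_extensionality => a; elim: (n a) 0 => // k IH i.
  by rewrite mulSn nseqD /= IH.
by apply; apply: FP_index_lift fm => p [].
Qed.

Lemma FPn_exp (A : Type) (D : A -> Prop) env (n : A -> nat) k :
  FPn D env n -> FPn D env (fun a => n a ^ k).
Proof.
move=> fn; elim: k => [|k IH]; first exact: FPn_const.
by apply: FP_ext (FPn_mul fn IH) => a _; rewrite expnS.
Qed.

Lemma FPn_size (A : Type) (D : A -> Prop) env u :
  @FP A D env u -> FPn D env (fun a => size (u a)).
Proof.
move=> fu; have bu := FP_pb fu.
pose stp (a : A) (w : bitstring) (s : nat) := s.+1.
pose Inv a (w : bitstring) (s : nat) := s + size w = size (u a).
apply: (@FP_loop _ _ _ _ _ [:: fun s => nseq s true] (fun=> 0) stp Inv _ 0 _ _ _ fu _ _ _ _ bu) => //.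
- move=> a _.
  have loopE w i : loop (stp a) w i = i + size w.
    by elim: w i => [|b w IH] i /=; rewrite ?addn0 // IH addSnnS.
  by rewrite loopE.
- by split=> //; exact: FP_const.
- by split=> //; apply: FPn_S; apply: (@FP_loop_state _ _ _ _ _ 0 (fun s => nseq s true)).
- by move=> a b w s _; rewrite /Inv /= addnS.
- by move=> a w s _; rewrite /Inv /env_size /= size_nseq; lia.
Qed.

Lemma FP_drop (A : Type) (D : A -> Prop) env (n : A -> nat) u :
  FPn D env n -> FP D env u -> FP D env (fun a => drop (n a) (u a)).
Proof.
move=> fn fu; have bu := FP_pb fu.
pose stp (a : A) (w : bitstring) (s : bitstring) := behead s.
pose Inv a (w : bitstring) (s : bitstring) := size s <= size (u a).
apply: (@FP_loop _ _ _ _ _ [:: id] u stp Inv _ 0 _ _ _ fn _ _ _ _ bu) => //.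
- move=> a _.
  have loopE w s : loop (stp a) w s = drop (size w) s.
    by elim: w s => [|b w IH] s /=; rewrite ?drop0 // IH; case: s.
  by rewrite loopE size_nseq.
- by split=> //; apply: FP_behead; apply: (@FP_loop_state _ _ _ _ _ 0 id).
- by move=> a _; exact: leqnn.
- by move=> a b w s _; rewrite /Inv size_behead; apply: leq_trans (leq_pred _).
- by move=> a w s _; rewrite /Inv /env_size /=; lia.
Qed.

Lemma FPn_sub (A : Type) (D : A -> Prop) env (n m : A -> nat) :
  FPn D env n -> FPn D env m -> FPn D env (fun a => n a - m a).
Proof. by move=> fn fm; apply: FP_ext (FP_drop fm fn) => a _; rewrite drop_nseq. Qed.

Lemma FPb_nth (A : Type) (D : A -> Prop) env (n : A -> nat) u :
  FPn D env n -> FP D env u -> FP D env (fun a => [:: nth false (u a) (n a)]).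
Proof.
move=> fn fu; apply: FP_ext (FPb_head (FP_drop fn fu)) => a _.
by rewrite -nth0 nth_drop addn0.
Qed.

Lemma FPb_ltn (A : Type) (D : A -> Prop) env (n m : A -> nat) :
  FPn D env n -> FPn D env m -> FP D env (fun a => [:: n a < m a]).
Proof.
move=> fn fm; apply: FP_ext (FPb_neg (FPb_nil (FPn_sub fm fn))) => a _.
by rewrite -size_eq0 size_nseq subn_eq0 ltnNge.
Qed.

Lemma FPb_eqn (A : Type) (D : A -> Prop) env (n m : A -> nat) :
  FPn D env n -> FPn D env m -> FP D env (fun a => [:: n a == m a]).
Proof.
move=> fn fm; apply: FP_ext (FPb_and (FPb_neg (FPb_ltn fn fm)) (FPb_neg (FPb_ltn fm fn))) => a _.
by rewrite -!leqNgt eqn_leq andbC.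
Qed.

Lemma FP_take (A : Type) (D : A -> Prop) env (n : A -> nat) u :
  FPn D env n -> FP D env u -> FP D env (fun a => take (n a) (u a)).
Proof.
move=> fn fu.
pose f a i := if i < size (u a) then [:: nth false (u a) i] else [::].
have E a : flatten [seq f a i | i <- iota 0 (n a)] = take (n a) (u a).
  rewrite /f; elim: (u a) (n a) => [|b x IH] [|k] //=.
    by elim: (iota _ _).
  by rewrite (iotaDl 1) -map_comp -IH.
have := @FP_flatmap _ D env n f fn.
rewrite (functional_extensionality _ _ E); apply.
have sub p : D p.1 /\ p.2 < n p.1 -> D p.1 by case.
have fi := FP_index (fun p => D p.1 /\ p.2 < n p.1) env.
apply: FP_if; last exact: FP_nil.
  apply: FPb_ltn fi _; exact: (FP_index_lift sub (FPn_size fu)).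
apply: FP_sub (FPb_nth fi (FP_index_lift sub fu)) => p; by case.
Qed.

Lemma FP_rev (A : Type) (D : A -> Prop) env u :
  @FP A D env u -> FP D env (fun a => rev (u a)).
Proof.
move=> fu; have bu := FP_pb fu.
pose stp (a : A) (w s : bitstring) := head false w :: s.
pose Inv a (w : bitstring) (s : bitstring) := size s + size w = size (u a).
apply: (@FP_loop _ _ _ _ _ [:: id] (fun=> [::]) stp Inv _ 0 _ _ _ fu _ _ _ _ bu) => //.
- move=> a _.
  have loopE w s : loop (stp a) w s = catrev w s by elim: w s => //= b w IH s.
  by rewrite loopE.
- by split=> //; exact: FP_const.
- split=> //; set F := (fun p => _).
  apply: FP_ext (FP_cat (FPb_head (FP_loop_word _ _ _)) (@FP_loop_state _ _ _ _ _ 0 id _)) => //.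
- by move=> a b w s _; rewrite /Inv /= addnS.
- by move=> a w s _; rewrite /Inv /env_size /=; lia.
Qed.

(** * From Turing machines to register programs *)

Lemma FP_empty (A : Type) (D : A -> Prop) env o : (forall a, ~ D a) -> @FP A D env o.
Proof.
by move=> no; exists Skip, (fun=> 0); split=> [|a /no//]; exact: pb_const.
Qed.

(** Case analysis on the value of [key]. It brings finite tables, such as the transition function of
    a machine, into programs: in each case the table entry is a constant. Quantifying over
    subdomains [D'] lets case analyses be nested. *)
Definition FPkey (A : Type) (D : A -> Prop) env (X : Type) (key : A -> X) : Prop :=
  forall (D' : A -> Prop) o, (forall a, D' a -> D a) ->
  (forall x, FP (fun a => D' a /\ key a = x) env o) -> FP D' env o.

Lemma FPkey_comp (A : Type) (D : A -> Prop) env X Y (f : X -> Y) (key : A -> X) (key' : A -> Y) :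
  (forall a, D a -> key' a = f (key a)) -> FPkey D env key -> FPkey D env key'.
Proof.
move=> def fk D' o sub h; apply: (fk D' o sub) => x; apply: FP_sub (h (f x)) => a [D'a e].
by rewrite def ?e //; auto.
Qed.

Lemma FPkey_pair (A : Type) (D : A -> Prop) env X Y (k1 : A -> X) (k2 : A -> Y) :
  FPkey D env k1 -> FPkey D env k2 -> FPkey D env (fun a => (k1 a, k2 a)).
Proof.
move=> f1 f2 D' o sub h; apply: (f1 D' o sub) => x; apply: (f2 _ o) => [a [/sub]//|y].
by apply: FP_sub (h (x, y)) => a [[D'a <-] <-].
Qed.

Lemma FPkey_head (A : Type) (D : A -> Prop) env u :
  @FP A D env u -> FPkey D env (fun a => ohead (u a)).
Proof.
move=> fu D' o sub h; apply: (FP_case (FP_sub sub fu)).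
- by apply: FP_sub (h None) => a [? ->].
- by apply: FP_sub (h (Some true)) => a [? [x ->]].
- by apply: FP_sub (h (Some false)) => a [? [x ->]].
Qed.

Lemma FPkey_seq (A : Type) (D : A -> Prop) env X (I : Type) (k : I -> A -> X) s :
  (forall i, FPkey D env (k i)) -> FPkey D env (fun a => [seq k i a | i <- s]).
Proof.
move=> fk; elim: s => [|i s IH].
  by move=> D' o sub h; apply: FP_sub (h [::]) => a.
exact: (FPkey_comp (f := fun p => p.1 :: p.2) _ (FPkey_pair (fk i) IH)).
Qed.

Lemma FPkey_ffun (A : Type) (D : A -> Prop) env X n (k : 'I_n -> A -> X) (x0 : X) :
  (forall i, FPkey D env (k i)) -> FPkey D env (fun a => [ffun i => k i a]).
Proof.
move=> fk; apply: (FPkey_comp (f := fun l => [ffun i : 'I_n => nth x0 l i]) _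
  (FPkey_seq (s := enum 'I_n) fk)) => a _.
by apply/ffunP => i; rewrite !ffunE (nth_map i) ?size_enum_ord // nth_ord_enum.
Qed.

(** [B] does not depend on the input, so the program can consist of [B] nested tests. *)
Lemma FPkey_nat (A : Type) (D : A -> Prop) env (n : A -> nat) B :
  FPn D env n -> (forall a, D a -> n a < B) -> FPkey D env n.
Proof.
elim: B D n => [|B IH] D n fn lt D' o sub h.
  by apply: FP_empty => a /sub/lt.
apply: (FP_case (FP_sub sub fn)); last first.
- by apply: FP_empty => a [_ []]; case: (n a).
- have nz a : (D' a /\ exists x, nseq (n a) true = true :: x) -> D' a /\ 0 < n a.
    by move=> [D'a [x]]; case: (n a).
  apply: (IH (fun a => D' a /\ 0 < n a) (fun a => (n a).-1) _ _ _ _ nz).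
  + by apply: FPn_pred; apply: FP_sub fn => a [/sub].
  + by move=> a [/sub/lt]; lia.
  + by move=> x; apply: FP_sub (h x.+1) => a [[D'a [y]]]; case: (n a) => //= m _ ->.
- by apply: FP_sub (h 0) => a [D'a]; case: (n a).
Qed.

Lemma FPkey_fin (A : Type) (D : A -> Prop) env (X : finType) (key : A -> X) :
  FPn D env (fun a => enum_rank (key a)) -> FPkey D env key.
Proof.
move=> fk D' o sub h; have lt a : D a -> enum_rank (key a) < #|X| by [].
apply: (FPkey_nat fk lt sub) => n; case: (ltnP n #|X|) => ln; last first.
  by apply: FP_empty => a [_ e]; have := ltn_ord (enum_rank (key a)); rewrite e ltnNge ln.
apply: FP_sub (h (enum_val (Ordinal ln))) => a [D'a e]; split=> //.
by apply: enum_rank_inj; apply/val_inj; rewrite /= e enum_valK.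
Qed.

Fixpoint Pall (T : Type) (P : T -> Prop) (l : seq T) : Prop :=
  if l is x :: l' then P x /\ Pall P l' else True.

Lemma Pall_cat (T : Type) (P : T -> Prop) l l' : Pall P l -> Pall P l' -> Pall P (l ++ l').
Proof. by elim: l => //= x l IH [? ?] ?; split=> //; apply: IH. Qed.

Lemma Pall_flatten (T : Type) (P : T -> Prop) (I : Type) (F : I -> seq T) s :
  (forall i, Pall P (F i)) -> Pall P (flatten [seq F i | i <- s]).
Proof. by move=> h; elim: s => //= i s IH; apply: Pall_cat. Qed.

Lemma FPall_map (A S : Type) (D : A -> Prop) env (phi : S -> A -> bitstring) l :
  Pall (fun g => FP D env (phi g)) l -> FPall D env [seq phi g | g <- l].
Proof. by elim: l => //= g l IH [? ?]; split=> //; apply: IH. Qed.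

Lemma env_size_Pall (A : Type) (env : seq (A -> bitstring)) a B :
  Pall (fun g : A -> bitstring => size (g a) <= B) env -> env_size env a <= size env * B.
Proof.
by elim: env => //= g env IH [? /IH le]; rewrite mulSn /env_size /= leq_add.
Qed.

Lemma nth_flatten_map (T : Type) (d : T) (I : eqType) (F : I -> seq T) s i j :
  i \in s -> j < size (F i) ->
  exists k, nth d (F i) j = nth d (flatten [seq F i | i <- s]) k.
Proof.
elim: s => //= i' s IH; rewrite inE; case: (eqVneq i i') => [<- _|_ /= si] lt.
  by exists j; rewrite nth_cat lt.
have [k ->] := IH si lt; exists (size (F i') + k).
by rewrite nth_cat ltnNge leq_addr /= addKn.
Qed.

Lemma poly_pow (p : {poly nat}) : exists k, forall n, poly_eval p n <= (n + 2) ^ k.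
Proof.
elim/poly_ind: p => [|p c [k IH]].
  by exists 0 => n; rewrite /poly_eval horner0.
exists (k.+1 + c + 1) => n; rewrite /poly_eval hornerD hornerMX hornerC.
apply: leq_trans (pow_add _ _ _); apply: leq_add.
  rewrite expnSr; apply: leq_mul; [exact: IH | exact: leq_addr].
apply: leq_trans (ltnW (ltn_expl c (isT : 1 < 2))) _.
by case: c => // c; rewrite leq_exp2r // leq_addl.
Qed.

(** A symbol has three values, so each half of a tape is kept as two parallel bitstrings: which
    cells are not blank, and the bits in them. *)
Definition tape_proj (M : machine) (i : 'I_(ntapes M).+1) : seq (config M -> bitstring) :=
  [:: fun c : config M => map isSome (c.2 i).1; fun c : config M => map (odflt false) (c.2 i).1;
      fun c : config M => map isSome (c.2 i).2; fun c : config M => map (odflt false) (c.2 i).2].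

Definition config_proj (M : machine) : seq (config M -> bitstring) :=
  (fun c : config M => nseq (enum_rank c.1) true) :: flatten [seq tape_proj i | i <- enum 'I_(ntapes M).+1].

Lemma config_proj_tape (M : machine) (i : 'I_(ntapes M).+1) j : j < 4 ->
  exists k, nth (fun=> [::]) (tape_proj i) j = nth (fun=> [::]) (config_proj M) k.
Proof.
move=> lt; have [k e] := @nth_flatten_map _ (fun=> [::]) _ (@tape_proj M) (enum 'I_(ntapes M).+1)
  i j (mem_enum _ _) lt.
by exists k.+1.
Qed.

Lemma FP_step (A : Type) env (M : machine) D :
  Pall (fun g => FP D (loop_env env (config_proj M))
    (fun p : A * (bitstring * config M) => g (step p.2.2))) (config_proj M).
Proof.
set E := loop_env _ _.
have var D' i j : j < 4 -> FP D' E (fun p => nth (fun=> [::]) (tape_proj i) j p.2.2).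
  by move=> /(config_proj_tape i) [k e]; apply: (@FP_loop_state _ _ _ _ _ k).
have lp D' i : FP D' E (fun p => map isSome (p.2.2.2 i).1) by exact: (var D' i 0).
have lv D' i : FP D' E (fun p => map (odflt false) (p.2.2.2 i).1) by exact: (var D' i 1).
have rp D' i : FP D' E (fun p => map isSome (p.2.2.2 i).2) by exact: (var D' i 2).
have rv D' i : FP D' E (fun p => map (odflt false) (p.2.2.2 i).2) by exact: (var D' i 3).
(* Once the state and the scanned symbols are fixed, the transition is a constant. *)
have key : FPkey D E (fun p => (p.2.2.1, [ffun i => tape_read (p.2.2.2 i)])).
  apply: FPkey_pair.
    apply: FPkey_fin.
    by apply: (@FP_loop_state _ _ _ _ _ 0 (fun c : config M => nseq (enum_rank c.1) true)).
  apply: (FPkey_ffun None) => i.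
  (* A blank is read both where the list has ended and where the mask is [false]. *)
  apply: (FPkey_comp (f := fun x => if x.1 is Some true then x.2 else None) _
    (FPkey_pair (FPkey_head (rp D i)) (FPkey_head (rv D i)))) => p _.
  by rewrite /tape_read; case: (p.2.2.2 i).2 => [|[b|] r].
have sub (p : A * (bitstring * config M)) : D p -> D p by [].
split.
  apply: (key _ _ sub) => [[q rd]]; case hq: (halting q).
    apply: FP_ext (FP_const _ _ (nseq (enum_rank q) true)) => p [_ [e _]].
    by rewrite /step e hq e.
  apply: FP_ext (FP_const _ _ (nseq (enum_rank (delta q rd).1) true)) => p [_ [e1 e2]].
  by rewrite /step e1 hq /= e2.
apply: Pall_flatten => i.
(* The move is analysed once, for an arbitrary computable function [x] of the four projections,
   instead of once per projection. *)
suff main (x : (bitstring * bitstring) * (bitstring * bitstring) -> bitstring) :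
    (forall D' u1 u2 u3 u4, FP D' E u1 -> FP D' E u2 -> FP D' E u3 -> FP D' E u4 ->
      FP D' E (fun p => x ((u1 p, u2 p), (u3 p, u4 p)))) ->
    FP D E (fun p => let t := (step p.2.2).2 i in
      x ((map isSome t.1, map (odflt false) t.1), (map isSome t.2, map (odflt false) t.2))).
  split; first by apply: (main (fun x => x.1.1)).
  split; first by apply: (main (fun x => x.1.2)).
  split; first by apply: (main (fun x => x.2.1)).
  by split=> //; apply: (main (fun x => x.2.2)).
move=> fx; apply: (key _ _ sub) => [[q rd]]; set D' := (fun p => D p /\ _).
case hq: (halting q).
  apply: FP_ext (fx D' _ _ _ _ (lp D' i) (lv D' i) (rp D' i) (rv D' i)) => p [_ [e _]].
  by rewrite /step e hq.
case ha: ((delta q rd).2 i) => [b m].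
have stepE p : D' p ->
    (step p.2.2).2 i = tape_move m (tape_write b (p.2.2.2 i)).
  by move=> [_ [e1 e2]]; rewrite /step e1 hq /= e2 ffunE ha.
case: m ha stepE => ha stepE.
- apply: FP_ext (fx D' _ _ _ _ (FP_behead (lp D' i)) (FP_behead (lv D' i))
    (FP_cat (FPb_head (lp D' i)) (FP_cons (isSome b) (FP_behead (rp D' i))))
    (FP_cat (FPb_head (lv D' i)) (FP_cons (odflt false b) (FP_behead (rv D' i))))) => p D'p.
  rewrite stepE //=; case: (p.2.2.2 i) => l r /=.
  by case: l => [|? l]; case: r.
- apply: FP_ext (fx D' _ _ _ _ (lp D' i) (lv D' i)
    (FP_cons (isSome b) (FP_behead (rp D' i)))
    (FP_cons (odflt false b) (FP_behead (rv D' i)))) => p D'p.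
  by rewrite stepE //=; case: (p.2.2.2 i) => l [].
- apply: FP_ext (fx D' _ _ _ _
    (FP_cons (isSome b) (lp D' i)) (FP_cons (odflt false b) (lv D' i))
    (FP_behead (rp D' i)) (FP_behead (rv D' i))) => p D'p.
  by rewrite stepE //=; case: (p.2.2.2 i) => l [].
Qed.

(** Two new cells at most: writing may create the scanned cell, and a move to the left one more. *)
Lemma step_size (M : machine) (c : config M) i :
  size ((step c).2 i).1 + size ((step c).2 i).2 <= size (c.2 i).1 + size (c.2 i).2 + 2.
Proof.
rewrite /step; case: ifP => [_|_]; first by lia.
rewrite /= ffunE; case: (_ i) => b m; case: (c.2 i) => l r.
by case: m => /=; rewrite ?size_behead; lia.
Qed.

Lemma FPn_env_size (A : Type) (D : A -> Prop) env : FPn D env (@env_size A env).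
Proof.
suff: forall env0 env1, env = env1 ++ env0 -> FPn D env (env_size env0).
  by move/(_ env [::] erefl).
elim=> [|g env0 IH] env1 e; first exact: FPn_const.
apply: FPn_add; last by apply: (IH (rcons env1 g)); rewrite cat_rcons.
apply: FPn_size; apply: (@FP_var_of _ _ _ (size env1)) => a _.
by rewrite /st e nth_cat ltnn subnn.
Qed.

Lemma FPn_lead (A : Type) (D : A -> Prop) env u :
  @FP A D env u -> FPn D env (fun a => find negb (u a)).
Proof.
move=> fu; have bu := FP_pb fu.
pose proj : seq (bitstring * nat -> bitstring) := [:: fst; fun s => nseq s.2 true].
pose stp (a : A) (w : bitstring) (s : bitstring * nat) :=
  if head false s.1 then (behead s.1, s.2.+1) else s.
pose Inv a (w : bitstring) (s : bitstring * nat) := size s.1 + s.2 <= size (u a).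
apply: (@FP_loop _ _ _ _ _ proj (fun a => (u a, 0)) stp Inv _ 1 _ _ _ fu _ _ _ _ bu) => //.
- move=> a _; rewrite /st /=.
  have stay w y n : (loop (stp a) w (false :: y, n)).2 = n by elim: w.
  have loopE w x n : size x <= size w -> (loop (stp a) w (x, n)).2 = n + find negb x.
    elim: w x n => [|b w IH] [|[] x] n //= le; rewrite ?addn0 //.
    + by rewrite /stp /= IH ?addn0.
    + by rewrite /stp /= IH ?addSnnS.
    + exact: (stay (b :: w)).
  by rewrite loopE.
- by split; [exact: fu | split=> //; exact: FP_const].
- set E := loop_env _ _; set D' := (fun p => _).
  have f1 D0 : FP D0 E (fun p => p.2.2.1) by exact: (@FP_loop_state _ _ _ _ _ 0 fst).
  have f2 D0 : FP D0 E (fun p => nseq p.2.2.2 true).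
    by exact: (@FP_loop_state _ _ _ _ _ 1 (fun s => nseq s.2 true)).
  split; last split=> //.
    apply: FP_ext (FP_if (FPb_head (f1 D')) (FP_behead (f1 _)) (f1 _)) => p _.
    by rewrite /stp; case: ifP.
  apply: FP_ext (FP_if (FPb_head (f1 D')) (FPn_S (f2 _)) (f2 _)) => p _.
  by rewrite /stp; case: ifP.
- by move=> a _; rewrite /Inv /= addn0.
- by move=> a b w [[|[] x] n] _; rewrite /Inv /stp /= ?addSnnS.
- by move=> a w s _; rewrite /Inv /env_size /= size_nseq addn0.
Qed.

Lemma FP_leading_bits (A : Type) (D : A -> Prop) env (r : A -> seq symbol) :
  FP D env (fun a => map isSome (r a)) -> FP D env (fun a => map (odflt false) (r a)) ->
  FP D env (fun a => leading_bits (r a)).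
Proof.
move=> fp fv; apply: FP_ext (FP_take (FPn_lead fp) fv) => a _.
by elim: (r a) => [|[b|] x IH] //=; rewrite IH.
Qed.

(** The simulation runs for [(n + 2) ^ k] steps, a clock that is easily computed and dominates the
    given polynomial; overshooting is harmless because a halted configuration no longer changes. *)
Lemma polytime_FP (A : Type) (D : A -> Prop) (env : seq (A -> bitstring)) inp o :
  (forall a, D a -> inp a = [seq g a | g <- env]) -> polytime D inp o -> FP D env o.
Proof.
move=> inpE [M [p h]]; have [k pk] := poly_pow p.
pose time a := (env_size env a + 2) ^ k.
pose init a := init_config M [seq g a | g <- env].
pose stp (a : A) (w : bitstring) (c : config M) := step c.
pose Inv a (w : bitstring) (c : config M) := size w <= time a /\
  forall i, size (c.2 i).1 + size (c.2 i).2 <= env_size env a + 2 * (time a - size w).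
have ft : FPn D env time.
  apply: FPn_exp; apply: FPn_add; [exact: FPn_env_size | exact: FPn_const].
pose R := size (config_proj M).
pose bnd a := R * (#|state M| + env_size env a + 2 * time a).
have bb : pbounded D env bnd.
  have bt : pbounded D env time by exists k.
  by rewrite /bnd; pb.
have xsE a i : nth [::] [seq g a | g <- env] i = st env a i.
  case: (ltnP i (size env)) => lt; last by rewrite st_out ?nth_default ?size_map.
  by rewrite (nth_map (fun=> [::])).
have main i : FP D env (fun a => leading_bits ((loop (stp a) (nseq (time a) true) (init a)).2 i).2).
  have fk j o' : j < 4 -> (forall c, o' c = nth (fun=> [::]) (tape_proj i) j c) ->
      FP D env (fun a => o' (loop (stp a) (nseq (time a) true) (init a))).
    move=> lt e; have [k' ek] := config_proj_tape i lt.
    (* The default of [nth] is constantly empty, whereas every tape projection is nonempty on a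
       configuration with a cell on each side. *)
    have lk : k' < R.
      rewrite ltnNge; apply/negP => /(nth_default (fun=> [::])) ek'.
      have := congr1 (fun f : config M -> bitstring =>
        f (start_state M, [ffun=> ([:: None], [:: None])])) (etrans ek ek').
      by case: (j) lt => [|[|[|[|j']]]] //= _; rewrite ffunE.
    apply: (@FP_loop _ _ _ _ _ (config_proj M) init stp Inv _ k' _ lk _ ft _ _ _ _ bb).
    + by move=> a _; rewrite e ek.
    + apply: FPall_map; split; first exact: (FP_const _ _ (nseq (enum_rank (start_state M)) true)).
      apply: Pall_flatten => i'; do 2?[split; first by
        apply: FP_ext (FP_nil _ _) => a _; rewrite /= ffunE].
      split.
        apply: FP_ext (FPn_size (FP_var D env i')) => a _.
        by rewrite /= ffunE /= xsE; elim: (st env a i') => //= ? ? ->.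
      split=> //; apply: FP_ext (FP_var D env i') => a _.
      by rewrite /= ffunE /= xsE -map_comp map_id_in.
    + by apply: FPall_map; apply: FP_step.
    + move=> a _; split=> [|i']; first by rewrite size_nseq.
      rewrite /= ffunE /= size_map xsE add0n; apply: leq_trans (leq_addr _ _).
      exact: size_st_le.
    + move=> a b w c _ [/= lw lc]; split=> [|i']; first exact: ltnW.
      apply: leq_trans (step_size _ _) _; have := lc i'; rewrite /=; lia.
    + move=> a w c _ [lw lc]; apply: leq_trans (env_size_Pall (B := #|state M| + env_size env a + 2 * time a) _) _ => //.
      split.
        by rewrite size_nseq -addnA; apply: leq_trans (ltnW (ltn_ord _)) (leq_addr _ _).
      apply: Pall_flatten => i'.
      have le0 : env_size env a + 2 * (time a - size w) <=
          #|state M| + env_size env a + 2 * time a.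
        rewrite -addnA; apply: leq_trans (leq_addl _ _).
        by rewrite leq_add2l leq_mul2l leq_subr.
      have h1 := leq_trans (leq_trans (leq_addr _ _) (lc i')) le0.
      have h2 := leq_trans (leq_trans (leq_addl _ _) (lc i')) le0.
      by rewrite /= !size_map.
  apply: FP_leading_bits.
    exact: (fk 2 (fun c : config M => map isSome (c.2 i).2)).
  exact: (fk 3 (fun c : config M => map (odflt false) (c.2 i).2)).
apply: FP_ext (main ord_max) => a Da.
have loopE n c : loop (stp a) (nseq n true) c = iter n (@step M) c.
  by elim: n c => // n IH c; rewrite iterSr -IH.
rewrite loopE; have [hc <-] := h a Da.
rewrite /init -inpE //; set t := poly_eval _ _ in hc *.
have le : t <= time a.
  by rewrite /t inpE // /time /env_size; apply: leq_trans (pk _) _; rewrite -map_comp.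
by rewrite -(subnK le) iterD iter_halted.
Qed.

(** * Membership in PLS *)

Lemma FP_fold (A S : Type) (D : A -> Prop) env (w : A -> bitstring)
    (proj : seq (S -> bitstring)) (init : A -> S)
    (step : A -> S -> bool -> S) (Inv : A -> nat -> S -> Prop)
    (bnd : A -> nat) i (o : A -> bitstring) :
  i < size proj ->
  (forall a, D a -> o a = st proj (foldl (step a) (init a) (w a)) i) ->
  FP D env w ->
  FPall D env [seq (fun a => g (init a)) | g <- proj] ->
  (forall D', (forall p, D' p -> D p.1) ->
   FPall D' (loop_env env proj)
     [seq (fun p => g (step p.1 p.2.2 (head false p.2.1))) | g <- proj]) ->
  (forall a, D a -> Inv a (size (w a)) (init a)) ->
  (forall a b n s, D a -> Inv a n.+1 s -> Inv a n (step a s b)) ->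
  pbounded D env bnd ->
  (forall a n s, D a -> Inv a n s -> env_size proj s <= bnd a) ->
  FP D env o.
Proof.
move=> lt def fw fi fs i0 iS bb le.
pose stp a w s := step a s (head false w).
pose Inv' a (w : bitstring) s := Inv a (size w) s.
apply: (@FP_loop _ _ _ _ _ proj init stp Inv' bnd i _ lt _ fw fi _ i0 _ bb).
- move=> a Da; rewrite def //; congr (st proj _ i).
  by elim: (w a) (init a) => //= b x IH s; rewrite IH.
- by apply: fs => p [].
- by move=> a b w' s Da; apply: iS.
- by move=> a w' s Da; apply: le.
Qed.

(** * Assignments at Hamming distance at most two *)

Fixpoint flip (i : nat) (a : bitstring) : bitstring :=
  match a, i with
  | [::], _ => [::]
  | b :: a', 0 => ~~ b :: a'
  | b :: a', i'.+1 => b :: flip i' a'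
  end.

Lemma size_flip i a : size (flip i a) = size a.
Proof. by elim: a i => [|b a IH] [|i] //=; rewrite IH. Qed.

Lemma nth_flip i a k :
  nth false (flip i a) k = if (k == i) && (i < size a) then ~~ nth false a k else nth false a k.
Proof. by elim: a i k => [|b a IH] [|i] [|k] //=; rewrite ?andbF // IH eqSS. Qed.

Lemma flips_cons x y a b : flips (x :: a) (y :: b) = (x != y) + flips a b.
Proof. by []. Qed.

Lemma flipsxx a : flips a a = 0.
Proof. by elim: a => //= x a IH; rewrite flips_cons IH eqxx. Qed.

Lemma flips_flip a b i : flips a (flip i b) <= flips a b + 1.
Proof.
elim: b a i => [|y b IH] [|x a] [|i] //=; rewrite ?flips_cons.
- by rewrite /flips; case: x; case: y => /=; lia.
- by have := IH a i; rewrite /flips /=; lia.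
Qed.

Lemma flips0P a b : size a = size b -> flips a b = 0 -> a = b.
Proof.
elim: a b => [|x a IH] [|y b] //= [sz]; rewrite flips_cons.
by case: eqVneq => // <- /IH ->.
Qed.

Lemma flips1P a b : size a = size b -> flips a b <= 1 ->
  exists2 i, i <= size a & b = flip i a.
Proof.
elim: a b => [|x a IH] [|y b] //=; first by exists 0.
move=> [sz]; rewrite flips_cons; case: eqVneq => [<- /(IH _ sz) [i le ->]|ne le]; first by exists i.+1.
exists 0 => //; rewrite -(flips0P sz); last lia.
by case: x ne; case: y {le}.
Qed.

Lemma flips2P a b : size a = size b -> flips a b <= 2 ->
  exists i j, [/\ i <= size a, j <= size a & b = flip i (flip j a)].
Proof.
elim: a b => [|x a IH] [|y b] //=; first by exists 0, 0.
move=> [sz]; rewrite flips_cons; case: eqVneq => [<- /(IH _ sz) [i [j [li lj ->]]]|ne le].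
  by exists i.+1, j.+1.
have [|i li ->] := flips1P sz; first lia.
by exists 0, i.+1; split=> //=; case: x ne; case: y {le}.
Qed.

Lemma FP_flip (A : Type) (D : A -> Prop) env (n : A -> nat) u :
  FPn D env n -> FP D env u -> FP D env (fun a => flip (n a) (u a)).
Proof.
move=> fn fu; have fd := FP_drop fn fu; have ft := FP_take fn fu.
have flipE i x : flip i x = take i x ++
    (if drop i x is b :: r then ~~ b :: r else [::]).
  elim: x i => [|b x IH] [|i] //=; by rewrite IH.
apply: FP_ext (_ : FP D env (fun a => take (n a) (u a) ++
  (if drop (n a) (u a) is b :: r then ~~ b :: r else [::]))) => [a _|].
  by rewrite flipE.
apply: FP_cat => //; apply: (FP_case fd).
- by apply: FP_ext (FP_nil _ _) => a [_ ->].
- by apply: FP_ext (FP_cons false (FP_behead (FP_sub _ fd))) => a [Da [x E]] //; rewrite E.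
- by apply: FP_ext (FP_cons true (FP_behead (FP_sub _ fd))) => a [Da [x E]] //; rewrite E.
Qed.

Lemma encode_seq_flatten (T : Type) (e : T -> bitstring) s :
  encode_seq e s = flatten [seq true :: e x | x <- s] ++ [:: false].
Proof. by elim: s => //= x s ->; rewrite catA. Qed.

Lemma FP_encode_string (A : Type) (D : A -> Prop) env u :
  @FP A D env u -> FP D env (fun a => encode_seq encode_bit (u a)).
Proof.
move=> fu; apply: FP_ext (_ : FP D env (fun a =>
    flatten [seq [:: true; nth false (u a) i] | i <- iota 0 (size (u a))] ++ [:: false])) => [a _|].
  rewrite encode_seq_flatten -[in RHS](mkseq_nth false (u a)) /mkseq -map_comp //.
apply: FP_cat (FP_const _ _ _); apply: FP_flatmap (FPn_size fu) _.
apply: FP_cons; apply: FPb_nth; first exact: FP_index.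
by apply: FP_index_lift fu => p [].
Qed.

Lemma encode_unary_lead n x : find negb (encode_unary n ++ x) = n.
Proof. by rewrite /encode_unary; elim: n => //= n ->. Qed.

Lemma drop_encode_unary n x : drop n.+1 (encode_unary n ++ x) = x.
Proof. by rewrite drop_size_cat // /encode_unary size_rcons size_nseq. Qed.

(** The index [n] is out of range for an assignment and flips nothing, so that the list also
    contains the assignments with fewer than two changes. *)
Definition two_flips (n : nat) (a : bitstring) : seq bitstring :=
  [seq flip i (flip j a) | i <- iota 0 n.+1, j <- iota 0 n.+1].

Lemma two_flipsP (F : cnf) a s' : is_assignment F a ->
  (s' \in two_flips (nvars F) a) = flip_neighbor 2 F a s'.
Proof.
rewrite /flip_neighbor /is_assignment => /eqP sa; apply/allpairsP/andP => [[[i j] [_ _ ->]]|[/eqP ss fl]].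
  rewrite /= !size_flip sa; split=> //.
  have h1 := flips_flip a (flip j a) i; have h2 := flips_flip a a j.
  by apply: leq_trans h1 _; move: h2; rewrite flipsxx add0n -ltnS -addn1.
have [|i [j [li lj e]]] := flips2P _ fl; first by rewrite sa ss.
by exists (i, j); split; rewrite ?mem_iota /= ?ltnS -?sa.
Qed.

Record sat_state := SatState {
  ss_mode : nat;
  ss_cur : bitstring;
  ss_sat : bool;
  ss_out : bitstring
}.

(* Scanning the encoded clause list: mode 0 expects a clause, 1 a literal,
   2 reads the unary variable index (advancing [ss_cur] in the assignment),
   3 reads the sign. *)
Definition sat_step (a : bitstring) (s : sat_state) (b : bool) : sat_state :=
  let m := ss_mode s in
  SatState
    (if m == 0 then (if b then 1 else 4) else
     if m == 1 then (if b then 2 else 0) else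
     if m == 2 then (if b then 2 else 3) else
     if m == 3 then 1 else 4)
    (if m == 1 then a else
     if (m == 2) && b then behead (ss_cur s) else ss_cur s)
    (if m == 0 then false else
     if m == 3 then (if head false (ss_cur s) then ss_sat s || b else ss_sat s || ~~ b)
     else ss_sat s)
    (if (m == 1) && ~~ b then ss_sat s :: ss_out s else ss_out s).

Lemma sat_step_literal a l c s out :
  foldl (sat_step a) (SatState 2 (drop c a) s out) (encode_literal l) =
  SatState 1 (drop (c + l.1) a) (s || (nth false a (c + l.1) == l.2)) out.
Proof.
case: l => i b; rewrite /encode_literal /= foldl_cat.
have -> : foldl (sat_step a) (SatState 2 (drop c a) s out) (encode_unary i) =
    SatState 3 (drop (c + i) a) s out.
  rewrite /encode_unary -cats1 foldl_cat /=.
  have step1 k : sat_step a (SatState 2 (drop k a) s out) true =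
      SatState 2 (drop k.+1 a) s out by rewrite /sat_step /= -drop1 drop_drop add1n.
  elim: i c => [|i IH] c; first by rewrite addn0.
  by rewrite [foldl _ _ _]/= step1 IH addSnnS.
by rewrite /= /sat_step /= -nth0 nth_drop addn0; case: (nth _ _ _); case: b; case: s.
Qed.

Lemma sat_step_clause a C s cur out :
  exists cur', foldl (sat_step a) (SatState 1 cur s out) (encode_seq encode_literal C) =
  SatState 0 cur' (s || sat_clause a C) ((s || sat_clause a C) :: out).
Proof.
elim: C s cur => [|l C IH] s cur; first by exists a; rewrite /= /sat_step /= orbF.
rewrite /= foldl_cat {2}/sat_step /=.
have := sat_step_literal a l 0 s out; rewrite drop0 !add0n => ->.
have [cur' ->] := IH (s || (nth false a l.1 == l.2)) (drop l.1 a).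
by exists cur'; rewrite /sat_literal orbA.
Qed.

Lemma sat_step_clauses a Cs s cur out :
  ss_out (foldl (sat_step a) (SatState 0 cur s out)
     (encode_seq (encode_seq encode_literal) Cs)) =
  catrev [seq sat_clause a C | C <- Cs] out.
Proof.
elim: Cs s cur out => [|C Cs IH] s cur out //=.
rewrite foldl_cat {2}/sat_step /=.
by have [cur' ->] := sat_step_clause a C false cur out; rewrite IH.
Qed.

(** As the weights are distinct powers of two, the satisfaction bits are themselves the binary
    digits of the payoff; reversal puts the least significant one first. *)
Definition lex_digits (F : cnf) (a : bitstring) : bitstring :=
  rev [seq sat_clause a C | C <- clauses F].

Lemma bits_value_rcons u b : bits_value (rcons u b) = bits_value u + b * 2 ^ size u.
Proof.
elim: u => [|x u IH] /=; first by rewrite muln1 addn0.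
by rewrite IH expnS; lia.
Qed.

Lemma lex_digitsP F a : bits_value (lex_digits F a) = lex_payoff F a.
Proof.
rewrite /lex_digits /lex_payoff; elim: (clauses F) => [|C Cs IH] /=; first by rewrite big_ord0.
rewrite rev_cons bits_value_rcons IH size_rev size_map big_ord_recl /= subn1 addnC.
by congr (_ + _); apply: eq_bigr => i _; rewrite subSS.
Qed.

Lemma FP_lex_digits (A : Type) (D : A -> Prop) env (F : A -> cnf) a :
  FP D env (fun x => encode_cnf (F x)) -> FP D env a ->
  FP D env (fun x => lex_digits (F x) (a x)).
Proof.
move=> fF fa; have ba := FP_pb fa.
pose w x := encode_seq (encode_seq encode_literal) (clauses (F x)).
have fw : FP D env w.
  apply: FP_ext (FP_drop (FPn_S (FPn_lead fF)) fF) => x _.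
  by rewrite /encode_cnf encode_unary_lead drop_encode_unary.
have bw := FP_pb fw.
pose proj : seq (sat_state -> bitstring) :=
  [:: fun s => nseq (ss_mode s) true; ss_cur; fun s => [:: ss_sat s]; ss_out].
pose Inv x n s := [/\ ss_mode s <= 4, size (ss_cur s) <= size (a x) &
  size (ss_out s) + n <= size (w x)].
have bb : pbounded D env (fun x => 5 + size (a x) + size (w x)) by pb.
apply: (@FP_fold _ _ _ _ _ proj (fun x => SatState 0 (a x) false [::])
  (fun x => sat_step (a x)) Inv _ 3 _ _ _ fw _ _ _ _ bb) => //.
- by move=> x _; rewrite /st /= sat_step_clauses.
- split; first exact: (FP_const _ _ [::]).
  split; first exact: fa.
  split; first exact: (FP_const _ _ [:: false]).
  by split=> //; exact: (FP_const _ _ [::]).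
- move=> D0 sub; set E := loop_env _ _.
  have fm D' : FPn D' E (fun p => ss_mode p.2.2).
    exact: (@FP_loop_state _ _ _ _ _ 0 (fun s => nseq (ss_mode s) true)).
  have fc D' : FP D' E (fun p => ss_cur p.2.2) by exact: (@FP_loop_state _ _ _ _ _ 1 ss_cur).
  have fs D' : FP D' E (fun p => [:: ss_sat p.2.2]).
    by exact: (@FP_loop_state _ _ _ _ _ 2 (fun s => [:: ss_sat s])).
  have fo D' : FP D' E (fun p => ss_out p.2.2) by exact: (@FP_loop_state _ _ _ _ _ 3 ss_out).
  have fb D' : FP D' E (fun p => [:: head false p.2.1]) by exact: FPb_head (FP_loop_word _ _ _).
  have is_mode D' k : FP D' E (fun p => [:: ss_mode p.2.2 == k]).
    by apply: FPb_eqn => //; exact: FPn_const.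
  split.
    apply: FP_ext (FP_if (is_mode D0 0) (FP_if (fb _) (FPn_const _ _ 1) (FPn_const _ _ 4))
      (FP_if (is_mode _ 1) (FP_if (fb _) (FPn_const _ _ 2) (FPn_const _ _ 0))
      (FP_if (is_mode _ 2) (FP_if (fb _) (FPn_const _ _ 2) (FPn_const _ _ 3))
      (FP_if (is_mode _ 3) (FPn_const _ _ 1) (FPn_const _ _ 4))))) => p _ /=.
    by case: (ss_mode p.2.2) => [|[|[|[|m]]]] //=; case: (head _ _).
  split.
    apply: FP_ext (FP_if (is_mode D0 1) (FP_loop_lift _ _ fa)
      (FP_if (FPb_and (is_mode _ 2) (fb _)) (FP_behead (fc _)) (fc _))) => p //.
    by move=> [/sub].
  split.
    have for_ D' b1 b2 : FP D' E (fun p => [:: b1 p]) -> FP D' E (fun p => [:: b2 p]) ->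
        FP D' E (fun p => [:: b1 p || b2 p]).
      move=> f1 f2; apply: FP_ext (FPb_neg (FPb_and (FPb_neg f1) (FPb_neg f2))) => p _.
      by rewrite -negb_or negbK.
    apply: FP_ext (FP_if (is_mode D0 0) (FP_const _ _ [:: false])
      (FP_if (is_mode _ 3) (FP_if (FPb_head (fc _)) (for_ _ _ _ (fs _) (fb _))
         (for_ _ _ _ (fs _) (FPb_neg (fb _)))) (fs _))) => p _ /=.
    by do !case: ifP.
  split=> //.
  apply: FP_ext (FP_if (FPb_and (is_mode D0 1) (FPb_neg (fb _)))
     (FP_cat (fs _) (fo _)) (fo _)) => p _ //.
- move=> x b n s _ [h1 h2 h3]; split.
  + by rewrite /=; do !case: ifP.
  + by rewrite /=; do !case: ifP => //; rewrite ?size_behead => *; apply: leq_trans h2; lia.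
  + by rewrite /=; case: ifP => _ /=; lia.
- by move=> x n s _ [h1 h2 h3]; rewrite /env_size /= size_nseq; lia.
Qed.

Lemma lex_SAT_FLIP_in_PLS : in_PLS (lex_SAT_FLIP 3 2).
Proof.
pose A := ({F : cnf | kcnf 3 F} * bitstring)%type.
pose env : seq (A -> bitstring) := [:: fun Fs => encode_kcnf Fs.1; snd].
have fF D : FP D env (fun Fs => encode_cnf (sval Fs.1)).
  by apply: (@FP_var_of _ _ _ 0).
have fs D : FP D env snd by apply: (@FP_var_of _ _ _ 1).
have fn D : FPn D env (fun Fs => nvars (sval Fs.1)).
  by apply: FP_ext (FPn_lead (fF D)) => p _; rewrite /encode_cnf encode_unary_lead.
split.
- exists 'X%R => F s /eqP ->; rewrite /poly_eval hornerX /= /encode_kcnf /encode_cnf.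
  by rewrite size_cat size_rcons size_nseq; lia.
- by move=> F s s' _ /andP[].
- exact: FP_polytime (FPb_eqn (FPn_size (fs _)) (fn _)).
- exists (fun F => nseq (nvars (sval F)) false); split=> [F|]; first by rewrite /= /is_assignment size_nseq.
  pose env1 : seq ({F : cnf | kcnf 3 F} -> bitstring) := [:: @encode_kcnf 3].
  apply: (FP_polytime (env := env1)).
  have f1 : FPn (fun=> True) env1 (fun F => nvars (sval F)).
    apply: FP_ext (FPn_lead (FP_var _ env1 0)) => p _.
    by rewrite /st /= /encode_kcnf /encode_cnf encode_unary_lead.
  have := FP_flatmap (f := fun _ _ => [:: false]) f1 (FP_const _ _ _).
  have E n i : flatten [seq [:: false] | _ <- iota i n] = nseq n false.
    by elim: n i => //= n IH i; rewrite IH.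
  by apply: FP_ext => F _; rewrite E.
- exists (fun F s => lex_digits (sval F) s); split=> [F s _|]; first exact: lex_digitsP.
  exact: FP_polytime (FP_lex_digits (fF _) (fs _)).
- exists (fun F s => two_flips (nvars (sval F)) s); split=> [F s fe s'|].
    exact: two_flipsP.
  set D := (fun Is => _).
  apply: (FP_polytime (env := env)).
  pose f2 (p : (A * nat)) (j : nat) := true :: encode_seq encode_bit (flip p.2 (flip j p.1.2)).
  have := @FP_flatmap _ D env _ (fun q i => flatten [seq f2 (q, i) j |
     j <- iota 0 (nvars (sval q.1)).+1]) (FPn_S (fn D)).
  move=> H; apply: FP_ext (FP_cat (H _) (FP_const _ _ [:: false])) => [q _|].
    rewrite /encode_strings encode_seq_flatten /two_flips; congr (_ ++ _).
    suff E L1 L2 : flatten [seq flatten [seq f2 (q, i) j | j <- L2] | i <- L1] =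
      flatten [seq true :: encode_seq encode_bit x |
        x <- [seq flip i (flip j q.2) | i <- L1, j <- L2]] by exact: E.
    elim: L1 => //= i L1 IH.
    by rewrite map_cat flatten_cat -IH -map_comp.
  apply: FP_flatmap.
    by apply: (FP_index_lift _ (FPn_S (fn D))) => p [].
  apply: FP_cons; apply: FP_encode_string; apply: FP_flip.
    pose D2 (p : A * nat) := D p.1 /\ p.2 < (nvars (sval p.1.1)).+1.
    by apply: (FP_index_lift _ (FP_index D2 env)) => p [].
  apply: FP_flip; first exact: FP_index.
  have D1 (p : A * nat) : D p.1 /\ p.2 < (nvars (sval p.1.1)).+1 -> D p.1 by case.
  by apply: (FP_index_lift _ (FP_index_lift D1 (fs D))) => p [].
Qed.

(** * Local optima of the reduced formula *)

Definition pv (a : bitstring) (cs : seq clause) : nat :=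
  bits_value (rev [seq sat_clause a C | C <- cs]).

Lemma pv_cons a C cs : pv a (C :: cs) = pv a cs + sat_clause a C * 2 ^ size cs.
Proof. by rewrite /pv /= rev_cons bits_value_rcons size_rev size_map. Qed.

Lemma pv_bound a cs : pv a cs < 2 ^ size cs.
Proof.
elim: cs => // C cs IH; rewrite pv_cons /= expnS.
by case: (sat_clause a C); lia.
Qed.

(** A clause outweighs all later ones together. The first clause of [seg] violated by [a] therefore
    decides, whatever [b] destroys in [post]. *)
Lemma pv_lt a b pre seg post :
  (forall C, C \in pre -> sat_clause a C -> sat_clause b C) ->
  all (sat_clause b) seg -> ~~ all (sat_clause a) seg ->
  pv a (pre ++ seg ++ post) < pv b (pre ++ seg ++ post).
Proof.
move=> mono sb sa; elim: pre mono => [|C pre IH] mono /=; last first.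
  rewrite !pv_cons; have := mono C (mem_head _ _).
  have {}IH := IH (fun D h => mono D (@mem_behead _ (C :: pre) D h)).
  case: (sat_clause a C) => [/(_ isT) ->|_]; first by rewrite ltn_add2r.
  by rewrite mul0n addn0; exact: leq_trans IH (leq_addr _ _).
elim: seg sb sa => //= C seg IH /andP[bC sb]; rewrite !pv_cons bC.
case: (sat_clause a C) => /= sa; first by have := IH sb sa; lia.
have := pv_bound a (seg ++ post); lia.
Qed.

(** Written as a flip, out of range when nothing has to change, so that setting two variables is
    always an instance of the two flips of the neighbourhood. *)
Definition setv (v : nat) (c : bool) (a : bitstring) : bitstring :=
  flip (if nth false a v == c then size a else v) a.

Lemma size_setv v c a : size (setv v c a) = size a.
Proof. exact: size_flip. Qed.

Lemma nth_setv v c a k : v < size a ->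
  nth false (setv v c a) k = if k == v then c else nth false a k.
Proof.
move=> lt; rewrite /setv nth_flip; case: (eqVneq (nth false a v) c) => [<-|ne].
  by rewrite ltnn andbF; case: eqP => // ->.
by rewrite lt andbT; case: eqP => // ->; move: ne; case: (nth _ _ _); case: (c).
Qed.

(** The form in which local optimality is used: a segment that two assignments can repair at the
    expense of later clauses only cannot be in need of repair. *)
Lemma locopt_seg a pre seg post v1 c1 v2 c2 (x := setv v1 c1 (setv v2 c2 a)) :
  (forall i j, ~~ (pv a (pre ++ seg ++ post) < pv (flip i (flip j a)) (pre ++ seg ++ post))) ->
  (forall C, C \in pre -> sat_clause a C -> sat_clause x C) ->
  all (sat_clause x) seg -> all (sat_clause a) seg.
Proof.
move=> opt mono sx; case: (boolP (all _ _)) => // sa.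
by have := pv_lt post mono sx sa; rewrite /x /setv (negPf (opt _ _)).
Qed.

Lemma eq_sat_clause (a b : bitstring) (C : clause) :
  (forall l, l \in C -> nth false a l.1 = nth false b l.1) -> sat_clause a C = sat_clause b C.
Proof. by move=> e; apply: eq_in_has => l /e; rewrite /sat_literal => ->. Qed.

(* A gate [(v, (l1, l2))] owns three variables: [v] and [v.+1] are private
   copies of the literals [l1] and [l2], and [v.+2] is their conjunction. *)
Definition gate := (nat * (literal * literal))%type.

(** Topological order, with disjoint blocks of three variables: repairing a gate cannot disturb the
    gates before it. *)
Fixpoint wf_gates (lo : nat) (gs : seq gate) (hi : nat) : bool :=
  if gs is g :: gs' then
    [&& lo <= g.1, g.2.1.1 < g.1, g.2.2.1 < g.1 & wf_gates g.1.+3 gs' hi]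
  else lo <= hi.

Lemma wf_gates_le lo gs hi : wf_gates lo gs hi -> lo <= hi.
Proof.
by elim: gs lo => //= g gs IH lo /and4P[h1 _ _ /IH h2]; lia.
Qed.

Lemma wf_gates_cat lo mid hi gs gs' :
  wf_gates lo gs mid -> wf_gates mid gs' hi -> wf_gates lo (gs ++ gs') hi.
Proof.
elim: gs lo => [|g gs IH] lo /=; last by move=> /and4P[-> -> -> h] h'; rewrite IH.
case: gs' => [|g gs'] /=; first exact: leq_trans.
by move=> l /and4P[l' -> -> ->]; rewrite (leq_trans l l').
Qed.

Lemma wf_gates_mem lo gs hi g : wf_gates lo gs hi -> g \in gs ->
  [/\ lo <= g.1, g.2.1.1 < g.1, g.2.2.1 < g.1 & g.1.+3 <= hi].
Proof.
elim: gs lo => //= h gs IH lo /and4P[h1 h2 h3 h4]; rewrite inE => /orP[/eqP->|ing].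
  by split=> //; exact: wf_gates_le h4.
by have [*] := IH _ h4 ing; split=> //; lia.
Qed.

Lemma wf_gates_split lo g1 g g2 hi : wf_gates lo (g1 ++ g :: g2) hi ->
  (forall g', g' \in g1 -> g'.1.+3 <= g.1) /\ (forall g', g' \in g2 -> g.1.+3 <= g'.1).
Proof.
elim: g1 lo => [|h g1 IH] lo /= /and4P[h1 h2 h3 h4].
  by split=> // g' ing; have [] := wf_gates_mem h4 ing.
have [a1 a2] := IH _ h4; split=> // g'; rewrite inE => /orP[/eqP->|]; last exact: a1.
by have [|] := wf_gates_mem (g := g) h4; first by rewrite mem_cat mem_head orbT.
Qed.

Definition gate_ok (alpha : nat -> bool) (g : gate) : bool :=
  alpha g.1.+2 ==
  (alpha g.2.1.1 == g.2.1.2) && (alpha g.2.2.1 == g.2.2.2).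

(** Variable 0 is the switch [f]. The two copies of the circuit are interleaved after it, and the
    output variables follow both. *)
Definition cvar (b : bool) (v : nat) : nat := (v.*2 + b).+1.

Lemma cvar_inj b v b' v' : cvar b v = cvar b' v' -> b = b' /\ v = v'.
Proof. by rewrite /cvar; case: b; case: b' => /= h; split=> //; lia. Qed.

Definition neg (l : literal) : literal := (l.1, ~~ l.2).

Definition clit (b : bool) (l : literal) : literal := (cvar b l.1, l.2).

(** A true guard [gd] switches the equation off. *)
Definition eq_clauses (gd : literal) (v : nat) (l : literal) : seq clause :=
  [:: [:: gd; (v, true); neg l]; [:: gd; (v, false); l]].

Definition and_clauses (gd : literal) (w y z : nat) : seq clause :=
  [:: [:: gd; (z, false); (w, true)]; [:: gd; (z, false); (y, true)];
      [:: (w, false); (y, false); (z, true)]].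

Definition gate_clauses (b : bool) (gd : literal) (g : gate) : seq clause :=
  eq_clauses gd (cvar b g.1) (clit b g.2.1) ++
  eq_clauses gd (cvar b g.1.+1) (clit b g.2.2) ++
  and_clauses gd (cvar b g.1) (cvar b g.1.+1) (cvar b g.1.+2).

Lemma sat_eq_clauses a gd v l :
  all (sat_clause a) (eq_clauses gd v l) =
  sat_literal a gd || (nth false a v == sat_literal a l).
Proof.
rewrite /= /sat_clause /= /sat_literal /= !orbF andbT.
case: (_ == gd.2) => //=; case: (nth false a v); case: (nth false a l.1); by case: (l.2).
Qed.

Lemma sat_and_clauses a gd w y z :
  all (sat_clause a) (and_clauses gd w y z) =
  (sat_literal a gd || (nth false a z ==> nth false a w && nth false a y)) &&
  (nth false a w && nth false a y ==> nth false a z).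
Proof.
rewrite /= /sat_clause /= /sat_literal /= !orbF andbT.
case: (_ == gd.2) => //=; case: (nth false a w); case: (nth false a y); by case: (nth false a z).
Qed.

(** * The formula containing two copies of a circuit *)

Section Formula.

Variables (L V NV : nat) (gs : seq gate) (nw vw : nat -> nat).

Definition ovar (j : nat) : nat := (NV.*2 + j).+1.

(** The guard [(0, ~~ b)] is false exactly when variable 0 equals [b], so the guarded clauses bind
    copy [b] while it is active. The opposite guard [(0, b)] in [low] binds it while it is
    inactive. *)
Definition top (b : bool) : seq clause :=
  flatten [seq gate_clauses b (0, ~~ b) g | g <- gs].

Definition mid_eqs (j : nat) : seq clause :=
  eq_clauses (0, true) (ovar j) (cvar false (vw j), true) ++
  eq_clauses (0, false) (ovar j) (cvar true (vw j), true).

Definition mid (j : nat) : seq clause := mid_eqs j ++ [:: [:: (ovar j, true)]].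

Definition copies (b : bool) : seq clause :=
  flatten [seq eq_clauses (0, b) (cvar b j) (cvar (~~ b) (nw j), true) | j <- iota 0 L].

Definition low (b : bool) : seq clause :=
  copies b ++ flatten [seq gate_clauses b (0, b) g | g <- gs].

Definition mids (n : nat) : seq clause := flatten [seq mid j | j <- iota 0 n].

Definition formula : seq clause :=
  top false ++ top true ++ mids V ++ low false ++ low true.

Hypothesis wf : wf_gates L gs NV.
Hypothesis nw_lt : forall j, j < L -> nw j < NV.
Hypothesis vw_lt : forall j, j < V -> vw j < NV.

Lemma formula_kcnf : kcnf 3 (CNF (NV.*2 + V).+1 formula).
Proof.
have cv b v : v < NV -> cvar b v < (NV.*2 + V).+1 by rewrite /cvar; case: b => /=; lia.
have LNV : L <= NV := wf_gates_le wf.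
rewrite /kcnf [clauses _]/= [nvars _]/=; set n := (NV.*2 + V).+1; set P := (fun C => _).
have eqP b v l : v < n -> l.1 < n -> all P (eq_clauses (0, b) v l).
  by move=> h1 h2; rewrite /P /= h1 h2.
have gates b s : all P (flatten [seq gate_clauses b (0, s) g | g <- gs]).
  apply/allP => C /flatten_mapP[g ing]; apply/allP: C.
  have [] := wf_gates_mem wf ing; case: g {ing} => v [[u1 s1] [u2 s2]] /= _ h1 h2 h3.
  have [c1 c2] : cvar b u1 < n /\ cvar b u2 < n by split; apply: cv; lia.
  have [d1 d2 d3] : [/\ cvar b v < n, cvar b v.+1 < n & cvar b v.+2 < n].
    by split; apply: cv; lia.
  by rewrite /P /= c1 c2 d1 d2 d3.
have cops b : all P (copies b).
  apply/allP => C /flatten_mapP[j]; rewrite mem_iota add0n /= => lj; apply/allP: C.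
  by apply: eqP => /=; apply: cv; [lia | exact: nw_lt].
rewrite !all_cat !gates !cops /= !andbT; apply/allP => C /flatten_mapP[j].
rewrite mem_iota add0n /= => lj; apply/allP: C.
have lo : ovar j < n by rewrite /ovar /n; lia.
by rewrite !all_cat !eqP /P /= ?lo ?cv ?vw_lt.
Qed.

Variable a : bitstring.
Hypothesis size_a : size a = (NV.*2 + V).+1.
Hypothesis opt : forall i j, ~~ (pv a formula < pv (flip i (flip j a)) formula).

Let f := nth false a 0.
Let val b v := nth false a (cvar b v).

Lemma cvar_lt b v : v < NV -> cvar b v < size a.
Proof. by rewrite size_a /cvar; case: b => /=; lia. Qed.

Lemma L_le_NV : L <= NV.
Proof. exact: wf_gates_le wf. Qed.

Lemma cvar_ovar b v j : v < NV -> cvar b v <> ovar j.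
Proof. by rewrite /cvar /ovar; case: b => /=; lia. Qed.

Lemma gate_clauses_vars b gd g C l : g.2.1.1 < g.1 -> g.2.2.1 < g.1 ->
  C \in gate_clauses b gd g -> l \in C ->
  l.1 = gd.1 \/ exists2 u, u < g.1.+3 & l.1 = cvar b u.
Proof.
case: g => v [[u1 s1] [u2 s2]] /= l1 l2; set g := (v, _) => inC inl.
pose Q (l : literal) := (l.1 == gd.1) || has (fun u => l.1 == cvar b u) (iota 0 v.+3).
have Qgd : Q gd by rewrite /Q eqxx.
have Qv u s : u < v.+3 -> Q (cvar b u, s).
  by move=> lt; apply/orP; right; apply/hasP; exists u; rewrite ?mem_iota.
have : all (all Q) (gate_clauses b gd g).
  by rewrite /gate_clauses /neg /clit /= !Qgd !Qv //; lia.
move=> /allP/(_ _ inC)/allP/(_ _ inl)/orP[/eqP|/hasP[u]]; first by left.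
by rewrite mem_iota => lt /eqP e; right; exists u.
Qed.

Definition pre_low (b : bool) : seq clause :=
  top false ++ top true ++ mids V ++ (if b then low false else [::]).

Lemma locopt pre seg post v1 c1 v2 c2 (x := setv v1 c1 (setv v2 c2 a)) :
  formula = pre ++ seg ++ post ->
  (forall C, C \in pre -> sat_clause a C -> sat_clause x C) ->
  all (sat_clause x) seg -> all (sat_clause a) seg.
Proof.
by move=> def mono sx; apply: (@locopt_seg a pre seg post v1 c1 v2 c2) => //; rewrite -def.
Qed.

Lemma locopt1 pre seg post v c (x := setv v c a) :
  formula = pre ++ seg ++ post ->
  (forall C, C \in pre -> sat_clause a C -> sat_clause x C) ->
  all (sat_clause x) seg -> all (sat_clause a) seg.
Proof.
have e : setv v c a = setv v c (setv v (nth false a v) a).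
  have -> // : setv v (nth false a v) a = a.
  rewrite /setv eqxx; elim: (a) => //= b s ->; by [].
by rewrite /x e; apply: locopt.
Qed.

Lemma flatten_cons_split (T : Type) (F : T -> seq clause) s1 y s2 :
  flatten [seq F x | x <- s1 ++ y :: s2] =
  flatten [seq F x | x <- s1] ++ F y ++ flatten [seq F x | x <- s2].
Proof. by rewrite map_cat flatten_cat. Qed.

Lemma all_gates b gd :
  (forall g1 g g2, gs = g1 ++ g :: g2 ->
     all (sat_clause a) (flatten [seq gate_clauses b gd g | g <- g1]) ->
     all (sat_clause a) (gate_clauses b gd g)) ->
  all (sat_clause a) (flatten [seq gate_clauses b gd g | g <- gs]).
Proof.
move=> h; suff: forall g1 g2, gs = g1 ++ g2 ->
    all (sat_clause a) (flatten [seq gate_clauses b gd g | g <- g1]).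
  by move/(_ gs [::]); rewrite cats0; apply.
elim/last_ind=> [|g1 g IH] g2 def //.
rewrite map_rcons flatten_rcons all_cat (IH (g :: g2)) ?def ?cat_rcons //=.
by apply: (h g1 g g2) => //; [rewrite def cat_rcons | apply: (IH (g :: g2)); rewrite def cat_rcons].
Qed.


(** Such clauses are insensitive to changes in copy [b] from variable [k] on. This links priority
    with topological order. *)
Definition vars_below b k (cs : seq clause) : Prop :=
  forall C l, C \in cs -> l \in C ->
  [\/ l.1 = 0, exists u, l.1 = cvar (~~ b) u | exists2 u, u < k & l.1 = cvar b u].

Lemma vars_below_cat b k cs cs' :
  vars_below b k cs -> vars_below b k cs' -> vars_below b k (cs ++ cs').
Proof. by move=> h h' C l; rewrite mem_cat => /orP[/h|/h']; apply. Qed.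

Lemma vars_below_le b k k' cs : k <= k' -> vars_below b k cs -> vars_below b k' cs.
Proof.
move=> le h C l inC inl; case: (h _ _ inC inl) => [?|?|[u lt e]];
  [by constructor 1 | by constructor 2 | constructor 3].
by exists u => //; exact: leq_trans lt le.
Qed.

Lemma vars_below_eq b k s u l0 : u < k ->
  (exists u', l0.1 = cvar (~~ b) u') \/ (exists2 u', u' < k & l0.1 = cvar b u') ->
  vars_below b k (eq_clauses (0, s) (cvar b u) l0).
Proof.
move=> lt h C l; rewrite !inE => /orP[/eqP->|/eqP->]; rewrite !inE => /or3P[]/eqP-> /=.
all: try by constructor 1.
all: try by constructor 3; exists u.
all: by case: h => [h|h]; [constructor 2 | constructor 3].
Qed.

Lemma vars_below_gates b k s g1 : {subset g1 <= gs} ->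
  (forall g, g \in g1 -> g.1.+3 <= k) ->
  vars_below b k (flatten [seq gate_clauses b (0, s) g | g <- g1]).
Proof.
move=> sub le C l /flatten_mapP[g ing inC] inl.
have [_ h1 h2 _] := wf_gates_mem wf (sub _ ing).
have [|[u lt e]] := gate_clauses_vars h1 h2 inC inl; first by constructor 1.
by constructor 3; exists u => //; apply: leq_trans lt (le _ ing).
Qed.

Lemma vars_other_gates b k s :
  vars_below b k (flatten [seq gate_clauses (~~ b) (0, s) g | g <- gs]).
Proof.
move=> C l /flatten_mapP[g ing inC] inl.
have [_ h1 h2 _] := wf_gates_mem wf ing.
have [|[u lt e]] := gate_clauses_vars h1 h2 inC inl; first by constructor 1.
by constructor 2; exists u.
Qed.

Lemma vars_below_mono b k cs x : vars_below b k cs ->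
  (forall u, (forall v, k <= v -> u <> cvar b v) -> nth false x u = nth false a u) ->
  forall C, C \in cs -> sat_clause a C -> sat_clause x C.
Proof.
move=> vb agree C inC; rewrite (@eq_sat_clause x a) // => l inl; apply: agree => v le.
case: (vb _ _ inC inl) => [->//|[u ->]|[u lt ->]] /cvar_inj [].
  by case: (b).
by lia.
Qed.

Lemma nth_setc b u c k : u < NV ->
  nth false (setv (cvar b u) c a) k = if k == cvar b u then c else nth false a k.
Proof. by move=> lt; rewrite nth_setv // cvar_lt. Qed.

Lemma val_setc b u c b' u' : u < NV ->
  nth false (setv (cvar b u) c a) (cvar b' u') =
  if (b' == b) && (u' == u) then c else nth false a (cvar b' u').
Proof.
move=> lt; rewrite nth_setc //; case: eqP => [/cvar_inj[-> ->]|ne]; first by rewrite !eqxx.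
by case: andP => // -[/eqP e1 /eqP e2]; case: ne; rewrite e1 e2.
Qed.

Lemma sat_clit x b l : sat_literal x (clit b l) = (nth false x (cvar b l.1) == l.2).
Proof. by []. Qed.

Lemma gates_split g1 g g2 : gs = g1 ++ g :: g2 ->
  [/\ L <= g.1, g.2.1.1 < g.1, g.2.2.1 < g.1 & g.1.+3 <= NV] /\
  [/\ {subset g1 <= gs}, forall g', g' \in g1 -> g'.1.+3 <= g.1 &
   forall g', g' \in gs -> g' = g \/ (forall u, g.1 <= u < g.1.+3 -> ~~ (g'.1 <= u < g'.1.+3))].
Proof.
move=> def; have ing : g \in gs by rewrite def mem_cat mem_head orbT.
split; first exact: wf_gates_mem wf ing.
have [h1 h2] : (forall g', g' \in g1 -> g'.1.+3 <= g.1) /\ (forall g', g' \in g2 -> g.1.+3 <= g'.1).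
  by apply: (@wf_gates_split L g1 g g2 NV); rewrite -def.
split=> // [g' h|g']; first by rewrite def mem_cat h.
rewrite def mem_cat inE => /or3P[/h1 le|/eqP|/h2 le]; [right=> u|by left|right=> u]; lia.
Qed.

(** The private copies and the conjunction of a gate are reset in this order, one flip each. The
    variable reset occurs in no clause of higher priority: earlier gates use smaller variables, and
    the other copy has its own. For the inactive copy the gain is the unguarded implication
    [top_and]. *)
Lemma top_sat b :
  all (sat_clause a) (top b).
Proof.
pose rest := (if b then [::] else top true) ++ mids V ++ low false ++ low true.
pose pre0 := if b then top false else [::].
have def0 : formula = pre0 ++ top b ++ rest.
  by rewrite /formula /pre0 /rest; case: b {pre0 rest}.
have vb0 k : vars_below b k pre0.
  by rewrite /pre0; case: b {pre0 def0 rest} => //; exact: vars_other_gates.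
apply: all_gates => g1 g g2 def _.
have [[lo l1 l2 hi] [sub bef aft]] := gates_split def.
pose P0 := pre0 ++ flatten [seq gate_clauses b (0, ~~ b) g | g <- g1].
pose P1 := flatten [seq gate_clauses b (0, ~~ b) g | g <- g2] ++ rest.
have vb1 : vars_below b g.1 P0 by apply: vars_below_cat => //; exact: vars_below_gates.
pose E1 := eq_clauses (0, ~~ b) (cvar b g.1) (clit b g.2.1).
pose E2 := eq_clauses (0, ~~ b) (cvar b g.1.+1) (clit b g.2.2).
pose E3 := and_clauses (0, ~~ b) (cvar b g.1) (cvar b g.1.+1) (cvar b g.1.+2).
have def1 : formula = P0 ++ E1 ++ E2 ++ E3 ++ P1.
  by rewrite def0 /top def flatten_cons_split /gate_clauses /P0 /P1 -!catA.
have vE1 : vars_below b g.1.+1 E1.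
  by apply: vars_below_eq => //; right; exists g.2.1.1 => //; exact: ltnW.
have vE2 : vars_below b g.1.+2 E2.
  by apply: vars_below_eq => //; right; exists g.2.2.1 => //; lia.
have agree u c k : k <= u -> u < NV -> forall u', (forall v, k <= v -> u' <> cvar b v) ->
    nth false (setv (cvar b u) c a) u' = nth false a u'.
  by move=> le lt u' h; rewrite nth_setc //; case: eqP => // e; case: (h u).
rewrite /gate_clauses -/E1 -/E2 -/E3 !all_cat; apply/and3P; split.
- apply: (@locopt1 P0 E1 (E2 ++ E3 ++ P1) (cvar b g.1) (sat_literal a (clit b g.2.1))) => //.
    by apply: vars_below_mono vb1 _; apply: agree; lia.
  rewrite /E1 sat_eq_clauses !sat_clit !val_setc; try lia.
  by rewrite !eqxx /= ifN ?eqxx ?orbT //; lia.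
- apply: (@locopt1 (P0 ++ E1) E2 (E3 ++ P1) (cvar b g.1.+1) (sat_literal a (clit b g.2.2))).
  + by rewrite def1 -!catA.
  + have vb : vars_below b g.1.+1 (P0 ++ E1) by apply: vars_below_cat => //; apply: vars_below_le vb1.
    by apply: vars_below_mono vb _; apply: agree; lia.
  rewrite /E2 sat_eq_clauses !sat_clit !val_setc; try lia.
  by rewrite !eqxx /= ifN ?eqxx ?orbT //; lia.
- apply: (@locopt1 (P0 ++ E1 ++ E2) E3 P1 (cvar b g.1.+2) (val b g.1 && val b g.1.+1)).
  + by rewrite def1 -!catA.
  + have vb : vars_below b g.1.+2 (P0 ++ E1 ++ E2).
      apply: vars_below_cat; first by apply: vars_below_le vb1; lia.
      by apply: vars_below_cat => //; apply: vars_below_le vE1.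
    by apply: vars_below_mono vb _; apply: agree; lia.
  rewrite /E3 sat_and_clauses !val_setc; try lia.
  rewrite !eqxx /= !ifN; try lia.
  by rewrite /val; case: (nth _ _ _ && _); rewrite /= ?orbT.
Qed.


Lemma sat_gate_clauses x b gd g :
  all (sat_clause x) (gate_clauses b gd g) =
  [&& sat_literal x gd || (nth false x (cvar b g.1) == sat_literal x (clit b g.2.1)),
      sat_literal x gd || (nth false x (cvar b g.1.+1) == sat_literal x (clit b g.2.2)),
      sat_literal x gd || (nth false x (cvar b g.1.+2) ==>
         nth false x (cvar b g.1) && nth false x (cvar b g.1.+1)) &
      nth false x (cvar b g.1) && nth false x (cvar b g.1.+1) ==> nth false x (cvar b g.1.+2)].
Proof. by rewrite /gate_clauses !all_cat !sat_eq_clauses sat_and_clauses. Qed.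

Lemma top_gate b g : g \in gs -> all (sat_clause a) (gate_clauses b (0, ~~ b) g).
Proof.
move=> ing; apply/allP => C inC; apply: (allP (top_sat b)).
by apply/flatten_mapP; exists g.
Qed.

Lemma top_and b g : g \in gs -> val b g.1 && val b g.1.+1 ==> val b g.1.+2.
Proof. by move/(top_gate b); rewrite sat_gate_clauses => /and4P[]. Qed.

Lemma mids_split j : j < V -> exists post, formula = (top false ++ top true ++ mids j) ++ mid j ++ post.
Proof.
move=> lt; exists (flatten [seq mid j | j <- iota j.+1 (V - j.+1)] ++ low false ++ low true).
rewrite /formula /mids; have -> : iota 0 V = iota 0 j ++ j :: iota j.+1 (V - j.+1).
  by rewrite -[_ :: _]/(iota j (V - j.+1).+1) -iotaD; congr iota; lia.
by rewrite flatten_cons_split -!catA.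
Qed.

Lemma mid_vars i C l : C \in mid i -> l \in C ->
  [\/ l.1 = 0, l.1 = ovar i | exists b, l.1 = cvar b (vw i)].
Proof.
move=> inC inl; pose Q (l : literal) := [|| l.1 == 0, l.1 == ovar i,
  l.1 == cvar false (vw i) | l.1 == cvar true (vw i)].
have /allP/(_ _ inC)/allP/(_ _ inl) : all (all Q) (mid i).
  by rewrite /mid /Q /= !eqxx /= !orbT.
case/or4P => /eqP e; [by constructor 1 | by constructor 2 | |]; constructor 3.
  by exists false.
by exists true.
Qed.

(** The variable [o_j] occurs in no earlier clause, and the wish that it be true comes only after
    these equations; so it can be corrected by one flip. *)
Lemma mid_eqs_sat j : j < V -> all (sat_clause a) (mid_eqs j).
Proof.
move=> lt; have [post def] := mids_split lt; rewrite /mid -[(mid_eqs j ++ _) ++ post]catA in def.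
have lo : ovar j < size a by rewrite size_a /ovar; lia.
apply: (@locopt1 _ _ _ (ovar j) (val f (vw j)) def).
  move=> C inC; rewrite (@eq_sat_clause _ a) // => l inl; rewrite nth_setv //.
  case: eqP => // e; exfalso; move: inC; rewrite !mem_cat => /or3P[].
  - move=> /flatten_mapP[g ing inC]; have [_ h1 h2 h3] := wf_gates_mem wf ing.
    have [|[u lu e']] := gate_clauses_vars h1 h2 inC inl; first by rewrite e.
    by apply: (@cvar_ovar false u j); [apply: leq_trans lu h3 | rewrite -e'].
  - move=> /flatten_mapP[g ing inC]; have [_ h1 h2 h3] := wf_gates_mem wf ing.
    have [|[u lu e']] := gate_clauses_vars h1 h2 inC inl; first by rewrite e.
    by apply: (@cvar_ovar true u j); [apply: leq_trans lu h3 | rewrite -e'].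
  - move=> /flatten_mapP[i]; rewrite mem_iota add0n /= => lij inC.
    have vi := vw_lt (ltn_trans lij lt).
    case: (mid_vars inC inl) => [||[b]]; rewrite e //.
      by rewrite /ovar; lia.
    by move/esym; apply: cvar_ovar.
rewrite /mid_eqs all_cat !sat_eq_clauses /sat_literal /= !nth_setv //.
rewrite !eqxx.
have ne b : cvar b (vw j) == ovar j = false by apply/eqP; apply: cvar_ovar; apply: vw_lt.
rewrite !ne /= /val /f; case: (nth false a 0); rewrite /= ?eqb_id ?eqxx //.
Qed.

(** The inactive copy may be rewritten freely as long as its unguarded gate clauses hold. Its other
    gate clauses in [top] are switched off, the value equations in force read the other copy, and
    when [b] is true the copying clauses of [low false] are off as well. *)
Lemma pre_low_mono b x : b = ~~ f ->
  (forall u, (forall v, v < NV -> u <> cvar b v) -> nth false x u = nth false a u) ->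
  (forall g, g \in gs ->
     nth false x (cvar b g.1) && nth false x (cvar b g.1.+1) ==> nth false x (cvar b g.1.+2)) ->
  forall C, C \in pre_low b -> sat_clause a C -> sat_clause x C.
Proof.
move=> bf agree andx.
have x0 : nth false x 0 = ~~ b by rewrite agree // bf negbK.
have a0 : nth false a 0 = ~~ b by rewrite bf negbK.
have agreef v : nth false x (cvar (~~ b) v) = nth false a (cvar (~~ b) v).
  by apply: agree => v' _ /cvar_inj []; case: (b).
have agreeo j : nth false x (ovar j) = nth false a (ovar j).
  by apply: agree => v lv /esym; apply: cvar_ovar.
have other s C : C \in flatten [seq gate_clauses (~~ b) (0, s) g | g <- gs] ->
    sat_clause a C -> sat_clause x C.
  move=> inC; rewrite (@eq_sat_clause x a) // => l inl.
  case: (@vars_other_gates b 0 _ _ _ inC inl) => [->|[u ->]|[]] //.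
  by rewrite x0 a0.
have same C : C \in top b -> sat_clause x C.
  move=> /flatten_mapP[g ing inC].
  have /allP : all (sat_clause x) (gate_clauses b (0, ~~ b) g); last exact.
  have gx : sat_literal x (0, ~~ b) by rewrite /sat_literal /= x0.
  by rewrite sat_gate_clauses gx /= andx.
have topb b' C : C \in top b' -> sat_clause a C -> sat_clause x C.
  by case: (eqVneq b' b) => [-> /same //|ne]; have -> : b' = ~~ b; [case: (b) ne; case: b' | exact: other].
move=> C; rewrite /pre_low !mem_cat => /or4P[/topb//|/topb//| |].
- move=> /flatten_mapP[j]; rewrite mem_iota add0n /= => lj inC.
  have guarded s v l : s = ~~ b -> C \in eq_clauses (0, s) v l -> sat_clause x C.
    move=> es inE; apply: (allP _ _ inE); rewrite sat_eq_clauses /sat_literal /= x0 es eqxx //.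
  have unch s : C \in eq_clauses (0, s) (ovar j) (cvar (~~ b) (vw j), true) ->
      sat_clause a C -> sat_clause x C.
    move=> inE; rewrite (@eq_sat_clause x a) // => l.
    by move: inE; rewrite !inE => /orP[]/eqP->; rewrite !inE => /or3P[]/eqP-> //=; rewrite x0 a0.
  move: inC; rewrite !mem_cat => /orP[/orP[]|].
  + by case eb: b unch guarded => unch guarded; [exact: unch | move=> inC _; apply: guarded inC].
  + by case eb: b unch guarded => unch guarded; [move=> inC _; apply: guarded inC | exact: unch].
  + by rewrite inE => /eqP->; rewrite /sat_clause /= /sat_literal /= agreeo.
- case eb: b {same} other x0 a0 agreef => //= other x0 a0 agreef.
  rewrite mem_cat => /orP[|]; last exact: other.
  move=> /flatten_mapP[j]; rewrite mem_iota add0n /= => lj inE _.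
  by apply: (allP _ _ inE); rewrite sat_eq_clauses /sat_literal /= x0.
Qed.

(** Repairs follow the order of the clauses. An input variable occurs in no unguarded clause, so one
    flip corrects it; correcting a private copy may require a second flip, of the conjunction of the
    same gate. *)
Lemma low_sat b : b = ~~ f -> all (sat_clause a) (low b).
Proof.
move=> bf.
have def0 : formula = pre_low b ++ low b ++ (if b then [::] else low true).
  by rewrite /formula /pre_low; case: b {bf} => /=; rewrite ?cats0 -!catA.
rewrite all_cat; apply/andP; split.
  apply/allP => C /flatten_mapP[j]; rewrite mem_iota add0n /= => lj.
  have lNV : j < NV := leq_trans lj L_le_NV.
  set seg := eq_clauses _ _ _; suff: all (sat_clause a) seg by move/allP; apply.
  pose cps := flatten [seq eq_clauses (0, b) (cvar b j) (cvar (~~ b) (nw j), true) | j <- iota 0 j].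
  have [post def] : exists post, formula = (pre_low b ++ cps) ++ seg ++ post.
    eexists; rewrite def0 /low /copies.
    have -> : iota 0 L = iota 0 j ++ j :: iota j.+1 (L - j.+1).
      by rewrite -[_ :: _]/(iota j (L - j.+1).+1) -iotaD; congr iota; lia.
    by rewrite flatten_cons_split -!catA; reflexivity.
  apply: (@locopt1 _ _ _ (cvar b j) (val f (nw j)) def).
    move=> C'; rewrite mem_cat => /orP[|].
      apply: pre_low_mono => // [u h|g ing]; first by rewrite nth_setc //; case: eqP => // /h.
      have [lo _ _ _] := wf_gates_mem wf ing.
      rewrite !val_setc // !ifN; try lia.
      exact: top_and.
    have vb : vars_below b j cps.
      move=> C0 l /flatten_mapP[i]; rewrite mem_iota add0n /= => li inC0.
      by apply: (vars_below_eq (u := i) _ _ inC0) => //; left; exists (nw i).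
    apply: (vars_below_mono vb) => u h; rewrite nth_setc //; case: eqP => // e.
    by case: (h j).
  rewrite /seg sat_eq_clauses {2}/sat_literal /= !val_setc // !eqxx /= ifN; last by case: (b).
  by rewrite bf negbK eqb_id eqxx orbT.
apply: all_gates => g1 g g2 def _.
have [[lo l1 l2 hi] [sub bef aft]] := gates_split def.
pose P0 := copies b ++ flatten [seq gate_clauses b (0, b) g | g <- g1].
pose P1 := flatten [seq gate_clauses b (0, b) g | g <- g2] ++ (if b then [::] else low true).
have vcp : vars_below b g.1 (copies b).
  move=> C0 l /flatten_mapP[i]; rewrite mem_iota add0n /= => li inC0.
  apply: (vars_below_eq (u := i) _ _ inC0) => //; first exact: leq_trans li lo.
  by left; exists (nw i).
have vb1 : vars_below b g.1 P0 by apply: vars_below_cat => //; exact: vars_below_gates.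
pose E1 := eq_clauses (0, b) (cvar b g.1) (clit b g.2.1).
pose E2 := eq_clauses (0, b) (cvar b g.1.+1) (clit b g.2.2).
pose E3 := and_clauses (0, b) (cvar b g.1) (cvar b g.1.+1) (cvar b g.1.+2).
have def1 : formula = pre_low b ++ P0 ++ E1 ++ E2 ++ E3 ++ P1.
  by rewrite def0 {1}/low def flatten_cons_split /gate_clauses /P0 /P1 -!catA.
have vE1 : vars_below b g.1.+1 E1.
  by apply: vars_below_eq => //; right; exists g.2.1.1 => //; exact: ltnW.
have vE2 : vars_below b g.1.+2 E2.
  by apply: vars_below_eq => //; right; exists g.2.2.1 => //; lia.
have z_lt : g.1.+2 < NV by [].
have set2 u c c' b' u' : g.1 <= u < g.1.+3 ->
    nth false (setv (cvar b g.1.+2) c' (setv (cvar b u) c a)) (cvar b' u') =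
    if (b' == b) && (u' == g.1.+2) then c' else
    if (b' == b) && (u' == u) then c else nth false a (cvar b' u').
  move=> /andP[_ lu]; have lu' : u < NV := leq_trans lu hi.
  rewrite nth_setv ?size_setv ?cvar_lt // val_setc //.
  case: eqP => [/cvar_inj[-> ->]|ne]; first by rewrite !eqxx.
  by rewrite [RHS]ifN //; apply/negP => /andP[/eqP e1 /eqP e2]; apply: ne; rewrite e1 e2.
(* Here privacy pays off: the variables of [g] occur in no unguarded clause of another gate, so only
   the implication of [g] itself has to be checked. *)
have mono u c c' k cs : g.1 <= u < g.1.+3 -> k <= u -> vars_below b k cs ->
    (let x := setv (cvar b g.1.+2) c' (setv (cvar b u) c a) in
     nth false x (cvar b g.1) && nth false x (cvar b g.1.+1) ==> nth false x (cvar b g.1.+2)) ->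
    forall C, C \in pre_low b ++ cs -> sat_clause a C ->
      sat_clause (setv (cvar b g.1.+2) c' (setv (cvar b u) c a)) C.
  move=> ug ku vb andg C.
  have lu' : u < NV by case/andP: ug => _ lu; exact: leq_trans lu hi.
  have agree u0 : (forall v, k <= v < NV -> u0 <> cvar b v) ->
      nth false (setv (cvar b g.1.+2) c' (setv (cvar b u) c a)) u0 = nth false a u0.
    move=> h; rewrite nth_setv ?size_setv ?cvar_lt // nth_setc //.
    case: eqP => [e|_]; first by case: (h g.1.+2) => //; lia.
    by case: eqP => [e|//]; case: (h u) => //; lia.
  rewrite mem_cat => /orP[|].
    apply: pre_low_mono => // [u0 h|g' ing'].
      by apply: agree => v /andP[_ lv]; exact: h.
    case: (aft _ ing') => [->//|dis].
    have d1 := dis _ ug; have d2 : ~~ (g'.1 <= g.1.+2 < g'.1.+3) by apply: dis; lia.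
    have := top_and b ing'; rewrite /val; move: d1 d2; clear - ug set2.
    case: g' => v' ls /= d1 d2 h.
    by rewrite !set2 // !eqxx /= !ifN //; lia.
  move=> inC; apply: (vars_below_mono vb _ inC) => u0 h; apply: agree => v /andP[kv _].
  exact: h.
have n02 : (g.1 == g.1.+2) = false by lia.
have n12 : (g.1.+1 == g.1.+2) = false by lia.
have n01 : (g.1 == g.1.+1) = false by lia.
have n10 : (g.1.+1 == g.1) = false by lia.
rewrite /gate_clauses -/E1 -/E2 -/E3 !all_cat; apply/and3P; split.
(* The conjunction is only raised, namely when both private copies become true. This keeps the
   unguarded clause; the clauses that would object to a conjunction too large come later. *)
- set c := sat_literal a (clit b g.2.1).
  apply: (@locopt (pre_low b ++ P0) E1 (E2 ++ E3 ++ P1)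
    (cvar b g.1.+2) (val b g.1.+2 || (c && val b g.1.+1)) (cvar b g.1) c).
  + by rewrite def1 -!catA.
  + apply: (mono _ _ _ g.1) => //; try lia.
    rewrite /= !set2 ?eqxx /= ?n02 ?n12 ?n01 ?n10 ?eqxx //; try lia.
    by rewrite /= /val; case: (_ && _); rewrite //= orbT.
  + rewrite /E1 sat_eq_clauses !sat_clit !set2; try lia.
    by rewrite !eqxx /= !ifN ?eqxx ?orbT //; lia.
- set c := sat_literal a (clit b g.2.2).
  apply: (@locopt (pre_low b ++ P0 ++ E1) E2 (E3 ++ P1)
    (cvar b g.1.+2) (val b g.1.+2 || (val b g.1 && c)) (cvar b g.1.+1) c).
  + by rewrite def1 -!catA.
  + apply: (mono _ _ _ g.1.+1) => //; try lia.
      by apply: vars_below_cat => //; apply: vars_below_le vb1.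
    rewrite /= !set2 ?eqxx /= ?n02 ?n12 ?n01 ?n10 ?eqxx //; try lia.
    by rewrite /= /val; case: (_ && _); rewrite //= orbT.
  + rewrite /E2 sat_eq_clauses !sat_clit !set2; try lia.
    by rewrite !eqxx /= !ifN ?eqxx ?orbT //; lia.
(* Both assignments concern the conjunction and the outer one prevails, which makes [mono]
   applicable with [u] the conjunction itself. *)
- apply: (@locopt (pre_low b ++ P0 ++ E1 ++ E2) E3 P1
    (cvar b g.1.+2) (val b g.1 && val b g.1.+1) (cvar b g.1.+2) true).
  + by rewrite def1 -!catA.
  + apply: (mono _ _ _ g.1.+2) => //; try lia.
      apply: vars_below_cat; first by apply: vars_below_le vb1; lia.
      by apply: vars_below_cat => //; apply: vars_below_le vE1.
    rewrite /= !set2 ?eqxx /= ?n02 ?n12 ?n01 ?n10 ?eqxx //; try lia.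
    by rewrite /= /val implybb.
  + rewrite /E3 sat_and_clauses !set2; try lia.
    rewrite !eqxx /= !ifN; try lia.
    by rewrite /val; case: (nth _ _ _ && _); rewrite /= ?orbT.
Qed.

Lemma active_ok g : g \in gs -> gate_ok (val f) g.
Proof.
move=> /(top_gate f); rewrite sat_gate_clauses /sat_literal /= -/f.
have -> : (f == ~~ f) = false by case: (f).
rewrite /= /gate_ok /val => /and4P[/eqP<- /eqP<-].
by case: (nth _ _ _); case: (nth _ _ _); case: (nth _ _ _).
Qed.

Lemma inactive_sat g : g \in gs -> all (sat_clause a) (gate_clauses (~~ f) (0, ~~ f) g).
Proof.
move=> ing; apply/allP => C inC; apply: (allP (low_sat erefl)).
by rewrite mem_cat; apply/orP; right; apply/flatten_mapP; exists g.
Qed.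

Lemma inactive_ok g : g \in gs -> gate_ok (val (~~ f)) g.
Proof.
move=> /inactive_sat; rewrite sat_gate_clauses /sat_literal /= -/f.
have -> : (f == ~~ f) = false by case: (f).
rewrite /= /gate_ok /val => /and4P[/eqP<- /eqP<-].
by case: (nth _ _ _); case: (nth _ _ _); case: (nth _ _ _).
Qed.

Lemma inactive_input j : j < L -> val (~~ f) j = val f (nw j).
Proof.
move=> lj; have : all (sat_clause a) (eq_clauses (0, ~~ f) (cvar (~~ f) j) (cvar (~~ ~~ f) (nw j), true)).
  apply/allP => C inC; apply: (allP (low_sat erefl)).
  by rewrite mem_cat; apply/orP; left; apply/flatten_mapP; exists j; rewrite ?mem_iota.
rewrite sat_eq_clauses /sat_literal /= -/f negbK eqb_id.
have -> : (f == ~~ f) = false by case: (f).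
by move/eqP.
Qed.

Lemma output_eq j : j < V -> nth false a (ovar j) = val f (vw j).
Proof.
move=> /mid_eqs_sat; rewrite all_cat !sat_eq_clauses /sat_literal /= -/f !eqb_id /val.
by case: (f) => /=; rewrite ?andbT => /eqP.
Qed.

(** The two flips gain the clause asking for [o_j], violated so far because [o_j] equals the active
    bit. Earlier outputs stay right since the copies agree on those bits. Flipping [f] alone would
    violate the equation of [o_j], which has higher priority. *)
Lemma no_switch j : j < V ->
  (forall i, i < j -> val f (vw i) = val (~~ f) (vw i)) ->
  val f (vw j) = false -> val (~~ f) (vw j) = true -> False.
Proof.
move=> lj eqs v0 v1; have [post def] := mids_split lj.
have lo : ovar j < size a by rewrite size_a /ovar; lia.
pose x := setv 0 (~~ f) (setv (ovar j) true a).
have nthx k : nth false x k = if k == 0 then ~~ f else if k == ovar j then true else nth false a k.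
  by rewrite /x nth_setv ?size_setv ?nth_setv // size_a.
have xc b v : v < NV -> nth false x (cvar b v) = val b v.
  by move=> lv; rewrite nthx /=; case: eqP => // /(cvar_ovar lv).
have x0 : nth false x 0 = ~~ f by rewrite nthx.
suff : all (sat_clause a) (mid j).
  by rewrite all_cat /= andbC /sat_clause /= /sat_literal /= output_eq // v0.
apply: (@locopt _ _ _ 0 (~~ f) (ovar j) true def); rewrite -/x; last first.
  have lv := vw_lt lj; rewrite /mid all_cat all_cat !sat_eq_clauses /sat_literal /= x0 !xc // !nthx /= eqxx.
  rewrite /sat_clause /= /sat_literal /= nthx /= eqxx.
  by move: v1; case: (f) => /= ->.
(* The copies exchange roles: the clauses of the newly active copy had already been enforced by
   [low], and those of the other are switched off except for [top_and]. *)
have topx b : all (sat_clause x) (top b).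
  apply/allP => C /flatten_mapP[g ing]; move: C; apply/allP.
  have [lo' l1 l2 hi] := wf_gates_mem wf ing.
  have xg u : u < g.1.+3 -> nth false x (cvar b u) = val b u.
    by move=> lu; apply: xc; exact: leq_trans lu hi.
  have w3 : g.1 < g.1.+3 by rewrite -[g.1.+3]addn3 -addn1 leq_add2l.
  have c1 : g.2.1.1 < g.1.+3 := ltn_trans l1 w3.
  have c2 : g.2.2.1 < g.1.+3 := ltn_trans l2 w3.
  have xE : sat_literal x (0, ~~ b) = (~~ f == ~~ b) by rewrite /sat_literal x0.
  rewrite sat_gate_clauses !sat_clit xE !xg //.
  case: (eqVneq b f) => [->|ne]; first by rewrite eqxx /= top_and.
  have eb : b = ~~ f by case: (b) ne; case: (f).
  have aE : sat_literal a (0, ~~ f) = false by rewrite /sat_literal /= -/f; case: (f).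
  have := inactive_sat ing; rewrite sat_gate_clauses !sat_clit aE eb /val negbK.
  by have -> : (~~ f == f) = false by case: (f).
move=> C; rewrite !mem_cat => /or3P[inC _|inC _|]; try exact: (allP (topx _) _ inC).
move=> /flatten_mapP[i]; rewrite mem_iota add0n /= => li.
have lV := ltn_trans li lj; have lv := vw_lt lV.
have ne : (ovar i == ovar j) = false by rewrite /ovar; lia.
rewrite mem_cat => /orP[inC _|]; last first.
  by rewrite inE => /eqP ->; rewrite /sat_clause /= /sat_literal /= nthx ne.
apply: (allP _ _ inC); rewrite all_cat !sat_eq_clauses /sat_literal /= x0 !xc // !nthx ne /= output_eq //.
by have := eqs i li; case: (f) => /= ->; rewrite eqb_id eqxx.
Qed.

End Formula.

(** * Circuits for stack machines *)

(** Number of gates of an expansion over [m] wires: two for a constant leaf, four for the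
    multiplexer joining two subtrees. It is exponential in [m], but [m] depends on the machine
    only. *)
Fixpoint gcount (m : nat) : nat := if m is m'.+1 then (gcount m').*2 + 4 else 2.

Definition twidth (m : nat) : nat := 3 * gcount m.

Lemma twidthS m : twidth m.+1 = twidth m + twidth m + 12.
Proof. by rewrite /twidth /=; lia. Qed.

Lemma twidth_gt0 m : 0 < twidth m.
Proof. by rewrite /twidth; case: m => //= m; lia. Qed.

(* Shannon expansion of [h] over the wires [ws]; the value is carried by the
   last of the [twidth (size ws)] variables from [B] on. *)
Fixpoint tmpl (ws : seq nat) (h : seq bool -> bool) (B : nat) : seq gate :=
  if ws is w :: ws' then
    let W := twidth (size ws') in
    let C := B + W + W in
    tmpl ws' (fun bs => h (true :: bs)) B ++
    tmpl ws' (fun bs => h (false :: bs)) (B + W) ++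
    [:: (C, ((w, true), (B + W.-1, true)));
        (C + 3, ((w, false), (B + W + W.-1, true)));
        (C + 6, ((C + 2, false), (C + 5, false)));
        (C + 9, ((C + 8, false), (C + 8, false)))]
  else
    [:: (B, ((0, true), (0, false)));
        (B + 3, ((B + 2, ~~ h [::]), (B + 2, ~~ h [::])))].

Lemma tmpl_ok alpha ws h B : all (gate_ok alpha) (tmpl ws h B) ->
  alpha (B + (twidth (size ws)).-1) = h (map alpha ws).
Proof.
elim: ws h B => [|w ws IH] h B.
  (* At a leaf the first gate conjoins variable 0 with its negation, a wire that is constantly
     false; the second reads it plain or negated according to [h]. *)
  rewrite /= /gate_ok /= !addnS addn0 => /and3P[/eqP -> /eqP -> _].
  by case: (alpha 0); case: (h _).
rewrite [tmpl _ _ _]/= !all_cat => /and3P[/IH h1 /IH h2].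
set W := twidth (size ws) in h1 h2 *; set C := B + W + W.
(* The four last gates select a subtree by the value of [w]: two conjunctions, then their
   disjunction by De Morgan's law. *)
rewrite /= /gate_ok /= h1 h2.
have -> : B + (twidth (size ws).+1).-1 = (C + 9).+2 by rewrite twidthS /C -/W; lia.
have -> : C + 8 = (C + 6).+2 by lia.
have -> : C + 5 = (C + 3).+2 by lia.
have -> : C + 2 = C.+2 by lia.
move=> /and5P[/eqP -> /eqP -> /eqP -> /eqP -> _].
by case: (alpha w) => /=; case: (h _).
Qed.

(** Leaves read variable 0, which has to precede them: hence [0 < B], and [0 < L] for whole
    circuits. *)
Lemma tmpl_wf ws h B : 0 < B -> all (fun w => w < B) ws ->
  wf_gates B (tmpl ws h B) (B + twidth (size ws)).
Proof.
elim: ws h B => [|w ws IH] h B B0 /=.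
  by move=> _; rewrite leqnn /twidth /=; lia.
move=> /andP[wB wsB]; set W := twidth (size ws).
have W0 : 0 < W := twidth_gt0 _.
apply: (@wf_gates_cat _ (B + W)); first exact: IH.
apply: (@wf_gates_cat _ (B + W + W)).
  apply: IH; first by lia.
  by apply: sub_all wsB => u lt; lia.
by rewrite /= twidthS -/W; lia.
Qed.

Section Circuit.

Variable M : smach.

(** The cell at position [j] holds the [j]-th symbol of every stack and a copy of the state. Cell 0
    shows all stack tops, hence determines the operation to be carried out everywhere. *)
Definition cell : finType := (sQ M * {ffun 'I_(sK M).+1 -> option bool})%type.
Let N := #|cell|.

Definition cell0 : cell := (sinit M, [ffun=> None]).
Definition onehot (x : cell) : seq bool := [seq x == y | y <- enum cell].
Definition unhot (bs : seq bool) : cell := nth cell0 (enum cell) (index true bs).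

Lemma size_onehot x : size (onehot x) = N.
Proof. by rewrite size_map -cardE. Qed.

Lemma onehotK x : unhot (onehot x) = x.
Proof.
rewrite /unhot /onehot.
have -> : index true [seq x == y | y <- enum cell] = index x (enum cell).
  elim: (enum cell) => //= y s ->.
  by rewrite (eq_sym y x); case: (x == y).
by rewrite nth_index // mem_enum.
Qed.

(** A push shifts a stack away from the top and a pop towards it. [first] marks position 0, where a
    push brings in the new bit for want of a left neighbour. *)
Definition rule (first : bool) (c0 cl c cr : cell) : cell :=
  if c0.1 == sfin M then c else
  let r := sreg c0.1 in
  let o := sop c0.1 (c0.2 r) in
  (o.2, [ffun r' => if r' == r then
                      match o.1 with
                      | Nop => c.2 r'
                      | OPop => cr.2 r'
                      | OPush b => if first then Some b else cl.2 r'
                      end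
                    else c.2 r']).

Definition mcell (x : sQ M * store) (j : nat) : cell :=
  (x.1, [ffun r : 'I_(sK M).+1 => onth (x.2 r) j]).

Lemma mcell_step x j :
  mcell (mstep x) j = rule (j == 0) (mcell x 0) (mcell x j.-1) (mcell x j) (mcell x j.+1).
Proof.
rewrite /rule /mstep /=; case: ifP => // _; rewrite ffunE.
rewrite /mcell -/(ohead (x.2 (sreg x.1))) [LHS]/=; congr pair; apply/ffunP => r; rewrite !ffunE /upd.
have -> : (r == sreg x.1 :> nat) = (r == sreg x.1) by [].
case: (eqVneq r (sreg x.1)) => [->|ne]; last by [].
set o := sop _ _; case: (o.1) => [||b] //=.
  by case: (x.2 _) => //=; case: j.
by case: j.
Qed.

(** * The circuit: [T] steps on [S] cells, the string [x] hard-wired, [L] free input bits *)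

Variables (L V T S : nat) (x : bitstring).

Let m := 4 * N.
Let W := twidth m.

(** Every template reads exactly [m] wires, if necessary repeated or padded with wire 0. All
    templates then have the same width, and wires have addresses given by arithmetic, which makes
    the formula easy to write down. *)
Definition tbase (t : nat) : nat := L + t * W.
Definition tout (t : nat) : nat := L + t * W + W.-1.
Definition cellw (c : nat) : seq nat := [seq tout (c * N + k) | k <- iota 0 N].

Definition cell_gates (ws : seq nat) (F : seq bool -> cell) (c : nat) : seq gate :=
  flatten [seq tmpl ws (fun bs => F bs == nth cell0 (enum cell) k) (tbase (c * N + k))
             | k <- iota 0 N].

Definition init_cell (xb : option bool) (isA : bool) (bs : seq bool) : cell :=
  (sinit M, [ffun r : 'I_(sK M).+1 => if r == 0 :> nat then xb else
     if r == 1 :> nat then (if isA then Some (head false bs) else None) else None]).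

Definition next_cell (first : bool) (bs : seq bool) : cell :=
  rule first (unhot (take N bs)) (unhot (take N (drop N bs)))
    (unhot (take N (drop (2 * N) bs))) (unhot (take N (drop (3 * N) bs))).

Definition out_bit (bs : seq bool) : bool :=
  (unhot (take N bs)).2 (inord 2) == Some true.

Definition init_wires (j : nat) : seq nat := nseq m (if j < L then j else 0).

Definition next_wires (t j : nat) : seq nat :=
  cellw (t * S) ++ cellw (t * S + j).-1 ++ cellw (t * S + j) ++ cellw (t * S + j).+1.

Definition out_wires (j : nat) : seq nat := cellw (T * S + j) ++ nseq (3 * N) 0.

Definition row0 : seq gate :=
  flatten [seq cell_gates (init_wires j) (init_cell (onth x j) (j < L)) j | j <- iota 0 S].

Definition next_row (t : nat) : seq gate :=
  flatten [seq cell_gates (next_wires t j) (next_cell (j == 0)) (t.+1 * S + j)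
             | j <- iota 0 S].

Definition rows : seq gate := flatten [seq next_row t | t <- iota 0 T].

Definition out_index (j : nat) : nat := T.+1 * S * N + j.

Definition outs : seq gate :=
  flatten [seq tmpl (out_wires j) out_bit (tbase (out_index j)) | j <- iota 0 (L + V)].

Definition circuit : seq gate := row0 ++ rows ++ outs.

Definition circuit_vars : nat := tbase (out_index (L + V)).

Hypothesis L0 : 0 < L.
Hypothesis S_big : 2 + T + L + V + size x <= S.
Hypothesis K_big : 2 <= sK M.

Lemma N_gt0 : 0 < N.
Proof. by rewrite /N; apply/card_gt0P; exists cell0. Qed.

Lemma W_gt0 : 0 < W.
Proof. exact: twidth_gt0. Qed.

Lemma tbaseS t : tbase t.+1 = tbase t + W.
Proof. by rewrite /tbase mulSn; lia. Qed.

Lemma tout_lt t t' : t < t' -> tout t < tbase t'.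
Proof.
move=> lt; rewrite /tout /tbase; have := W_gt0.
have : t.+1 * W <= t' * W by rewrite leq_mul2r lt orbT.
by rewrite mulSn; lia.
Qed.

Lemma size_cellw c : size (cellw c) = N.
Proof. by rewrite size_map size_iota. Qed.

Lemma size_next_wires t j : size (next_wires t j) = m.
Proof. by rewrite !size_cat !size_cellw /m; lia. Qed.

Lemma size_out_wires j : size (out_wires j) = m.
Proof. by rewrite size_cat size_cellw size_nseq /m; lia. Qed.

Lemma cellw_lt c c' : c < c' -> all (fun w => w < tbase (c' * N)) (cellw c).
Proof.
move=> lt; apply/allP => w /mapP[k]; rewrite mem_iota => lk ->; apply: tout_lt.
have : c.+1 * N <= c' * N by rewrite leq_mul2r lt orbT.
by rewrite mulSn; lia.
Qed.

Lemma wf_flatten (F : nat -> seq gate) (B : nat -> nat) n i :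
  (forall j, i <= j < i + n -> wf_gates (B j) (F j) (B j.+1)) ->
  wf_gates (B i) (flatten [seq F j | j <- iota i n]) (B (i + n)).
Proof.
elim: n i => [|n IH] i h /=; first by rewrite addn0.
apply: (@wf_gates_cat _ (B i.+1)); first by apply: h; lia.
by rewrite -addSnnS; apply: IH => j lj; apply: h; lia.
Qed.

Lemma cell_gates_wf ws F c : size ws = m -> all (fun w => w < tbase (c * N)) ws ->
  wf_gates (tbase (c * N)) (cell_gates ws F c) (tbase (c.+1 * N)).
Proof.
move=> sz lt.
rewrite -{1}[c * N]addn0 mulSnr.
apply: (@wf_flatten _ (fun k => tbase (c * N + k)) N 0) => k _.
rewrite addnS tbaseS /W -sz; apply: tmpl_wf; first by rewrite /tbase; lia.
by apply: sub_all lt => w; rewrite /tbase mulnDl; lia.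
Qed.

Lemma circuit_wf : wf_gates L circuit circuit_vars.
Proof.
have tb c : tbase c < tbase c.+1 by rewrite tbaseS; have := W_gt0; lia.
have L_tb c : L <= tbase c by rewrite /tbase leq_addr.
apply: (@wf_gates_cat _ (tbase (S * N))).
  have {1}-> : L = tbase (0 * N) by rewrite mul0n /tbase mul0n addn0.
  apply: (@wf_flatten _ (fun j => tbase (j * N)) S 0) => j _.
  apply: cell_gates_wf; first by rewrite size_nseq.
  apply/allP => w; rewrite mem_nseq => /andP[_ /eqP->].
  by have := L_tb (j * N); case: ifP; lia.
apply: (@wf_gates_cat _ (tbase (T.+1 * S * N))).
  rewrite -{1}[S]mul1n.
  apply: (@wf_flatten _ (fun t => tbase (t.+1 * S * N)) T 0) => t _.
  rewrite -{1}[t.+1 * S]addn0 [t.+2 * S]mulSnr.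
  apply: (@wf_flatten _ (fun j => tbase ((t.+1 * S + j) * N)) S 0) => j /andP[_ lj].
  rewrite addnS; apply: cell_gates_wf; first exact: size_next_wires.
  (* The last cell of a row finds, as its right neighbour, the first cell of the row under
     construction; that one comes earlier because [S] is at least 2. *)
  have cS : t.+1 * S = t * S + S by rewrite mulSnr.
  rewrite !all_cat !cellw_lt //; lia.
rewrite -[T.+1 * S * N]addn0.
apply: (@wf_flatten _ (fun j => tbase (out_index j)) (L + V) 0) => j lj.
rewrite /out_index addnS tbaseS /W -(size_out_wires j); apply: tmpl_wf.
  by rewrite /tbase; lia.
rewrite all_cat; apply/andP; split.
  have lt : T * S + j < T.+1 * S by rewrite mulSnr; lia.
  apply: sub_all (cellw_lt lt) => w; rewrite /tbase mulnDl; lia.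
by apply/allP => w; rewrite mem_nseq => /andP[_ /eqP->]; rewrite /tbase; lia.
Qed.

Lemma cell_gates_ok alpha ws F c : size ws = m ->
  all (gate_ok alpha) (cell_gates ws F c) ->
  map alpha (cellw c) = onehot (F (map alpha ws)).
Proof.
move=> sz ok.
have E k : k < N -> alpha (tout (c * N + k)) = (F (map alpha ws) == nth cell0 (enum cell) k).
  move=> lk; have := @tmpl_ok alpha ws (fun bs => F bs == nth cell0 (enum cell) k) (tbase (c * N + k)).
  rewrite sz; apply; apply/allP => g ing; apply: (allP ok).
  by apply/flatten_mapP; exists k => //; rewrite mem_iota.
apply: (@eq_from_nth _ false); first by rewrite size_map size_cellw size_onehot.
move=> k; rewrite size_map size_cellw => lk.
rewrite (nth_map 0) ?size_cellw // (nth_map 0) ?size_iota // nth_iota // E //.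
have sE : size (enum cell) = N by rewrite /N cardE.
by rewrite add0n [RHS](nth_map cell0) ?sE.
Qed.

Lemma circuit_ok alpha y s' :
  all (gate_ok alpha) circuit ->
  (forall i, s' i = if i == 0 then x else if i == 1 then [seq alpha j | j <- iota 0 L] else [::]) ->
  (iter T (@mstep M) (sinit M, s')).2 2 = y ->
  forall j, j < L + V -> alpha (tout (out_index j)) = nth false y j.
Proof.
rewrite !all_cat => /and3P[ok0 okr oko] s'E yE.
pose X t := iter t (@mstep M) (sinit M, s').
(* The right end of a row has no true right neighbour, and the error spreads by one cell per step.
   Correctness is therefore claimed in a shrinking range, which after [T] steps still contains the
   [L + V] output cells. *)
have main t : t <= T -> forall j, j + t < S ->
    map alpha (cellw (t * S + j)) = onehot (mcell (X t) j).
  elim: t => [|t IH] lt j lj.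
    rewrite mul0n add0n.
    have ok : all (gate_ok alpha) (cell_gates (init_wires j) (init_cell (onth x j) (j < L)) j).
      apply/allP => g ing; apply: (allP ok0); apply/flatten_mapP; exists j => //.
      by rewrite mem_iota; lia.
    rewrite (cell_gates_ok _ ok) ?size_nseq //; congr onehot; congr pair.
    apply/ffunP => r; rewrite !ffunE /= s'E.
    case: eqP => // _; case: eqP => _; last by rewrite onth0n.
    have -> : head false (map alpha (init_wires j)) = alpha (if j < L then j else 0).
      by rewrite /init_wires /m; case: (N) N_gt0.
    case: (ltnP j L) => ljL; last by rewrite onth_default // size_map size_iota.
    by rewrite onthE (nth_map false) ?size_map ?size_iota // (nth_map 0) ?size_iota // nth_iota.
  have ok : all (gate_ok alpha)
      (cell_gates (next_wires t j) (next_cell (j == 0)) (t.+1 * S + j)).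
    apply/allP => g ing; apply: (allP okr); apply/flatten_mapP; exists t.
      by rewrite mem_iota.
    by apply/flatten_mapP; exists j => //; rewrite mem_iota; lia.
  have {}IH := IH (ltnW lt).
  have sl c : size (map alpha (cellw c)) = N by rewrite size_map size_cellw.
  rewrite (cell_gates_ok (size_next_wires _ _) ok); congr onehot.
  rewrite /next_cell /next_wires !map_cat.
  rewrite take_size_cat // drop_size_cat // take_size_cat //.
  have -> u1 u2 u3 : size u1 = N -> size u2 = N ->
      drop (2 * N) (u1 ++ u2 ++ u3 : seq bool) = u3.
    by move=> e1 e2; rewrite catA drop_size_cat // size_cat e1 e2; lia.
  2,3: by rewrite sl.
  have -> u1 u2 u3 u4 : size u1 = N -> size u2 = N -> size u3 = N ->
      drop (3 * N) (u1 ++ u2 ++ u3 ++ u4 : seq bool) = u4.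
    by move=> e1 e2 e3; rewrite catA catA drop_size_cat // !size_cat e1 e2 e3; lia.
  2-4: by rewrite sl.
  rewrite take_size_cat // take_oversize ?sl //.
  have e0 := IH 0; rewrite addn0 in e0; rewrite e0; last by lia.
  rewrite (IH j); last by lia.
  rewrite -addnS (IH j.+1); last by lia.
  have XS : X t.+1 = mstep (X t) by [].
  rewrite !onehotK XS mcell_step.
  (* At position 0 the left wires belong to another row or are those of cell 0, but [rule] with
     [first] set does not consult them. *)
  case: j lj {ok} => [|j] lj; first by rewrite /rule.
  by rewrite addnS /= IH ?onehotK //; lia.
move=> j lj.
have := @tmpl_ok alpha (out_wires j) out_bit (tbase (out_index j)).
rewrite size_out_wires /tout => ->; last first.
  apply/allP => g ing; apply: (allP oko); apply/flatten_mapP; exists j => //.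
  by rewrite mem_iota.
rewrite /out_bit /out_wires map_cat take_size_cat ?size_map ?size_iota //.
rewrite main //; last by lia.
rewrite onehotK /mcell /= ffunE inordK // -/(X T) yE.
by elim: (y) (j) => [|b u IH] [|i] //=.
Qed.

End Circuit.

(** * Writing down the reduced formula *)

(** The encoding without its end marker turns concatenation of clause lists into concatenation of
    texts, so a formula can be written piece by piece. *)
Definition clauses_text (cs : seq clause) : bitstring :=
  flatten [seq true :: encode_seq encode_literal C | C <- cs].

Lemma clauses_text_cat cs cs' : clauses_text (cs ++ cs') = clauses_text cs ++ clauses_text cs'.
Proof. by rewrite /clauses_text map_cat flatten_cat. Qed.

Lemma clauses_text_flatten (I : Type) (F : I -> seq clause) s :
  clauses_text (flatten [seq F i | i <- s]) = flatten [seq clauses_text (F i) | i <- s].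
Proof. by elim: s => //= i s IH; rewrite clauses_text_cat IH. Qed.

Lemma encode_cnfE n cs :
  encode_cnf (CNF n cs) = nseq n true ++ [:: false] ++ clauses_text cs ++ [:: false].
Proof. by rewrite /encode_cnf encode_seq_flatten /encode_unary -cats1 -catA. Qed.

Definition gates_text (b s : bool) (gs : seq gate) : bitstring :=
  clauses_text (flatten [seq gate_clauses b (0, s) g | g <- gs]).

Lemma gates_text_cat b s gs gs' : gates_text b s (gs ++ gs') = gates_text b s gs ++ gates_text b s gs'.
Proof. by rewrite /gates_text map_cat flatten_cat clauses_text_cat. Qed.

Lemma gates_text_flatten (I : Type) b s (F : I -> seq gate) l :
  gates_text b s (flatten [seq F i | i <- l]) = flatten [seq gates_text b s (F i) | i <- l].
Proof. by elim: l => //= i l IH; rewrite gates_text_cat IH. Qed.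

Lemma FP_clauses (A : Type) (D : A -> Prop) env (cl : seq (seq ((A -> nat) * bool))) :
  Pall (Pall (fun l : (A -> nat) * bool => FPn D env l.1)) cl ->
  FP D env (fun a => clauses_text [seq [seq (l.1 a, l.2) | l <- C] | C <- cl]).
Proof.
elim: cl => [|C cl IH] /=; first by move=> _; exact: FP_nil.
move=> [hC /IH hcl]; apply: FP_cons; apply: FP_cat hcl.
elim: C hC => [|[n s] C IHC] /=; first by move=> _; exact: FP_const.
move=> [hn /IHC hC]; apply: FP_cons; apply: FP_cat hC.
rewrite /encode_literal /=; apply: FP_cat (FP_const _ _ [:: s]).
apply: FP_ext (FP_cat hn (FP_const _ _ [:: false])) => a _.
by rewrite /encode_unary cats1.
Qed.

Lemma FPn_cvar (A : Type) (D : A -> Prop) env b (v : A -> nat) :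
  FPn D env v -> FPn D env (fun a => cvar b (v a)).
Proof.
move=> fv; apply: FPn_S; apply: FPn_add (FPn_const _ _ b).
by apply: FP_ext (FPn_add fv fv) => a _; rewrite addnn.
Qed.

Lemma FP_gate (A : Type) (D : A -> Prop) env b s (v u1 u2 : A -> nat) s1 s2 :
  FPn D env v -> FPn D env u1 -> FPn D env u2 ->
  FP D env (fun a => gates_text b s [:: (v a, ((u1 a, s1), (u2 a, s2)))]).
Proof.
move=> fv f1 f2.
pose w a := cvar b (v a); pose y a := cvar b (v a).+1; pose z a := cvar b (v a).+2.
pose t1 a := cvar b (u1 a); pose t2 a := cvar b (u2 a).
have fw : FPn D env w by apply: FPn_cvar.
have fy : FPn D env y by apply: FPn_cvar; apply: FPn_S.
have fz : FPn D env z by apply: FPn_cvar; do 2!apply: FPn_S.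
have ft1 : FPn D env t1 by apply: FPn_cvar.
have ft2 : FPn D env t2 by apply: FPn_cvar.
have f0 : FPn D env (fun _ : A => 0) by apply: FPn_const.
have := @FP_clauses _ D env
 [:: [:: (fun=> 0, s); (w, true); (t1, ~~ s1)]; [:: (fun=> 0, s); (w, false); (t1, s1)];
     [:: (fun=> 0, s); (y, true); (t2, ~~ s2)]; [:: (fun=> 0, s); (y, false); (t2, s2)];
     [:: (fun=> 0, s); (z, false); (w, true)]; [:: (fun=> 0, s); (z, false); (y, true)];
     [:: (w, false); (y, false); (z, true)]].
by apply=> /=; do !split.
Qed.

Lemma FP_flatten_const (A I : Type) (D : A -> Prop) env (f : I -> A -> bitstring) (l : seq I) :
  (forall i, FP D env (f i)) -> FP D env (fun a => flatten [seq f i a | i <- l]).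
Proof. by move=> h; elim: l => [|i l IH] /=; [exact: FP_nil | exact: FP_cat]. Qed.

(** The number of wires and the function [h] are fixed, so the exponential tree unfolds into a fixed
    program in which only the addresses depend on the input. *)
Lemma FP_tmpl (A : Type) (D : A -> Prop) env b s (ws : seq (A -> nat)) h (B : A -> nat) :
  Pall (fun w => FPn D env w) ws -> FPn D env B ->
  FP D env (fun a => gates_text b s (tmpl [seq w a | w <- ws] h (B a))).
Proof.
have addc D0 (n : A -> nat) c : FPn D0 env n -> FPn D0 env (fun a => n a + c).
  by move=> fn; apply: FPn_add fn (FPn_const _ _ c).
elim: ws h B => [|w ws IH] h B /=.
  move=> _ fB; apply: FP_ext (FP_cat
    (FP_gate b s true false fB (FPn_const _ _ 0) (FPn_const _ _ 0))
    (FP_gate b s (~~ h [::]) (~~ h [::]) (addc _ _ 3 fB) (addc _ _ 2 fB) (addc _ _ 2 fB))) => a _.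
  by rewrite -gates_text_cat.
move=> [fw fws] fB; set W := twidth (size ws).
have sz a : size [seq w a | w <- ws] = size ws by rewrite size_map.
have fC : FPn D env (fun a => B a + W + W) by apply/addc/addc.
apply: FP_ext (FP_cat (IH (fun bs => h (true :: bs)) B fws fB)
  (FP_cat (IH (fun bs => h (false :: bs)) _ fws (addc _ _ W fB))
  (FP_cat (FP_gate b s true true fC fw (addc _ _ W.-1 fB))
  (FP_cat (FP_gate b s false true (addc _ _ 3 fC) fw (addc _ _ W.-1 (addc _ _ W fB)))
  (FP_cat (FP_gate b s false false (addc _ _ 6 fC) (addc _ _ 2 fC) (addc _ _ 5 fC))
     (FP_gate b s false false (addc _ _ 9 fC) (addc _ _ 8 fC) (addc _ _ 8 fC))))))) => a _.
by rewrite -!gates_text_cat sz.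
Qed.

Definition cell_wires (A : Type) (M : smach) (L c : A -> nat) : seq (A -> nat) :=
  [seq (fun a => tout M (L a) (c a * #|cell M| + k)) | k <- iota 0 #|cell M|].

Lemma cell_wiresE (A : Type) M (L c : A -> nat) a :
  cellw M (L a) (c a) = [seq w a | w <- cell_wires M L c].
Proof. by rewrite /cell_wires -map_comp. Qed.

Lemma FPn_tbase (A : Type) (D : A -> Prop) env M (L t : A -> nat) :
  FPn D env L -> FPn D env t -> FPn D env (fun a => tbase M (L a) (t a)).
Proof.
move=> fL ft; rewrite /tbase; apply: FPn_add fL _.
by apply: FPn_mul ft (FPn_const _ _ _).
Qed.

Lemma FPn_tout (A : Type) (D : A -> Prop) env M (L t : A -> nat) :
  FPn D env L -> FPn D env t -> FPn D env (fun a => tout M (L a) (t a)).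
Proof.
move=> fL ft; rewrite /tout; apply: FPn_add (FPn_const _ _ _).
exact: FPn_tbase.
Qed.

Lemma FPn_cell_wires (A : Type) (D : A -> Prop) env M (L c : A -> nat) :
  FPn D env L -> FPn D env c -> Pall (fun w => FPn D env w) (cell_wires M L c).
Proof.
move=> fL fc; rewrite /cell_wires; elim: (iota _ _) => //= k l IH; split=> //.
apply: FPn_tout fL _; apply: FPn_add (FPn_const _ _ k).
by apply: FPn_mul fc (FPn_const _ _ _).
Qed.

Lemma FP_cell (A : Type) (D : A -> Prop) env M b s (L c : A -> nat) (ws : seq (A -> nat)) F :
  FPn D env L -> FPn D env c -> Pall (fun w => FPn D env w) ws ->
  FP D env (fun a => gates_text b s (cell_gates (M := M) (L a) [seq w a | w <- ws] F (c a))).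
Proof.
move=> fL fc fws.
apply: FP_ext (FP_flatten_const (f := fun k a => gates_text b s
  (tmpl [seq w a | w <- ws] (fun bs => F bs == nth (cell0 M) (enum (cell M)) k)
    (tbase M (L a) (c a * #|cell M| + k)))) (iota 0 #|cell M|) _) => [a _|k].
  by rewrite /cell_gates gates_text_flatten.
apply: FP_tmpl fws _; apply: FPn_tbase fL _; apply: FPn_add (FPn_const _ _ k).
by apply: FPn_mul fc (FPn_const _ _ _).
Qed.

Lemma FPn_if (A : Type) (D : A -> Prop) env (b : A -> bool) (n m : A -> nat) :
  FP D env (fun a => [:: b a]) -> FPn D env n -> FPn D env m ->
  FPn D env (fun a => if b a then n a else m a).
Proof.
move=> fb fn fm; apply: FP_ext (FP_if fb (FP_sub _ fn) (FP_sub _ fm)) => a.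
- by case: (b a).
- by case.
- by case.
Qed.

Lemma FPkey_bool (A : Type) (D : A -> Prop) env (b : A -> bool) :
  FP D env (fun a => [:: b a]) -> FPkey D env b.
Proof.
by move/FPkey_head; apply: (FPkey_comp (f := fun o => odflt false o)).
Qed.

Lemma FPkey_onth (A : Type) (D : A -> Prop) env (x : A -> bitstring) (n : A -> nat) :
  FP D env x -> FPn D env n -> FPkey D env (fun a => onth (x a) (n a)).
Proof.
move=> fx fn; apply: (FPkey_comp (f := id) _ (FPkey_head (FP_drop fn fx))) => a _.
by elim: (x a) (n a) => [|b y IH] [|i] //=; rewrite IH.
Qed.

Lemma Pall_nseq (T : Type) (P : T -> Prop) n x : P x -> Pall P (nseq n x).
Proof. by move=> h; elim: n. Qed.

Lemma FP_row0 (A : Type) (D : A -> Prop) env M b s (x : A -> bitstring) (L S : A -> nat) :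
  FP D env x -> FPn D env L -> FPn D env S ->
  FP D env (fun a => gates_text b s (row0 M (L a) (S a) (x a))).
Proof.
move=> fx fL fS.
pose f a j := gates_text b s (cell_gates (M := M) (L a) (init_wires M (L a) j)
  (init_cell M (onth (x a) j) (j < L a)) j).
apply: FP_ext (_ : FP D env (fun a => flatten [seq f a j | j <- iota 0 (S a)])) => [a _|].
  by rewrite /row0 gates_text_flatten.
apply: FP_flatmap fS _; set D' := (fun p => _).
have sub p : D' p -> D p.1 by case.
have fL' := FP_index_lift sub fL; have fx' := FP_index_lift sub fx.
have fi := FP_index D' env; have fb := FPb_ltn fi fL'.
(* The cell function has to be a constant of the program, so its finitely many instances are
   separated first. *)
apply: (FPkey_pair (FPkey_onth fx' fi) (FPkey_bool fb)) => // -[xb isA].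
have fw : FPn D' (index_env env) (fun p => if p.2 < L p.1 then p.2 else 0).
  by apply: FPn_if => //; exact: FPn_const.
have := @FP_cell _ D' _ M b s _ _ _ (init_cell M xb isA) fL' fi
  (Pall_nseq (P := fun w => FPn D' (index_env env) w) (4 * #|cell M|) fw).
move/FP_sub => h; apply: FP_ext (h _ _) => [p [_ [<- <-]]|p []//].
by rewrite /f /init_wires map_nseq.
Qed.

Lemma FP_rows (A : Type) (D : A -> Prop) env M b s (L T S : A -> nat) :
  FPn D env L -> FPn D env T -> FPn D env S ->
  FP D env (fun a => gates_text b s (rows M (L a) (T a) (S a))).
Proof.
move=> fL fT fS.
pose f (p : A * nat) j := gates_text b s (cell_gates (L p.1) (next_wires M (L p.1) (S p.1) p.2 j)
  (next_cell M (j == 0)) (p.2.+1 * S p.1 + j)).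
apply: FP_ext (_ : FP D env (fun a =>
    flatten [seq flatten [seq f (a, t) j | j <- iota 0 (S a)] | t <- iota 0 (T a)])) => [a _|].
  rewrite /rows gates_text_flatten; congr flatten; apply: eq_map => t.
  by rewrite /next_row gates_text_flatten.
apply: FP_flatmap fT _; set D1 := (fun p => _).
have sub1 p : D1 p -> D p.1 by case.
apply: FP_flatmap; first exact: FP_index_lift sub1 fS.
set D2 := (fun p => _); have sub2 p : D2 p -> D1 p.1 by case.
set E := index_env _.
have fL2 : FPn D2 E (fun p => L p.1.1) by exact: FP_index_lift sub2 (FP_index_lift sub1 fL).
have fS2 : FPn D2 E (fun p => S p.1.1) by exact: FP_index_lift sub2 (FP_index_lift sub1 fS).
have ft : FPn D2 E (fun p => p.1.2) by exact: FP_index_lift sub2 (FP_index D1 env).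
have fj : FPn D2 E snd by exact: FP_index.
pose c0 (p : A * nat * nat) := p.1.2 * S p.1.1.
have fc0 : FPn D2 E c0 by exact: FPn_mul.
have fc : FPn D2 E (fun p => c0 p + p.2) by exact: FPn_add.
have fcp : FPn D2 E (fun p => (c0 p + p.2).-1) by exact: FPn_pred.
have fcs : FPn D2 E (fun p => (c0 p + p.2).+1) by exact: FPn_S.
have ft1 : FPn D2 E (fun p => p.1.2.+1 * S p.1.1 + p.2).
  by apply: FPn_add fj; apply: FPn_mul fS2; exact: FPn_S.
pose LL (p : A * nat * nat) := L p.1.1.
pose ws := cell_wires M LL c0 ++ cell_wires M LL (fun p => (c0 p + p.2).-1) ++
  cell_wires M LL (fun p => c0 p + p.2) ++ cell_wires M LL (fun p => (c0 p + p.2).+1).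
have fws : Pall (fun w => FPn D2 E w) ws.
  by do 3?apply: Pall_cat; apply: FPn_cell_wires.
apply: (FPkey_bool (FPb_eqn fj (FPn_const _ _ 0))) => // first.
have := @FP_cell _ D2 _ M b s _ _ _ (next_cell M first) fL2 ft1 fws.
move/FP_sub => h; apply: FP_ext (h _ _) => [p [_ <-]|p []//].
rewrite /f /next_wires /ws !map_cat.
by rewrite -(cell_wiresE M LL c0) -(cell_wiresE M LL (fun p => (c0 p + p.2).-1))
  -(cell_wiresE M LL (fun p => c0 p + p.2)) -(cell_wiresE M LL (fun p => (c0 p + p.2).+1)).
Qed.

Lemma FPn_out_index (A : Type) (D : A -> Prop) env M (T S j : A -> nat) :
  FPn D env T -> FPn D env S -> FPn D env j ->
  FPn D env (fun a => out_index M (T a) (S a) (j a)).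
Proof.
move=> fT fS fj; rewrite /out_index; apply: FPn_add fj.
by apply: FPn_mul (FPn_const _ _ _); apply: FPn_mul fS; exact: FPn_S.
Qed.

Lemma FP_outs (A : Type) (D : A -> Prop) env M b s (L V T S : A -> nat) :
  FPn D env L -> FPn D env V -> FPn D env T -> FPn D env S ->
  FP D env (fun a => gates_text b s (outs M (L a) (V a) (T a) (S a))).
Proof.
move=> fL fV fT fS.
pose f a j := gates_text b s (tmpl (out_wires M (L a) (T a) (S a) j) (out_bit M)
  (tbase M (L a) (out_index M (T a) (S a) j))).
apply: FP_ext (_ : FP D env (fun a => flatten [seq f a j | j <- iota 0 (L a + V a)])) => [a _|].
  by rewrite /outs gates_text_flatten.
apply: FP_flatmap; first exact: FPn_add.
set D' := (fun p => _).
have sub p : D' p -> D p.1 by case.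
have fL' := FP_index_lift sub fL; have fT' := FP_index_lift sub fT.
have fS' := FP_index_lift sub fS; have fj := FP_index D' env.
have fB : FPn D' (index_env env) (fun p => tbase M (L p.1) (out_index M (T p.1) (S p.1) p.2)).
  by apply: FPn_tbase fL' _; apply: FPn_out_index.
have fc : FPn D' (index_env env) (fun p => T p.1 * S p.1 + p.2).
  by apply: FPn_add fj; apply: FPn_mul.
pose LL (p : A * nat) := L p.1.
have fws : Pall (fun w => FPn D' (index_env env) w)
    (cell_wires M LL (fun p => T p.1 * S p.1 + p.2) ++ nseq (3 * #|cell M|) (fun=> 0)).
  apply: Pall_cat; first exact: FPn_cell_wires.
  by apply: Pall_nseq; exact: FPn_const.
apply: FP_ext (FP_tmpl b s (out_bit M) fws fB) => p _.
by rewrite /f /out_wires map_cat -(cell_wiresE M LL) map_nseq.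
Qed.

Lemma FP_circuit (A : Type) (D : A -> Prop) env M b s (x : A -> bitstring) (L V T S : A -> nat) :
  FP D env x -> FPn D env L -> FPn D env V -> FPn D env T -> FPn D env S ->
  FP D env (fun a => gates_text b s (circuit M (L a) (V a) (T a) (S a) (x a))).
Proof.
move=> fx fL fV fT fS; rewrite /circuit.
apply: FP_ext (FP_cat (FP_row0 M b s fx fL fS) (FP_cat (FP_rows M b s fL fT fS)
  (FP_outs M b s fL fV fT fS))) => a _.
by rewrite !gates_text_cat.
Qed.

Definition reduced_cnf (M : smach) (L V T S : nat) (x : bitstring) : cnf :=
  let NV := circuit_vars M L V T S in
  let ow j := tout M L (out_index M T S j) in
  CNF (NV.*2 + V).+1
    (formula L V NV (circuit M L V T S x) ow (fun j => ow (L + j))).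

Lemma FP_reduced_cnf (A : Type) (D : A -> Prop) env M (x : A -> bitstring) (L V T S : A -> nat) :
  FP D env x -> FPn D env L -> FPn D env V -> FPn D env T -> FPn D env S ->
  FP D env (fun a => encode_cnf (reduced_cnf M (L a) (V a) (T a) (S a) (x a))).
Proof.
move=> fx fL fV fT fS.
pose NV a := circuit_vars M (L a) (V a) (T a) (S a).
pose ow a j := tout M (L a) (out_index M (T a) (S a) j).
have fNV : FPn D env NV.
  exact: (FPn_tbase M fL (FPn_out_index M fT fS (FPn_add fL fV))).
have fNV2 : FPn D env (fun a => (NV a).*2).
  by apply: FP_ext (FPn_add fNV fNV) => a _; rewrite addnn.
have fnv : FPn D env (fun a => ((NV a).*2 + V a).+1) by apply: FPn_S; exact: FPn_add.
have fcirc b s := FP_circuit M b s fx fL fV fT fS.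
have fcop b : FP D env (fun a => clauses_text (copies (L a) (ow a) b)).
  pose f a j := clauses_text (eq_clauses (0, b) (cvar b j) (cvar (~~ b) (ow a j), true)).
  apply: FP_ext (_ : FP D env (fun a => flatten [seq f a j | j <- iota 0 (L a)])) => [a _|].
    by rewrite /copies clauses_text_flatten.
  apply: (FP_flatmap fL); set D' := (fun p => _).
  have sub p : D' p -> D p.1 by case.
  have fj := FP_index D' env.
  have fv : FPn D' (index_env env) (fun p => cvar b p.2) by exact: FPn_cvar.
  have fo : FPn D' (index_env env) (fun p => cvar (~~ b) (ow p.1 p.2)).
    apply: FPn_cvar; apply: FPn_tout (FP_index_lift sub fL) _.
    by apply: FPn_out_index (FP_index_lift sub fT) (FP_index_lift sub fS) fj.
  have f0 : FPn D' (index_env env) (fun _ : A * nat => 0) by exact: FPn_const.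
  have := @FP_clauses _ D' (index_env env)
    [:: [:: (fun=> 0, b); (fun p => cvar b p.2, true); (fun p => cvar (~~ b) (ow p.1 p.2), false)];
        [:: (fun=> 0, b); (fun p => cvar b p.2, false); (fun p => cvar (~~ b) (ow p.1 p.2), true)]].
  by apply=> /=; do !split.
have fmid : FP D env (fun a => clauses_text (mids (NV a) (fun j => ow a (L a + j)) (V a))).
  pose f a j := clauses_text (mid (NV a) (fun j => ow a (L a + j)) j).
  apply: FP_ext (_ : FP D env (fun a => flatten [seq f a j | j <- iota 0 (V a)])) => [a _|].
    by rewrite /mids clauses_text_flatten.
  apply: (FP_flatmap fV); set D' := (fun p => _).
  have sub p : D' p -> D p.1 by case.
  have fj := FP_index D' env.
  have fo : FPn D' (index_env env) (fun p => ovar (NV p.1) p.2).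
    by apply: FPn_S; apply: FPn_add (FP_index_lift sub fNV2) fj.
  have fv b : FPn D' (index_env env) (fun p => cvar b (ow p.1 (L p.1 + p.2))).
    apply: FPn_cvar; apply: FPn_tout (FP_index_lift sub fL) _.
    apply: FPn_out_index (FP_index_lift sub fT) (FP_index_lift sub fS) _.
    by apply: FPn_add (FP_index_lift sub fL) fj.
  have f0 : FPn D' (index_env env) (fun _ : A * nat => 0) by exact: FPn_const.
  pose o (p : A * nat) := ovar (NV p.1) p.2.
  pose v b (p : A * nat) := cvar b (ow p.1 (L p.1 + p.2)).
  have := @FP_clauses _ D' (index_env env)
    [:: [:: (fun=> 0, true); (o, true); (v false, false)];
        [:: (fun=> 0, true); (o, false); (v false, true)];
        [:: (fun=> 0, false); (o, true); (v true, false)];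
        [:: (fun=> 0, false); (o, false); (v true, true)]; [:: (o, true)]].
  have fo' : FPn D' (index_env env) o := fo.
  have fv0 : FPn D' (index_env env) (v false) := fv false.
  have fv1 : FPn D' (index_env env) (v true) := fv true.
  by apply=> /=; do !split.
apply: FP_ext (FP_cat fnv (FP_cat (FP_const _ _ [:: false]) (FP_cat
  (FP_cat (fcirc false true) (FP_cat (fcirc true false) (FP_cat fmid
    (FP_cat (FP_cat (fcop false) (fcirc false false))
            (FP_cat (fcop true) (fcirc true true))))))
  (FP_const _ _ [:: false])))) => a _.
by rewrite encode_cnfE /formula /top /low !clauses_text_cat.
Qed.

(** * One improvement step as a polynomial-time function *)

Fixpoint lexltb (u v : bitstring) : bool :=
  match u, v with
  | x :: u', y :: v' => if x == y then lexltb u' v' else y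
  | _, _ => false
  end.

Lemma lexltbP u v : lexltb u v -> exists j, [/\ j < size u,
  forall i, i < j -> nth false u i = nth false v i,
  nth false u j = false & nth false v j = true].
Proof.
elim: u v => [|x u IH] [|y v] //=; case: eqVneq => [<- /IH [j [lj eqs uj vj]]|ne yT].
  by exists j.+1; split=> // -[|i] //= lt; apply: eqs.
by exists 0; split=> //=; move: ne yT; case: x; case: y.
Qed.

Lemma lexltb_negb u v : size u = size v ->
  lexltb (map negb v) (map negb u) = lexltb u v.
Proof.
elim: u v => [|x u IH] [|y v] //= [sz].
by rewrite IH //; case: x; case: y.
Qed.

Lemma lexltb_rcons u v x y : size u = size v ->
  lexltb (rcons u x) (rcons v y) = lexltb u v || [&& u == v, ~~ x & y].
Proof.
elim: u v => [|a u IH] [|b v] //=; first by case: x; case: y.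
move=> [sz]; rewrite IH // eqseq_cons; case: (eqVneq a b) => //= _.
by rewrite orbF.
Qed.

Lemma bits_value_inj u v : size u = size v -> bits_value u = bits_value v -> u = v.
Proof.
elim: u v => [|x u IH] [|y v] //= [sz] h.
have [e1 e2] : x = y /\ bits_value u = bits_value v by case: x h; case: y => /=; lia.
by rewrite e1 (IH v).
Qed.

Lemma bits_value_lexltb u v : size u = size v ->
  bits_value u < bits_value v -> lexltb (rev u) (rev v).
Proof.
elim: u v => [|x u IH] [|y v] //= [sz] lt.
rewrite !rev_cons lexltb_rcons ?size_rev //.
case: (ltngtP (bits_value u) (bits_value v)) => [/(IH _ sz) ->//|gt|/(bits_value_inj sz) e].
  by exfalso; move: lt gt; case: x; case: y => /=; lia.
rewrite e eqxx /=; move: lt; rewrite e; case: x; case: y => /=; rewrite ?orbT //; lia.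
Qed.

Lemma bits_value_pad u n : bits_value (u ++ nseq n false) = bits_value u.
Proof.
elim: u => [|x u IH] /=; last by rewrite IH.
by elim: n => //= n ->.
Qed.

Lemma FP_map_negb (A : Type) (D : A -> Prop) env u :
  @FP A D env u -> FP D env (fun a => map negb (u a)).
Proof.
move=> fu; pose f a i := [:: ~~ nth false (u a) i].
apply: FP_ext (_ : FP D env (fun a => flatten [seq f a i | i <- iota 0 (size (u a))])) => [a _|].
  rewrite -[in RHS](mkseq_nth false (u a)) /mkseq -map_comp /f.
  by elim: (iota _ _) => //= i l ->.
apply: (FP_flatmap (FPn_size fu)); set D' := (fun p => _).
have sub p : D' p -> D p.1 by case.
exact: (FPb_neg (FPb_nth (FP_index D' env) (FP_index_lift sub fu))).
Qed.

Lemma FPb_lexltb (A : Type) (D : A -> Prop) env u v :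
  @FP A D env u -> FP D env v -> FP D env (fun a => [:: lexltb (u a) (v a)]).
Proof.
move=> fu fv; have bv := FP_pb fv.
pose proj : seq (bitstring * bitstring -> bitstring) := [:: fst; snd].
(* The second component stays empty while the words agree and then holds the verdict. *)
pose stp (a : A) (s : bitstring * bitstring) (x : bool) :=
  (behead s.1,
   if s.2 == [::] then
     (if s.1 == [::] then [:: false] else
      if (if x then head false s.1 else ~~ head false s.1) then [::] else [:: head false s.1])
   else s.2).
pose Inv a (n : nat) (s : bitstring * bitstring) := size s.1 <= size (v a) /\ size s.2 <= 1.
have bb : pbounded D env (fun a => size (v a) + 1) by pb.
have fd : FP D env (fun a => (foldl (stp a) (v a, [::]) (u a)).2).
  apply: (@FP_fold _ _ _ _ _ proj (fun a => (v a, [::])) stp Inv _ 1 _ _ _ fu _ _ _ _ bb) => //.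
  - by split=> //; split=> //; exact: FP_const.
  - move=> D0 _; set E := loop_env _ _.
    have f1 D' : FP D' E (fun p => p.2.2.1) by exact: (@FP_loop_state _ _ _ _ _ 0 fst).
    have f2 D' : FP D' E (fun p => p.2.2.2) by exact: (@FP_loop_state _ _ _ _ _ 1 snd).
    have fx D' : FP D' E (fun p => [:: head false p.2.1]) by exact: FPb_head (FP_loop_word _ _ _).
    have fh D' := FPb_head (f1 D').
    have fe D' : FP D' E (fun p => [:: if head false p.2.1 then head false p.2.2.1
                                       else ~~ head false p.2.2.1]).
      apply: FP_ext (FP_if (fx _) (fh _) (FPb_neg (fh _))) => p _.
      by case: (head _ p.2.1).
    split; first exact: FP_behead (f1 _).
    split=> //.
    exact: (FP_if (FPb_nil (f2 D0)) (FP_if (FPb_nil (f1 _)) (FP_const _ _ [:: false])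
      (FP_if (fe _) (FP_nil _ _) (fh _))) (f2 _)).
  - move=> a b n [r d] _ [/= h1 h2]; split; first by rewrite /= size_behead; apply: leq_trans h1; exact: leq_pred.
    by rewrite /=; do !case: ifP.
  - by move=> a n [r d] _ [/= h1 h2]; rewrite /env_size /= addn0 leq_add.
apply: FP_ext (FPb_head fd) => a _; congr cons.
have stay w r b : (foldl (stp a) (r, [:: b]) w).2 = [:: b] by elim: w r => //= x w IH r; apply: IH.
have stepE x y r : stp a (y :: r, [::]) x = if x == y then (r, [::]) else (r, [:: y]).
  by rewrite /stp /=; case: x; case: y.
elim: (u a) (v a) => [|x w IH] [|y r] //; first by rewrite (stay w).
by rewrite [foldl _ _ _]/= stepE /=; case: eqP => _; rewrite ?stay ?IH.
Qed.

(** The marker [true] followed by zeros gives solutions of various lengths codes of one length, as a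
    circuit requires. Decoding strips the final zeros and the marker, and is defined on every
    bitstring. *)
Definition encode_solution (L : nat) (s : bitstring) : bitstring :=
  s ++ true :: nseq (L - (size s).+1) false.

Definition decode_solution (a : bitstring) : bitstring :=
  rev (behead (drop (find id (rev a)) (rev a))).

Lemma size_encode_solution L s : size s < L -> size (encode_solution L s) = L.
Proof. by move=> lt; rewrite size_cat /= size_nseq addnS -addSn subnKC. Qed.

Lemma encode_solutionK L s : decode_solution (encode_solution L s) = s.
Proof.
rewrite /decode_solution /encode_solution rev_cat rev_cons -cats1 -catA.
have -> n : rev (nseq n false) = nseq n false.
  elim: n => //= n IH; rewrite rev_cons IH.
  by elim: n {IH} => //= n ->.
set n := _ - _; have -> : find id (nseq n false ++ [:: true] ++ rev s) = n.
  by elim: n => //= n ->.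
by rewrite drop_size_cat ?size_nseq //= revK.
Qed.

Lemma FP_decode_solution (A : Type) (D : A -> Prop) env u :
  @FP A D env u -> FP D env (fun a => decode_solution (u a)).
Proof.
move=> fu; have fr := FP_rev fu.
have fn : FPn D env (fun a => find id (rev (u a))).
  apply: FP_ext (FPn_lead (FP_map_negb fr)) => a _.
  by elim: (rev (u a)) => //= -[] //= x IH; rewrite -!IH.
exact: FP_rev (FP_behead (FP_drop fn fr)).
Qed.

(** * Selecting an element of an encoded list of strings *)

Record pick_state := PickState {
  pk_mode : nat;
  pk_cur : bitstring;
  pk_best : bitstring
}.

(* Scanning an encoded list of strings: mode 0 expects a string, 1 an element
   of it, 2 reads its bit; [pk_cur] is the reversed string read so far. *)
Definition pick_step (good : bitstring -> bool) (s : pick_state) (b : bool) : pick_state :=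
  let m := pk_mode s in
  PickState
    (if m == 0 then (if b then 1 else 3) else
     if m == 1 then (if b then 2 else 0) else
     if m == 2 then 1 else 3)
    (if m == 0 then [::] else if m == 2 then b :: pk_cur s else pk_cur s)
    (if [&& m == 1, ~~ b & good (rev (pk_cur s))] then rev (pk_cur s) else pk_best s).

Definition pick (good : bitstring -> bool) (best s : bitstring) : bitstring :=
  if good s then s else best.

Lemma pick_string good cur best t :
  foldl (pick_step good) (PickState 1 cur best) (encode_seq encode_bit t) =
  PickState 0 (catrev t cur) (pick good best (rev (catrev t cur))).
Proof.
elim: t cur => [|b t IH] cur //=.
have -> : pick_step good (pick_step good (PickState 1 cur best) true) b =
    PickState 1 (b :: cur) best by rewrite /pick_step /=.
exact: IH.
Qed.

Lemma pick_strings good cur best l :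
  pk_best (foldl (pick_step good) (PickState 0 cur best) (encode_strings l)) =
  foldl (pick good) best l.
Proof.
elim: l cur best => [|t l IH] cur best //=.
have -> : pick_step good (PickState 0 cur best) true = PickState 1 [::] best by [].
rewrite foldl_cat (pick_string good [::] best t) /= -/(rev t) revK.
exact: IH.
Qed.

Lemma pick_good good best l : has good l -> good (foldl (pick good) best l).
Proof.
have keep l' b : good b -> good (foldl (pick good) b l').
  by elim: l' b => //= s l' IH b gb; apply: IH; rewrite /pick; case: ifP.
elim: l best => //= s l IH best /orP[gs|/IH//]; apply: keep.
by rewrite /pick gs.
Qed.

Lemma pick_all (Q : bitstring -> Prop) good best l : Q best ->
  (forall s, s \in l -> Q s) -> Q (foldl (pick good) best l).
Proof.
elim: l best => //= s l IH best Qb Ql; apply: IH => [|s' h].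
  by rewrite /pick; case: ifP => // _; apply: Ql; rewrite mem_head.
by apply: Ql; rewrite inE h orbT.
Qed.

Lemma FP_pick (A : Type) (D : A -> Prop) env (good : A -> bitstring -> bool)
    (best : A -> bitstring) (l : A -> seq bitstring) :
  FP (fun p : A * bitstring => D p.1) (lift_env fst env ++ [:: snd]) (fun p => [:: good p.1 p.2]) ->
  FP D env best -> FP D env (fun a => encode_strings (l a)) ->
  FP D env (fun a => foldl (pick (good a)) (best a) (l a)).
Proof.
move=> fg fbest fw; have bbest := FP_pb fbest; have bw := FP_pb fw.
pose w a := encode_strings (l a).
pose proj : seq (pick_state -> bitstring) :=
  [:: fun s => nseq (pk_mode s) true; pk_cur; pk_best].
pose Inv a n s := [/\ pk_mode s <= 3, size (pk_cur s) + n <= size (w a) &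
  size (pk_best s) <= size (best a) + size (w a)].
have bb : pbounded D env (fun a => 3 + (size (w a) + (size (best a) + size (w a)))) by pb.
apply: (@FP_fold _ _ _ _ w proj (fun a => PickState 0 [::] (best a))
  (fun a => pick_step (good a)) Inv _ 2 _ _ _ fw _ _ _ _ bb) => //.
- by move=> a _; rewrite /st /= pick_strings.
- split; first exact: (FP_const _ _ [::]).
  by split; first exact: (FP_const _ _ [::]).
- move=> D0 sub; set E := loop_env _ _.
  have fm D' : FPn D' E (fun p => pk_mode p.2.2).
    exact: (@FP_loop_state _ _ _ _ _ 0 (fun s => nseq (pk_mode s) true)).
  have fc D' : FP D' E (fun p => pk_cur p.2.2) by exact: (@FP_loop_state _ _ _ _ _ 1 pk_cur).
  have fo D' : FP D' E (fun p => pk_best p.2.2) by exact: (@FP_loop_state _ _ _ _ _ 2 pk_best).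
  have fb D' : FP D' E (fun p => [:: head false p.2.1]) by exact: FPb_head (FP_loop_word _ _ _).
  have is_mode D' k : FP D' E (fun p => [:: pk_mode p.2.2 == k]).
    by apply: FPb_eqn => //; exact: FPn_const.
  have fgood : FP D0 E (fun p => [:: good p.1 (rev (pk_cur p.2.2))]).
    apply: (@FP_subst _ _ _ _ _ _ (fun p => (p.1, rev (pk_cur p.2.2))) _ _ fg) => //.
    rewrite /lift_env map_cat -map_comp.
    have main env0 env1 : env = env1 ++ env0 -> FPall D0 E
       ([seq ((fun g a => g (a.1, rev (pk_cur a.2.2))) \o
         (fun (g : A -> bitstring) (b : A * bitstring) => g b.1)) x | x <- env0] ++
        [:: fun a => rev (pk_cur a.2.2)]).
      elim: env0 env1 => [|g env0 IH] env1 e /=; first by split=> //; exact: FP_rev (fc _).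
      split; last by apply: (IH (rcons env1 g)); rewrite e cat_rcons.
      apply: (@FP_var_of _ _ _ (size env1)) => [[a [x s]] _] /=.
      rewrite st_loop_env ifT; last by rewrite e size_cat /=; lia.
      by rewrite /st e nth_cat ltnn subnn.
    exact: (main env [::]).
  split.
    apply: FP_ext (FP_if (is_mode D0 0) (FP_if (fb _) (FPn_const _ _ 1) (FPn_const _ _ 3))
      (FP_if (is_mode _ 1) (FP_if (fb _) (FPn_const _ _ 2) (FPn_const _ _ 0))
      (FP_if (is_mode _ 2) (FPn_const _ _ 1) (FPn_const _ _ 3)))) => p _ /=.
    by case: (pk_mode p.2.2) => [|[|[|m]]] //=; case: (head _ _).
  split.
    exact: (FP_if (is_mode D0 0) (FP_nil _ _)
      (FP_if (is_mode _ 2) (FP_cat (fb _) (fc _)) (fc _))).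
  split=> //.
  exact: (FP_if (FPb_and (is_mode D0 1) (FPb_and (FPb_neg (fb _)) fgood))
    (FP_rev (fc _)) (fo _)).
- by move=> a _; split=> //=; rewrite leq_addr.
- move=> a b n s _ [h1 h2 h3]; split.
  + by rewrite /=; do !case: ifP.
  + by rewrite /=; do !case: ifP => //= _; lia.
  + by rewrite /=; case: ifP => // _; rewrite size_rev; lia.
- by move=> a n s _ [h1 h2 h3]; rewrite /env_size /= size_nseq; lia.
Qed.

(** * The reduction *)

(* One improvement step of a local search problem, seen on fixed-length
   strings: from the code of a solution, compute the code of a better neighbour
   (of any solution, if the code is not feasible) followed by a value whose
   lexicographic order is the order of improvement. *)
Lemma improvement_step (P : local_search) : in_PLS P ->
  exists (L V : instance P -> nat) (nx vb : instance P -> bitstring -> bitstring),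
  [/\ (exists k l, forall I, L I = (size (encode I) + 2) ^ k + 1 /\
         V I = (size (encode I) + (size (encode I) + 2) ^ k + 2) ^ l + 1),
      FP (fun _ : instance P * bitstring => True)
        [:: (fun Ia => encode Ia.1); snd]
        (fun Ia => let s := decode_solution Ia.2 in
           encode_solution (L Ia.1) (nx Ia.1 s) ++ vb Ia.1 s),
      (forall I s, size (nx I s) < L I),
      (forall I s, size (vb I s) = V I)
    & forall I s, ~~ lexltb (vb I s) (vb I (nx I s)) -> local_optimum I s].
Proof.
case=> [[psz size_sol]] nb_feas pt_feas [start [start_feas pt_start]]
  [digits [digitsE pt_digits]] [nbhd [nbhdE pt_nbhd]].
pose A := (instance P * bitstring)%type.
pose env : seq (A -> bitstring) := [:: fun Is => encode Is.1; snd].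
have [k psz_k] := poly_pow psz.
have ff : FP (fun=> True) env (fun Is => [:: feasible Is.1 Is.2]).
  exact: (polytime_FP (env := env) _ pt_feas).
have fd : FP (fun Is : A => feasible Is.1 Is.2) env (fun Is => digits Is.1 Is.2).
  exact: (polytime_FP (env := env) _ pt_digits).
have fn : FP (fun Is : A => feasible Is.1 Is.2) env (fun Is => encode_strings (nbhd Is.1 Is.2)).
  exact: (polytime_FP (env := env) _ pt_nbhd).
have fst : FP (fun=> True) env (fun Is => start Is.1).
  have h := polytime_FP (env := [:: @encode P]) (fun _ _ => erefl) pt_start.
  by apply: (@FP_lift _ _ _ _ [:: @encode P] (fun Is : A => Is.1) [:: snd] start _ h).
have [l bl] := FP_pb fd.
pose n (I : instance P) := size (encode I).
pose B I := (n I + 2) ^ k.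
pose DV I := (n I + B I + 2) ^ l.
have size_feas I s : feasible I s -> size s <= B I.
  by move=> fs; apply: leq_trans (size_sol _ _ fs) (psz_k _).
have size_dig I s : feasible I s -> size (digits I s) <= DV I.
  move=> fs; apply: leq_trans (bl (I, s) fs) _; rewrite /DV /env_size /= addn0.
  have := size_feas I s fs; rewrite /n; case: (l) => // l' le.
  by rewrite leq_exp2r // !leq_add2r leq_add2l.
(* Padding to a common length and putting the most significant digit first turns numerical order
   into lexicographic order. *)
pose pad I s := rev (digits I s ++ nseq (DV I - size (digits I s)) false).
(* The leading bit ranks every feasible solution above every other string; negating the digits turns
   minimization into maximization. *)
pose vb I s := if feasible I s then
    true :: (if maximizes P then pad I s else map negb (pad I s))
  else false :: nseq (DV I) false.
have size_pad I s : feasible I s -> size (pad I s) = DV I.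
  by move=> fs; rewrite size_rev size_cat size_nseq subnKC // size_dig.
have vb_lt I s s' : feasible I s -> feasible I s' -> better I s' s -> lexltb (vb I s) (vb I s').
  move=> fs fs'; rewrite /better /vb fs fs' /=.
  have h t t' : feasible I t -> feasible I t' -> payoff I t < payoff I t' ->
      lexltb (pad I t) (pad I t').
    move=> ft ft'; rewrite -!digitsE // => lt; apply: bits_value_lexltb.
      by rewrite -[LHS]size_rev -[RHS]size_rev !size_pad.
    by rewrite !bits_value_pad.
  case: (maximizes P) => lt; first exact: h.
  by rewrite lexltb_negb ?size_pad //; apply: h.
(* The search starts from [s] itself, which is returned when no neighbour has a larger value
   string. *)
pose nx I s := if feasible I s then foldl (pick (fun s' => lexltb (vb I s) (vb I s'))) s (nbhd I s)
  else start I.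
have nx_feas I s : feasible I (nx I s).
  rewrite /nx; case: ifP => // fs; apply: (@pick_all (fun s' => feasible I s')) => // s'.
  by rewrite nbhdE // => /(nb_feas _ _ _ fs).
have fnI D : FPn D env (fun Is => n Is.1) by apply: FPn_size; exact: (@FP_var_of _ _ _ 0).
have fB D : FPn D env (fun Is => B Is.1).
  by apply: FPn_exp; apply: FPn_add (fnI D) (FPn_const _ _ 2).
have fDV D : FPn D env (fun Is => DV Is.1).
  by apply: FPn_exp; apply: FPn_add (FPn_const _ _ 2); apply: FPn_add.
have fzeros D (m : A -> nat) : FPn D env m -> FP D env (fun Is => nseq (m Is) false).
  move=> fm; apply: FP_ext (FP_map_negb fm) => Is _; exact: map_nseq.
have feasE D : FP D env (fun Is => [:: feasible Is.1 Is.2]) by apply: FP_sub ff.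
have fvb : FP (fun=> True) env (fun Is => vb Is.1 Is.2).
  apply: FP_if => //; last by apply: FP_cons; exact: fzeros.
  apply: FP_cons.
  have fd' : FP (fun Is : A => True /\ feasible Is.1 Is.2) env (fun Is => digits Is.1 Is.2).
    by apply: FP_sub fd => Is [].
  have fp : FP (fun Is : A => True /\ feasible Is.1 Is.2) env (fun Is => pad Is.1 Is.2).
    by apply: FP_rev; apply: FP_cat => //; apply: fzeros; apply: FPn_sub => //; exact: FPn_size.
  by case: (maximizes P) => //; exact: FP_map_negb.
have fnx : FP (fun=> True) env (fun Is => nx Is.1 Is.2).
  apply: FP_if => //; last by apply: FP_sub fst.
  apply: (@FP_pick A _ env (fun Is s' => lexltb (vb Is.1 Is.2) (vb Is.1 s')) snd).
  - apply: FPb_lexltb; first exact: FP_lift (fun _ _ => I) fvb.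
    apply: (@FP_subst _ _ _ _ _ _ (fun p => (p.1.1, p.2)) _ _ fvb) => //.
    split; first exact: (@FP_var_of _ _ _ 0).
    by split=> //; exact: (@FP_var_of _ _ _ 2).
  - exact: (@FP_var_of _ _ _ 1).
  - by apply: FP_sub fn => Is [].
exists (fun I => B I + 1), (fun I => DV I + 1), nx, vb; split.
- by exists k, l.
- have fs : FP (fun=> True) env (fun Ia => decode_solution Ia.2).
    by apply: FP_decode_solution; exact: (@FP_var_of _ _ _ 1).
  have fenv : FPall (fun=> True) env [seq (fun Ia : A => g (Ia.1, decode_solution Ia.2)) | g <- env].
    by split; [exact: (@FP_var_of _ _ _ 0) | split].
  have f1 := FP_subst (h := fun Ia : A => (Ia.1, decode_solution Ia.2)) (fun _ _ => I) fnx fenv.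
  have f2 := FP_subst (h := fun Ia : A => (Ia.1, decode_solution Ia.2)) (fun _ _ => I) fvb fenv.
  apply: FP_cat; last exact: f2.
  apply: FP_cat; first exact: f1.
  apply: FP_cons; apply: fzeros.
  apply: FPn_sub; first by apply: FPn_add (fB _) (FPn_const _ _ 1).
  by apply: FPn_S; exact: FPn_size f1.
- by move=> I s; rewrite addn1 ltnS size_feas.
- move=> I s; rewrite /vb; case: ifP => fs /=; last by rewrite size_nseq addn1.
  by rewrite addn1; case: ifP => _; rewrite ?size_map size_pad.
(* An infeasible string is improved by the starting solution, so it never satisfies the
   hypothesis. *)
- move=> I s; case: (boolP (feasible I s)) => fs; last first.
    by rewrite {1}/vb (negPf fs) {1}/vb nx_feas.
  move=> nlt; split=> // s' nbs'; apply: contra nlt => bt.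
  rewrite /nx fs; apply: (@pick_good (fun s'' => lexltb (vb I s) (vb I s''))); apply/hasP; exists s'; first by rewrite nbhdE.
  by apply: vb_lt => //; exact: nb_feas nbs'.
Qed.

Lemma PLS_hard (P : local_search) : in_PLS P -> PLS_reducible P (lex_SAT_FLIP 3 2).
Proof.
move=> /improvement_step [L [V [nx [vb [[k [l LVE]] fPhi size_nx size_vb optP]]]]].
pose A := (instance P * bitstring)%type.
pose n (I : instance P) := size (encode I).
pose Phi I a := encode_solution (L I) (nx I (decode_solution a)) ++ vb I (decode_solution a).
case: fPhi => c [Tm [[t bt] hc]].
(* Registers 0 and 1 hold the instance and the code of a solution; the result appears in register 2,
   which must exist. *)
pose K := maxn (maxreg c) 2.
pose M := smach_of c K.
pose T I := (n I + L I + 2) ^ t.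
pose S I := 2 + T I + L I + V I + n I.
have L0 I : 0 < L I by have [-> _] := LVE I; rewrite addn1.
have S_big I : 2 + T I + L I + V I + size (encode I) <= S I by [].
have K_big : 2 <= sK M by rewrite leq_maxr.
have runs I a : size a = L I -> forall s0 : store,
    (forall i, s0 i = if i == 0 then encode I else if i == 1 then a else [::]) ->
    (iter (T I) (@mstep M) (sinit M, s0)).2 2 = Phi I a.
  move=> sa s0 s0E; have [j lj e] := hc (I, a) Logic.I.
  have -> : s0 = st [:: (fun Ia : A => encode Ia.1); snd] (I, a).
    by apply: functional_extensionality => -[|[|i]]; rewrite s0E // st_out.
  have jT : j <= T I.
    apply: leq_trans lj (leq_trans (bt _ Logic.I) _).
    by rewrite /env_size /= addn0 /T sa.
  rewrite -(subnK jT) iterD (exec_smach (K := K) _ e) ?leq_maxl //.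
  have -> d s' : iter d (@mstep M) (sfin M, s') = (sfin M, s').
    by elim: d => //= d ->; rewrite /mstep eqxx.
  by rewrite /= upd_eq.
have wfI I := circuit_wf (L0 I) (S_big I) K_big.
pose NV I := circuit_vars M (L I) (V I) (T I) (S I).
pose ow I j := tout M (L I) (out_index M (T I) (S I) j).
have ow_lt I j : j < L I + V I -> ow I j < NV I.
  by move=> lj; apply: (tout_lt (L0 I) (S_big I) K_big); rewrite /out_index ltn_add2l.
have nw_lt I j : j < L I -> ow I j < NV I by move=> lj; apply: ow_lt; lia.
have vw_lt I j : j < V I -> ow I (L I + j) < NV I by move=> lj; apply: ow_lt; lia.
have kF I : kcnf 3 (reduced_cnf M (L I) (V I) (T I) (S I) (encode I)).
  exact: formula_kcnf (wfI I) (nw_lt I) (vw_lt I).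
pose f I : instance (lex_SAT_FLIP 3 2) := exist (fun F => kcnf 3 F) _ (kF I).
(* The solution is read off the inputs of the copy that variable 0 declares active. *)
pose inp (s : bitstring) (m : nat) := [seq nth false s (cvar (nth false s 0) j) | j <- iota 0 m].
pose g I s := decode_solution (inp s (L I)).
exists f, g; split.
- pose env : seq (instance P -> bitstring) := [:: @encode P].
  have fx : FP (fun=> True) env (@encode P) by exact: (@FP_var_of _ _ _ 0).
  have fn : FPn (fun=> True) env n by exact: FPn_size.
  have fB : FPn (fun=> True) env (fun I => (n I + 2) ^ k).
    by apply: FPn_exp; apply: FPn_add fn (FPn_const _ _ 2).
  have fL : FPn (fun=> True) env L.
    by apply: FP_ext (FPn_add fB (FPn_const _ _ 1)) => I _; have [-> _] := LVE I.
  have fV : FPn (fun=> True) env V.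
    apply: FP_ext (FPn_add (FPn_exp l (FPn_add (FPn_add fn fB) (FPn_const _ _ 2))) (FPn_const _ _ 1)) => I _.
    by have [_ ->] := LVE I.
  have fT : FPn (fun=> True) env T.
    exact: (FPn_exp t (FPn_add (FPn_add fn fL) (FPn_const _ _ 2))).
  have fS : FPn (fun=> True) env S.
    exact: (FPn_add (FPn_add (FPn_add (FPn_add (FPn_const _ _ 2) fT) fL) fV) fn).
  exact: FP_polytime (FP_reduced_cnf M fx fL fV fT fS).
- pose env : seq (A -> bitstring) := [:: (fun Is => encode Is.1); snd].
  set D := (fun Is => _).
  apply: (FP_polytime (env := env)); apply: FP_decode_solution.
  have fs : FP D env snd by exact: (@FP_var_of _ _ _ 1).
  have fL : FPn D env (fun Is => L Is.1).
    have fn : FPn D env (fun Is => n Is.1) by apply: FPn_size; exact: (@FP_var_of _ _ _ 0).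
    apply: FP_ext (FPn_add (FPn_exp k (FPn_add fn (FPn_const _ _ 2))) (FPn_const _ _ 1)) => Is _.
    by have [-> _] := LVE Is.1.
  pose h (Is : A) j := [:: nth false Is.2 (cvar (nth false Is.2 0) j)].
  apply: FP_ext (_ : FP D env (fun Is => flatten [seq h Is j | j <- iota 0 (L Is.1)])) => [Is _|].
    by rewrite /inp /h; elim: (iota _ _) => //= j m ->.
  apply: (FP_flatmap fL); set D' := (fun p => _).
  have sub p : D' p -> D p.1 by case.
  have fs' := FP_index_lift sub fs; have fj := FP_index D' env.
  apply: FPb_nth; last exact: fs'.
  apply: FPn_S.
  have fj2 : FPn D' (index_env env) (fun p => p.2.*2).
    by apply: FP_ext (FPn_add fj fj) => p _; rewrite addnn.
  apply: FP_ext (FPn_add fj2 (FPn_if (FPb_nth (FPn_const _ _ 0) fs') (FPn_const _ _ 1) (FPn_const _ _ 0))) => p _.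
  by case: (nth _ _ _).
- move=> I s [/= /eqP sz opt]; apply: optP.
  have sz' : size s = ((NV I).*2 + V I).+1 by [].
  set F := clauses (reduced_cnf M (L I) (V I) (T I) (S I) (encode I)).
  have opt' i j : ~~ (pv s F < pv (flip i (flip j s)) F).
    have := opt (flip i (flip j s)); rewrite /better /= -!lex_digitsP; apply.
    rewrite /flip_neighbor /is_assignment !size_flip sz eqxx /=.
    have h1 := flips_flip s (flip j s) i; have h2 := flips_flip s s j.
    by apply: leq_trans h1 _; move: h2; rewrite flipsxx add0n -ltnS -addn1.
  pose b := nth false s 0.
  pose al b v := nth false s (cvar b v).
  have act : all (gate_ok (al b)) (circuit M (L I) (V I) (T I) (S I) (encode I)).
    apply/allP => gt; exact: (active_ok (wfI I) sz' opt').
  have ina : all (gate_ok (al (~~ b))) (circuit M (L I) (V I) (T I) (S I) (encode I)).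
    apply/allP => gt; exact: (inactive_ok (wfI I) sz' opt').
  have out b' : all (gate_ok (al b')) (circuit M (L I) (V I) (T I) (S I) (encode I)) ->
      forall j, j < L I + V I ->
      al b' (ow I j) = nth false (Phi I [seq al b' j | j <- iota 0 (L I)]) j.
    move=> ok; pose s0 : store := fun i => if i == 0 then encode I else
      if i == 1 then [seq al b' j | j <- iota 0 (L I)] else [::].
    apply: (circuit_ok (L0 I) (S_big I) K_big ok (s' := s0)) => //.
    by apply: runs => //; rewrite size_map size_iota.
  have out1 := out _ act; have out2 := out _ ina.
  set a1 := [seq al b j | j <- _] in out1; set a2 := [seq al (~~ b) j | j <- _] in out2.
  have gE : g I s = decode_solution a1 by [].
  set s1 := decode_solution a1 in gE.
  have size_enc : size (encode_solution (L I) (nx I s1)) = L I by rewrite size_encode_solution.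
  (* At a local optimum the inactive copy has the improved solution as its input, so its value bits
     are those of [nx I s1]. *)
  have a2E : a2 = encode_solution (L I) (nx I s1).
    apply: (@eq_from_nth _ false); first by rewrite size_map size_iota size_enc.
    move=> j; rewrite size_map size_iota => lj.
    rewrite (nth_map 0) ?size_iota // nth_iota // add0n.
    rewrite [LHS](inactive_input (wfI I) sz' opt' lj).
    rewrite [LHS](out1 j); last by lia.
    by rewrite nth_cat size_enc lj.
  have val1 j : j < V I -> al b (ow I (L I + j)) = nth false (vb I s1) j.
    move=> lj; rewrite out1 ?ltn_add2l // nth_cat size_enc ltnNge leq_addr /=.
    by rewrite addKn.
  have val2 j : j < V I -> al (~~ b) (ow I (L I + j)) = nth false (vb I (nx I s1)) j.
    move=> lj; rewrite out2 ?ltn_add2l // a2E /Phi encode_solutionK nth_cat.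
    by rewrite size_encode_solution // ltnNge leq_addr /= addKn.
  (* A better value would first differ at a bit that is false in the active copy and true in the
     inactive one, which [no_switch] excludes. *)
  rewrite gE; apply/negP => /lexltbP [j [lj eqs v0 v1]].
  rewrite size_vb in lj.
  apply: (no_switch (wfI I) (vw_lt I) sz' opt' lj).
  + move=> i li; have lV := ltn_trans li lj.
    by rewrite [LHS]val1 // [RHS]val2 // eqs.
  + by rewrite [LHS]val1.
  + by rewrite [LHS]val2.
Qed.

Theorem theorem2 : PLS_complete (lex_SAT_FLIP 3 2).
Proof. by split; [exact: lex_SAT_FLIP_in_PLS | exact: PLS_hard]. Qed.
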